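(* Let $\beta,\gamma\in(0,1)$ with $\beta+\gamma=1$. Let $ds^2$ be a reducible spherical conical metric on the Riemann sphere $\bar{\mathbb{C}}=\mathbb{C}\cup\{\infty\}$ with exactly three cone points, of angles $4\pi$, $2\pi\beta$, $2\pi\gamma$ (the ''heart shape''). Place the cone point of angle $4\pi$ at $z=0$, and choose the coordinate so that $\infty$ is a pole of the associated character 1-form with residue $-1$ (a smooth point of $ds^2$). Then, up to a change of coordinate $z\mapsto pz$ with $p\in\mathbb{C}\setminus\{0\}$, the character 1-form of $ds^2$ is $$\omega=\frac{z}{(z-1)\left(z+\frac{\gamma}{\beta}\right)}\,dz,$$ and there is a real one-parameter family of such metrics, given for $c\in\mathbb{R}$ by $$ds^{2}=\frac{4e^{c}\,|z-1|^{2(\beta-1)}\,\left|z+\tfrac{\gamma}{\beta}\right|^{2(\gamma-1)}\,|z|^{2}}{\left[1+e^{c}\,|z-1|^{2\beta}\,\left|z+\tfrac{\gamma}{\beta}\right|^{2\gamma}\right]^{2}}\,|dz|^2 .$$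
   Context: A conical metric on a compact Riemann surface $\mathcal{M}$ is a metric smooth away from finitely many points $p_k$, near each of which it has the form $dr^2+\beta_k^2r^2d\theta^2$ (cone angle $2\pi\beta_k$); it is spherical if it has constant Gaussian curvature $1$. Away from cone points such a metric is locally the pullback $F^*\!\left(\frac{4|dw|^2}{(1+|w|^2)^2}\right)$ of the round metric by a multivalued locally univalent meromorphic function $F$ (the developing map); the metric is called reducible if the monodromy of $F$ can be chosen to lie in the diagonal subgroup $\{w\mapsto e^{i\theta}w\}\cong U(1)$ of $PSU(2)$. For a reducible spherical conical metric there is an associated character 1-form $\omega$: an Abelian differential of the third kind (meromorphic 1-form with only simple poles) on $\mathcal{M}$, all of whose residues are nonzero real numbers and whose real part is exact off its poles, together with a smooth function $\Phi:\mathcal{M}\setminus\{\text{poles of }\omega\}\to(0,4)$ satisfying $\frac{4\,d\Phi}{\Phi(4-\Phi)}=\omega+\overline{\omega}$, such that $ds^2=\frac{\Phi(4-\Phi)}{4}\,\omega\overline{\omega}$. A zero of $\omega$ of order $m$ is a cone point of angle $2\pi(m+1)$; a pole $p$ is a cone point of angle $2\pi|\mathrm{Res}_p\omega|$, and a smooth point if $\mathrm{Res}_p\omega=\pm1$. *)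

(* Defs.v *)
(* Complex numbers: Coquelicot's [C] (= R * R),
   complex differentiability: Coquelicot's [ex_derive] over [C_AbsRing].
   The Riemann sphere is C ∪ {∞}; everything is written in the global
   coordinate z on C, and near ∞ in the coordinate w = 1/z. *)
From Stdlib Require Export Reals List.
From Coquelicot Require Export Coquelicot.
Export ListNotations.
Open Scope R_scope.

Definition cont_at (u : C -> R) (z : C) : Prop :=
  forall eps, 0 < eps -> exists del, 0 < del /\
    forall w, Cmod (Cminus w z) < del -> Rabs (u w - u z) < eps.

Definition holo_disc (g : C -> C) (p : C) (del : R) : Prop :=
  forall z, Cmod (Cminus z p) < del -> ex_derive g z.

Definition simple_pole (f : C -> C) (p r : C) : Prop :=
  exists del, 0 < del /\ exists g : C -> C, holo_disc g p del /\ g p = r /\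
    forall z, 0 < Cmod (Cminus z p) < del -> Cmult (Cminus z p) (f z) = g z.

Definition removable (f : C -> C) (p : C) : Prop :=
  exists del, 0 < del /\ exists g : C -> C, holo_disc g p del /\
    forall z, 0 < Cmod (Cminus z p) < del -> f z = g z.

(** The 1-form f(z) dz written in the chart w = 1/z at ∞:
    f(1/w) d(1/w) = - f(1/w)/w^2 dw. *)
Definition coeff_inf (f : C -> C) : C -> C :=
  fun w => Copp (Cdiv (f (Cinv w)) (Cmult w w)).

(** ω = f dz is an Abelian differential of the third kind on the sphere
    (only simple poles) whose residues are all nonzero reals.
    [P] = finite poles, [infp] = whether ∞ is a pole. *)
Definition third_kind_real (f : C -> C) (P : list C) (infp : bool) : Prop :=
  NoDup P /\
  (forall z, ~ In z P -> ex_derive f z) /\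
  (forall p, In p P -> exists r : R, r <> 0 /\ simple_pole f p (RtoC r)) /\
  (if infp then exists r : R, r <> 0 /\ simple_pole (coeff_inf f) 0 (RtoC r)
   else removable (coeff_inf f) 0).

(** Re ω = Re f dx - Im f dy is exact on C minus the poles. *)
Definition re_exact (f : C -> C) (P : list C) : Prop :=
  exists h : C -> R, forall x y, ~ In (x, y) P ->
    is_derive (fun t => h (t, y)) x (Re (f (x, y))) /\
    is_derive (fun t => h (x, t)) y (- Im (f (x, y))).

(** ω = f dz is a character 1-form of the metric ds^2 = ρ |dz|^2:
    third kind, real nonzero residues, Re ω exact, and there is a smooth
    Φ : sphere \ poles -> (0,4) with 4 dΦ / (Φ(4-Φ)) = ω + conj ω and
    ds^2 = Φ(4-Φ)/4 · ω conj(ω).  (ω + conj ω = 2 Re f dx - 2 Im f dy.)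
    The metric identity is required away from poles and zeros of ω
    (zeros of ω are cone points, where ρ is not meaningful). *)
Definition character_form (rho : C -> R) (f : C -> C) : Prop :=
  exists (P : list C) (infp : bool),
    third_kind_real f P infp /\ re_exact f P /\
    exists Phi : C -> R,
      (forall x y, ~ In (x, y) P ->
         0 < Phi (x, y) < 4 /\ cont_at Phi (x, y) /\
         is_derive (fun t => Phi (t, y)) x
           (Phi (x, y) * (4 - Phi (x, y)) / 2 * Re (f (x, y))) /\
         is_derive (fun t => Phi (x, t)) y
           (- (Phi (x, y) * (4 - Phi (x, y)) / 2 * Im (f (x, y))))) /\
      (forall z, ~ In z P -> f z <> RtoC 0 ->
         rho z = Phi z * (4 - Phi z) / 4 * (Cmod (f z)) ^ 2) /\
      (if infp then True else
         exists L, 0 < L < 4 /\ forall eps, 0 < eps -> exists del, 0 < del /\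
           forall w, 0 < Cmod w < del -> Rabs (Phi (Cinv w) - L) < eps).

Definition is_laplacian (g : C -> R) (z : C) (l : R) : Prop :=
  exists del, 0 < del /\ exists gx gy : C -> R,
    (forall x y, Cmod (Cminus (x, y) z) < del ->
       is_derive (fun t => g (t, y)) x (gx (x, y)) /\
       is_derive (fun t => g (x, t)) y (gy (x, y))) /\
    exists gxx gyy : R,
      is_derive (fun t => gx (t, snd z)) (fst z) gxx /\
      is_derive (fun t => gy (fst z, t)) (snd z) gyy /\
      gxx + gyy = l.

(** ρ|dz|^2 is a smooth metric of Gaussian curvature 1 at z:
    ρ > 0, continuous, and K = -(1/(2ρ)) Δ log ρ = 1. *)
Definition curv1_at (rho : C -> R) (z : C) : Prop :=
  0 < rho z /\ cont_at rho z /\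
  is_laplacian (fun w => ln (rho w)) z (- 2 * rho z).

(** Cone point of angle 2πα at p:
    ρ = |z - p|^{2(α-1)} e^{u} near p with u continuous. *)
Definition cone_at (rho : C -> R) (p : C) (alpha : R) : Prop :=
  exists del, 0 < del /\ exists u : C -> R,
    (forall z, Cmod (Cminus z p) < del -> cont_at u z) /\
    forall z, 0 < Cmod (Cminus z p) < del ->
      rho z = Rpower (Cmod (Cminus z p)) (2 * (alpha - 1)) * exp (u z).

(** ds^2 = ρ|dz|^2 is a spherical conical metric on the Riemann sphere whose
    cone points are exactly the listed finite points (with the listed angles
    2π·α); all other points, including ∞, are smooth points of curvature 1.
    Near ∞ the metric in the chart w = 1/z is ρ(1/w)/|w|^4 |dw|^2. *)
Definition sph_conical_metric (rho : C -> R) (cones : list (C * R)) : Prop :=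
  NoDup (map fst cones) /\
  (forall pa, In pa cones -> 0 < snd pa /\ cone_at rho (fst pa) (snd pa)) /\
  (forall z, ~ In z (map fst cones) -> curv1_at rho z) /\
  (exists (rt : C -> R) (del : R), 0 < del /\
     (forall w, 0 < Cmod w < del -> rt w = rho (Cinv w) / (Cmod w) ^ 4) /\
     curv1_at rt 0).

Definition omega0 (beta gamma : R) (z : C) : C :=
  Cdiv z (Cmult (Cminus z 1) (Cplus z (RtoC (gamma / beta)))).

Definition rho_c (beta gamma c : R) (z : C) : R :=
  4 * exp c * Rpower (Cmod (Cminus z 1)) (2 * (beta - 1))
    * Rpower (Cmod (Cplus z (RtoC (gamma / beta)))) (2 * (gamma - 1))
    * (Cmod z) ^ 2
  / (1 + exp c * Rpower (Cmod (Cminus z 1)) (2 * beta)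
       * Rpower (Cmod (Cplus z (RtoC (gamma / beta)))) (2 * gamma)) ^ 2.

(* Main.v *)
Require Import Defs.
From Stdlib Require Import Lra Psatz Classical ClassicalEpsilon.

(** [is_laplacian] only gives first partials along the axes and second partials at one point, so a
    mean value property is not directly available. The second-derivative test says merely that the
    Laplacian at a maximum is at most 0. A contradiction needs a strictly positive Laplacian, and
    this is why [barrier] contains |w - q|^(-2) besides harmonic logarithms; its singularity at q is
    cut out by a small disc, on which continuity of H gives the bound.

    The one-sided bound at infinity matters: H may grow like k ln |z| with k = 1 - sum r_p of
    unknown sign, and k = 0 comes out only after H is known to be constant. Applied to -ln |N|, the
    same Liouville theorem gives the roots of the numerator.

    Zeros and poles are located through the inequality rho <= |f|^2. The metric sees a residue only
    up to sign, since Phi (4 - Phi) is unchanged by Phi -> 4 - Phi; the relations r_a + r_b = 1 =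
    beta + gamma then fix both signs. *)

(** Off the poles [P] of [f dz], [h = ln (Phi / (4 - Phi)) / 2] satisfies [dh = Re (f dz)], so
    [H = h - sum r_p ln |z - p|] is harmonic off [P].  Its gradient is bounded near [P] and
    is that of [k ln |z|] up to [O(1/|z|^2)] at infinity, so [H] is bounded near [P] and
    bounded above or below at infinity; hence it is constant (Liouville with removable points, by the
    weak maximum principle and logarithmic barriers, which needs no Cauchy theory).  This gives
    [f = sum r_p / (z - p)] with [sum r_p = 1], a quotient of monic polynomials with one
    zero less than poles.  Comparing [rho = Phi (4 - Phi) / 4 |f|^2] with the metric, [a] and
    [b] must be poles, all zeros must be at [0], and the zero at [0] is simple; so the poles are
    exactly [a] and [b].  The local behaviour of [rho] there gives [|r_a| = beta], [|r_b| = gamma],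
    whence [r_a = beta], [r_b = gamma], and the zero at [0] locates [b].

    Conversely [rho_c = 4 e^u / (1 + e^u)^2 |omega0|^2] with
    [u = c + 2 beta ln |z - 1| + 2 gamma ln |z + gamma/beta|] harmonic and [du = 2 Re omega0],
    so the curvature is computed from [Delta (phi (u)) = phi'' (u) |grad u|^2]. *)

(** * Complex derivatives and continuity *)

(** Coquelicot's derivative quantifies over every limit of the filter of neighbourhoods; such a
    limit is [x] itself, which leaves the usual estimate, for R and C at once. *)
Lemma is_derive_eps (K : AbsRing) (V : NormedModule K) (f : K -> V) (x : K) (l : V) :
  is_derive f x l <->
  forall eps, 0 < eps -> exists del, 0 < del /\ forall y, abs (minus y x) < del ->
    norm (minus (minus (f y) (f x)) (scal (minus y x) l)) <= eps * abs (minus y x).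
Proof.
split.
- intros [_ H] eps Heps.
  destruct (H x (fun P HP => HP) (mkposreal eps Heps)) as [d Hd].
  exists d; split; [apply cond_pos|].
  intros y Hy; exact (Hd y Hy).
- intros H; split; [apply is_linear_scal_l|].
  intros x' Hx.
  rewrite <- (is_filter_lim_locally_unique (V := AbsRing_NormedModule K) _ _ Hx).
  intros eps; destruct (H eps (cond_pos eps)) as [d [Hd Hd2]].
  exists (mkposreal d Hd); intros y Hy; exact (Hd2 y Hy).
Qed.

Lemma C_derive_eps (f : C -> C) (z l : C) :
  is_derive (K := C_AbsRing) (V := C_NormedModule) f z l <->
  forall eps, 0 < eps -> exists del, 0 < del /\ forall w, Cmod (w - z) < del ->
    Cmod (f w - f z - (w - z) * l)%C <= eps * Cmod (w - z).
Proof.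
rewrite is_derive_eps.
split; intros H eps Heps; destruct (H eps Heps) as [d [Hd Hd2]];
  exists d; (split; [exact Hd|]); intros w Hw; exact (Hd2 w Hw).
Qed.

Lemma R_derive_eps (f : R -> R) (x l : R) :
  is_derive f x l <->
  forall eps, 0 < eps -> exists del, 0 < del /\ forall y, Rabs (y - x) < del ->
    Rabs (f y - f x - (y - x) * l) <= eps * Rabs (y - x).
Proof. exact (is_derive_eps R_AbsRing R_NormedModule f x l). Qed.

(** The balls of this uniform structure are the discs of [Cmod], so the notion fits both [cont_at]
    and differentiability over [C_AbsRing]. *)
Definition ccont (f : C -> C) (z : C) : Prop :=
  continuous (T := AbsRing_UniformSpace C_AbsRing) (U := AbsRing_UniformSpace C_AbsRing) f z.

Lemma ccont_eps (f : C -> C) (z : C) :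
  ccont f z <-> forall eps, 0 < eps -> exists del, 0 < del /\
    forall w, Cmod (w - z) < del -> Cmod (f w - f z) < eps.
Proof.
split.
- intros H eps Heps.
  destruct (H _ (locally_ball (T := AbsRing_UniformSpace C_AbsRing) (f z) (mkposreal eps Heps))) as [d Hd].
  exists d; split; [apply cond_pos|]; intros w Hw; exact (Hd w Hw).
- intros H P [e He].
  destruct (H e (cond_pos e)) as [d [Hd Hd2]].
  exists (mkposreal d Hd); intros w Hw; apply He; exact (Hd2 w Hw).
Qed.

Lemma cont_at_continuous (u : C -> R) (z : C) :
  cont_at u z <-> continuous (T := AbsRing_UniformSpace C_AbsRing) (U := R_UniformSpace) u z.
Proof.
split.
- intros H P [e He].
  destruct (H e (cond_pos e)) as [d [Hd Hd2]].
  exists (mkposreal d Hd); intros w Hw; apply He; exact (Hd2 w Hw).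
- intros H eps Heps.
  destruct (H _ (locally_ball (u z) (mkposreal eps Heps))) as [d Hd].
  exists d; split; [apply cond_pos|]; intros w Hw; exact (Hd w Hw).
Qed.

Lemma ccont_const (c z : C) : ccont (fun _ => c) z.
Proof. exact (@continuous_const (AbsRing_UniformSpace C_AbsRing) (AbsRing_UniformSpace C_AbsRing) c z). Qed.

Lemma ccont_id (z : C) : ccont (fun w => w) z.
Proof. exact (@continuous_id (AbsRing_UniformSpace C_AbsRing) z). Qed.

Lemma ccont_plus (f g : C -> C) (z : C) :
  ccont f z -> ccont g z -> ccont (fun w => f w + g w)%C z.
Proof.
exact (@continuous_plus (AbsRing_UniformSpace C_AbsRing) C_AbsRing
         (AbsRing_NormedModule C_AbsRing) f g z).
Qed.

Lemma ccont_mult (f g : C -> C) (z : C) :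
  ccont f z -> ccont g z -> ccont (fun w => f w * g w)%C z.
Proof. exact (@continuous_mult (AbsRing_UniformSpace C_AbsRing) C_AbsRing f g z). Qed.

Lemma ccont_minus (f g : C -> C) (z : C) :
  ccont f z -> ccont g z -> ccont (fun w => f w - g w)%C z.
Proof.
exact (@continuous_minus (AbsRing_UniformSpace C_AbsRing) C_AbsRing
         (AbsRing_NormedModule C_AbsRing) f g z).
Qed.

Lemma Cmod_minus_sym (a b : C) : Cmod (a - b) = Cmod (b - a).
Proof. rewrite <- Cmod_opp; f_equal; ring. Qed.

Lemma Cmod_minus_pos (a b : C) : a <> b -> 0 < Cmod (a - b).
Proof. intros H; apply Cmod_gt_0; intros E; apply H, Ceq_minus, E. Qed.

Lemma Cmod_minus_neq (a b : C) : 0 < Cmod (a - b) -> a <> b.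
Proof.
intros H E; subst; replace (b - b)%C with (RtoC 0) in H by ring; rewrite Cmod_0 in H; lra.
Qed.

Lemma Cmod_minus_le (a b c : C) : Cmod (a - c) <= Cmod (a - b) + Cmod (b - c).
Proof. replace (a - c)%C with ((a - b) + (b - c))%C by ring; apply Cmod_triangle. Qed.

Lemma Cmod_triangle_minus (a b : C) : Cmod a <= Cmod (a - b) + Cmod b.
Proof. replace a with ((a - b) + b)%C at 1 by ring; apply Cmod_triangle. Qed.

Lemma ccont_inv (f : C -> C) (z : C) :
  ccont f z -> f z <> 0 -> ccont (fun w => / f w)%C z.
Proof.
intros H Hz; apply ccont_eps; intros eps Heps.
assert (Hm : 0 < Cmod (f z)) by (apply Cmod_gt_0; exact Hz).
(* The first bound keeps |f w| above |f z| / 2; with it the second makes |f w - f z| / (|f w| |f z|)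
   less than eps. *)
assert (He : 0 < Rmin (Cmod (f z) / 2) (eps * (Cmod (f z) * Cmod (f z)) / 2)).
{ apply Rmin_glb_lt; [lra|].
  assert (0 < eps * (Cmod (f z) * Cmod (f z))) by (repeat apply Rmult_lt_0_compat; lra); lra. }
destruct (proj1 (ccont_eps f z) H _ He) as [d [Hd Hd2]].
exists d; split; [exact Hd|]; intros w Hw; specialize (Hd2 w Hw).
assert (H1 := Rmin_l (Cmod (f z) / 2) (eps * (Cmod (f z) * Cmod (f z)) / 2)).
assert (H2 := Rmin_r (Cmod (f z) / 2) (eps * (Cmod (f z) * Cmod (f z)) / 2)).
assert (H3 := Cmod_triangle_minus (f z) (f w)).
rewrite Cmod_minus_sym in H3.
assert (Hfw : Cmod (f z) / 2 < Cmod (f w)) by lra.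
assert (Hfw0 : f w <> 0) by (apply Cmod_gt_0; lra).
replace (/ f w - / f z)%C with ((f z - f w) / (f w * f z))%C by (field; auto).
rewrite Cmod_div by (apply Cmult_neq_0; auto).
rewrite Cmod_mult, Cmod_minus_sym.
apply Rmult_lt_reg_r with (Cmod (f w) * Cmod (f z)); [apply Rmult_lt_0_compat; lra|].
unfold Rdiv; rewrite Rmult_assoc, Rinv_l by (apply Rgt_not_eq, Rmult_lt_0_compat; lra).
assert (Cmod (f z) / 2 * (eps * Cmod (f z)) < Cmod (f w) * (eps * Cmod (f z))).
{ apply Rmult_lt_compat_r; [apply Rmult_lt_0_compat; lra|lra]. }
lra.
Qed.

Lemma ccont_ext_loc (f g : C -> C) (z : C) (d : R) : 0 < d ->
  (forall w, Cmod (w - z) < d -> f w = g w) -> ccont f z -> ccont g z.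
Proof.
intros Hd He H; apply ccont_eps; intros eps Heps.
destruct (proj1 (ccont_eps f z) H eps Heps) as [d2 [Hd2 H2]].
exists (Rmin d d2); split; [apply Rmin_glb_lt; auto|]; intros w Hw.
assert (Cmod (z - z) < d).
{ replace (z - z)%C with (RtoC 0) by ring; rewrite Cmod_0; auto. }
rewrite <- He, <- He; auto; [apply H2|];
  eapply Rlt_le_trans; try apply Hw; [apply Rmin_r|apply Rmin_l].
Qed.

(** Carathéodory's form of complex differentiability, from which the product and
    quotient rules follow. *)
Lemma C_derive_slope (f : C -> C) (z l : C) :
  is_derive (K := C_AbsRing) (V := C_NormedModule) f z l <->
  exists d phi, 0 < d /\ (forall w, Cmod (w - z) < d -> f w = f z + (w - z) * phi w)%C /\
    phi z = l /\ ccont phi z.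
Proof.
rewrite C_derive_eps; split.
- intros H.
  set (phi := fun w => if excluded_middle_informative (w = z) then l
                       else ((f w - f z) / (w - z))%C).
  exists 1, phi.
  assert (Ez : phi z = l) by (unfold phi; destruct excluded_middle_informative; tauto).
  assert (Hphi : forall w, (f w = f z + (w - z) * phi w)%C).
  { intros w; unfold phi; destruct excluded_middle_informative as [E|E].
    - subst w; ring.
    - field; intros E2; apply E, Ceq_minus, E2. }
  repeat split; auto; [lra|].
  apply ccont_eps; intros eps Heps.
  destruct (H (eps / 2) ltac:(lra)) as [d [Hd Hd2]].
  exists d; split; auto; intros w Hw; specialize (Hd2 w Hw); rewrite Ez.
  destruct (classic (w = z)) as [E|E].
  { subst w; rewrite Ez; replace (l - l)%C with (RtoC 0) by ring; rewrite Cmod_0; auto. }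
  apply Cmod_minus_pos in E.
  rewrite (Hphi w) in Hd2.
  replace (f z + (w - z) * phi w - f z - (w - z) * l)%C
    with ((phi w - l) * (w - z))%C in Hd2 by ring.
  rewrite Cmod_mult in Hd2; apply Rmult_le_reg_r in Hd2; lra.
- intros (d & phi & Hd & H1 & H2 & H3) eps Heps.
  destruct (proj1 (ccont_eps phi z) H3 eps Heps) as [d2 [Hd2 H4]].
  exists (Rmin d d2); split; [apply Rmin_glb_lt; auto|]; intros w Hw.
  rewrite H1 by (eapply Rlt_le_trans; [apply Hw|apply Rmin_l]).
  replace (f z + (w - z) * phi w - f z - (w - z) * l)%C
    with ((phi w - l) * (w - z))%C by ring.
  rewrite Cmod_mult; apply Rmult_le_compat_r; [apply Cmod_ge_0|].
  rewrite <- H2; apply Rlt_le, H4.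
  eapply Rlt_le_trans; [apply Hw|apply Rmin_r].
Qed.

Notation cderive f z l :=
  (is_derive (K := C_AbsRing) (V := C_NormedModule) f%C z%C (l%C : C)).

Lemma cderive_cont (f : C -> C) (z l : C) : cderive f z l -> ccont f z.
Proof.
intros H; apply C_derive_slope in H; destruct H as (d & phi & Hd & H1 & H2 & H3).
apply ccont_ext_loc with (f := fun w => (f z + (w - z) * phi w)%C) (d := d); auto.
- intros; symmetry; auto.
- apply ccont_plus; [apply ccont_const|].
  apply ccont_mult; auto; apply ccont_minus; [apply ccont_id|apply ccont_const].
Qed.

Lemma cderive_const (c z : C) : cderive (fun _ => c) z (RtoC 0).
Proof. exact (is_derive_const (K := C_AbsRing) (V := C_NormedModule) c z). Qed.

Lemma cderive_id (z : C) : cderive (fun w => w) z (RtoC 1).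
Proof.
apply C_derive_slope; exists 1, (fun _ => RtoC 1); repeat split; [lra| |apply ccont_const].
intros; ring.
Qed.

Lemma cderive_plus (f g : C -> C) (z l m : C) :
  cderive f z l -> cderive g z m -> cderive (fun w => f w + g w)%C z (l + m).
Proof. exact (is_derive_plus (K := C_AbsRing) (V := C_NormedModule) f g z l m). Qed.

Lemma cderive_minus (f g : C -> C) (z l m : C) :
  cderive f z l -> cderive g z m -> cderive (fun w => f w - g w)%C z (l - m).
Proof. exact (is_derive_minus (K := C_AbsRing) (V := C_NormedModule) f g z l m). Qed.

Lemma cderive_mult (f g : C -> C) (z l m : C) :
  cderive f z l -> cderive g z m -> cderive (fun w => f w * g w)%C z (l * g z + f z * m).
Proof.
intros Hf Hg; assert (Hc := cderive_cont _ _ _ Hg).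
apply C_derive_slope in Hf; destruct Hf as (d & p & Hd & H1 & H2 & H3).
apply C_derive_slope in Hg; destruct Hg as (d' & p' & Hd' & H1' & H2' & H3').
apply C_derive_slope.
exists (Rmin d d'), (fun w => p w * g w + f z * p' w)%C.
split; [apply Rmin_glb_lt; auto|split; [|split]].
- intros w Hw.
  rewrite H1, H1' by (eapply Rlt_le_trans; [apply Hw|apply Rmin_l || apply Rmin_r]).
  ring.
- rewrite H2, H2'; reflexivity.
- apply ccont_plus; apply ccont_mult; auto; apply ccont_const.
Qed.

Lemma ccont_neq_0 (f : C -> C) (z : C) : ccont f z -> f z <> 0 ->
  exists d, 0 < d /\ forall w, Cmod (w - z) < d -> f w <> 0.
Proof.
intros H Hz; apply Cmod_gt_0 in Hz.
destruct (proj1 (ccont_eps f z) H _ Hz) as [d [Hd Hd2]].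
exists d; split; auto; intros w Hw E; specialize (Hd2 w Hw).
rewrite E in Hd2; replace (0 - f z)%C with (- f z)%C in Hd2 by ring.
rewrite Cmod_opp in Hd2; lra.
Qed.

Lemma cderive_inv (f : C -> C) (z l : C) :
  cderive f z l -> f z <> 0 -> cderive (fun w => / f w)%C z (- l / (f z * f z)).
Proof.
intros Hf Hz; assert (Hc := cderive_cont _ _ _ Hf).
destruct (ccont_neq_0 f z Hc Hz) as [d' [Hd' H']].
apply C_derive_slope in Hf; destruct Hf as (d & p & Hd & H1 & H2 & H3).
apply C_derive_slope.
exists (Rmin d d'), (fun w => p w * (- (/ f z)) * / f w)%C.
split; [apply Rmin_glb_lt; auto|split; [|split]].
- intros w Hw.
  assert (Hw1 : Cmod (w - z) < d) by (eapply Rlt_le_trans; [apply Hw|apply Rmin_l]).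
  assert (Hw2 : Cmod (w - z) < d') by (eapply Rlt_le_trans; [apply Hw|apply Rmin_r]).
  apply H' in Hw2.
  assert (E : ((w - z) * p w = f w - f z)%C) by (rewrite (H1 w Hw1); ring).
  transitivity (/ f z + ((w - z) * p w) * (- (/ f z) * / f w))%C; [|ring].
  rewrite E; field; auto.
- rewrite H2; field; auto.
- apply ccont_mult; [|apply ccont_inv; auto].
  apply ccont_mult; [auto|apply ccont_const].
Qed.

(** Increments along the axes are real multiples of 1 and of [Ci]; real and imaginary parts of the
    complex estimate then give the Cauchy-Riemann equations. *)
Lemma cderive_partials (f : C -> C) (x y : R) (l : C) : cderive f (x, y) l ->
  is_derive (fun t => Re (f (t, y))) x (Re l) /\
  is_derive (fun t => Im (f (t, y))) x (Im l) /\
  is_derive (fun t => Re (f (x, t))) y (- Im l) /\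
  is_derive (fun t => Im (f (x, t))) y (Re l).
Proof.
intros H.
assert (Hx : forall t, ((t, y) - (x, y))%C = RtoC (t - x)).
{ intros t; unfold Cminus, Cplus, Copp, RtoC; simpl; f_equal; ring. }
assert (Hy : forall t, ((x, t) - (x, y))%C = (Ci * RtoC (t - y))%C).
{ intros t; unfold Cminus, Cplus, Copp, Cmult, Ci, RtoC; simpl; f_equal; ring. }
assert (Im_le : forall c : C, Rabs (Im c) <= Cmod c).
{ intros c; eapply Rle_trans; [apply Rmax_r|apply (Rmax_Cmod c)]. }
assert (My : forall t, Cmod (Ci * RtoC (t - y)) = Rabs (t - y)).
{ intros t; rewrite Cmod_mult, Cmod_Ci, Cmod_R; ring. }
refine (conj _ (conj _ (conj _ _))); apply R_derive_eps; intros eps Heps;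
  destruct (proj1 (C_derive_eps f (x, y) l) H eps Heps) as [d [Hd Hd2]];
  exists d; split; auto; intros t Ht;
  [specialize (Hd2 (t, y))|specialize (Hd2 (t, y))
  |specialize (Hd2 (x, t))|specialize (Hd2 (x, t))];
  rewrite ?Hx, ?Hy, ?My, ?Cmod_R in Hd2; specialize (Hd2 Ht);
  (eapply Rle_trans; [|exact Hd2]);
  match goal with
  | |- _ <= Cmod ?c =>
      (eapply Rle_trans; [|apply (re_le_Cmod c)]; right; f_equal; unfold Re, Im; simpl; ring)
      || (eapply Rle_trans; [|apply (Im_le c)]; right; f_equal; unfold Re, Im; simpl; ring)
  end.
Qed.

Lemma cont_at_const (c : R) (z : C) : cont_at (fun _ => c) z.
Proof.
apply cont_at_continuous.
exact (@continuous_const (AbsRing_UniformSpace C_AbsRing) R_UniformSpace c z).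
Qed.

Lemma cont_at_plus (u v : C -> R) (z : C) :
  cont_at u z -> cont_at v z -> cont_at (fun w => u w + v w) z.
Proof.
rewrite !cont_at_continuous.
exact (@continuous_plus (AbsRing_UniformSpace C_AbsRing) R_AbsRing R_NormedModule u v z).
Qed.

Lemma cont_at_minus (u v : C -> R) (z : C) :
  cont_at u z -> cont_at v z -> cont_at (fun w => u w - v w) z.
Proof.
rewrite !cont_at_continuous.
exact (@continuous_minus (AbsRing_UniformSpace C_AbsRing) R_AbsRing R_NormedModule u v z).
Qed.

Lemma cont_at_mult (u v : C -> R) (z : C) :
  cont_at u z -> cont_at v z -> cont_at (fun w => u w * v w) z.
Proof.
rewrite !cont_at_continuous.
exact (@continuous_mult (AbsRing_UniformSpace C_AbsRing) R_AbsRing u v z).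
Qed.

Lemma cont_at_comp (phi : R -> R) (u : C -> R) (z : C) :
  cont_at u z -> continuous phi (u z) -> cont_at (fun w => phi (u w)) z.
Proof.
rewrite !cont_at_continuous.
exact (continuous_comp (U := AbsRing_UniformSpace C_AbsRing) (V := R_UniformSpace)
         (W := R_UniformSpace) u phi z).
Qed.

Lemma cont_at_comp_derive (phi : R -> R) (u : C -> R) (z : C) :
  cont_at u z -> ex_derive phi (u z) -> cont_at (fun w => phi (u w)) z.
Proof.
intros H1 H2; apply cont_at_comp; auto;
apply (ex_derive_continuous (K := R_AbsRing) (V := R_NormedModule)); auto.
Qed.

Lemma cont_at_Cmod (f : C -> C) (z : C) : ccont f z -> cont_at (fun w => Cmod (f w)) z.
Proof.
intros H eps Heps; destruct (proj1 (ccont_eps f z) H eps Heps) as [d [Hd Hd2]].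
exists d; split; auto; intros w Hw; eapply Rle_lt_trans; [|apply (Hd2 w Hw)].
assert (H1 := Cmod_triangle_minus (f w) (f z)).
assert (H2 := Cmod_triangle_minus (f z) (f w)).
rewrite (Cmod_minus_sym (f z)) in H2; apply Rabs_le; lra.
Qed.

Lemma cont_at_ext_loc (u v : C -> R) (z : C) (d : R) : 0 < d ->
  (forall w, Cmod (w - z) < d -> u w = v w) -> cont_at u z -> cont_at v z.
Proof.
intros Hd He H eps Heps.
destruct (H eps Heps) as [d2 [Hd2 H2]].
exists (Rmin d d2); split; [apply Rmin_glb_lt; auto|]; intros w Hw.
assert (Cmod (z - z) < d).
{ replace (z - z)%C with (RtoC 0) by ring; rewrite Cmod_0; auto. }
rewrite <- He, <- He; auto; [apply H2|];
  eapply Rlt_le_trans; try apply Hw; [apply Rmin_r|apply Rmin_l].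
Qed.

(** * Gradients and Laplacians *)

Lemma R_derive_eq (f : R -> R) (x l l' : R) : l = l' -> is_derive f x l -> is_derive f x l'.
Proof. intros ->; auto. Qed.

(** [grad u z w] says that [du = Re (w dz)] at [z], partial derivatives only. *)
Definition grad (u : C -> R) (z w : C) : Prop :=
  is_derive (fun t => u (t, snd z)) (fst z) (Re w) /\
  is_derive (fun t => u (fst z, t)) (snd z) (- Im w).

Lemma grad_const (c : R) (z : C) : grad (fun _ => c) z 0.
Proof.
split; simpl; [|rewrite Ropp_0]; apply (is_derive_const (K := R_AbsRing) (V := R_NormedModule)).
Qed.

Lemma grad_eq (u : C -> R) (z w w' : C) : w = w' -> grad u z w -> grad u z w'.
Proof. intros ->; auto. Qed.

Lemma grad_plus (u v : C -> R) (z a b : C) :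
  grad u z a -> grad v z b -> grad (fun w => u w + v w) z (a + b).
Proof.
intros [H1 H2] [H3 H4]; split.
- exact (is_derive_plus (K := R_AbsRing) (V := R_NormedModule) _ _ _ _ _ H1 H3).
- replace (- Im (a + b)) with (- Im a + - Im b) by (unfold Im; simpl; ring).
  exact (is_derive_plus (K := R_AbsRing) (V := R_NormedModule) _ _ _ _ _ H2 H4).
Qed.

Lemma grad_scal (k : R) (u : C -> R) (z a : C) :
  grad u z a -> grad (fun w => k * u w) z (RtoC k * a).
Proof.
intros [H1 H2]; split.
- replace (Re (RtoC k * a)) with (k * Re a) by (unfold Re; simpl; ring).
  exact (is_derive_scal _ _ _ _ H1).
- replace (- Im (RtoC k * a)) with (k * - Im a) by (unfold Im; simpl; ring).
  exact (is_derive_scal _ _ _ _ H2).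
Qed.

Lemma grad_minus (u v : C -> R) (z a b : C) :
  grad u z a -> grad v z b -> grad (fun w => u w - v w) z (a - b).
Proof.
intros [H1 H2] [H3 H4]; split.
- exact (is_derive_minus (K := R_AbsRing) (V := R_NormedModule) _ _ _ _ _ H1 H3).
- replace (- Im (a - b)) with (- Im a - - Im b) by (unfold Im; simpl; ring).
  exact (is_derive_minus (K := R_AbsRing) (V := R_NormedModule) _ _ _ _ _ H2 H4).
Qed.

Lemma grad_comp (phi : R -> R) (u : C -> R) (z a : C) (d : R) :
  grad u z a -> is_derive phi (u z) d -> grad (fun w => phi (u w)) z (RtoC d * a).
Proof.
destruct z as [x y]; intros [H1 H2] H; split.
- eapply R_derive_eq; [|exact (is_derive_comp phi (fun t => u (t, y)) x d _ H H1)].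
  unfold Re, scal, mult; simpl; unfold mult; simpl; ring.
- eapply R_derive_eq; [|exact (is_derive_comp phi (fun t => u (x, t)) y d _ H H2)].
  unfold Im, scal, mult; simpl; unfold mult; simpl; ring.
Qed.

Lemma Cmod_horizontal (t x y : R) : Cmod ((t, y) - (x, y)) = Rabs (t - x).
Proof.
replace ((t, y) - (x, y))%C with (RtoC (t - x)); [apply Cmod_R|].
unfold Cminus, Cplus, Copp, RtoC; simpl; f_equal; ring.
Qed.

Lemma Cmod_vertical (t x y : R) : Cmod ((x, t) - (x, y)) = Rabs (t - y).
Proof.
replace ((x, t) - (x, y))%C with (Ci * RtoC (t - y))%C.
- rewrite Cmod_mult, Cmod_Ci, Cmod_R; ring.
- unfold Cminus, Cplus, Copp, Cmult, Ci, RtoC; simpl; f_equal; ring.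
Qed.

Lemma grad_ext_loc (u v : C -> R) (z a : C) (d : R) : 0 < d ->
  (forall w, Cmod (w - z) < d -> u w = v w) -> grad u z a -> grad v z a.
Proof.
destruct z as [x y]; intros Hd He [H1 H2]; simpl in *; split; simpl.
- eapply is_derive_ext_loc; [|exact H1].
  exists (mkposreal d Hd); intros t Ht; apply He; rewrite Cmod_horizontal; exact Ht.
- eapply is_derive_ext_loc; [|exact H2].
  exists (mkposreal d Hd); intros t Ht; apply He; rewrite Cmod_vertical; exact Ht.
Qed.

Lemma grad_unique (u : C -> R) (z a b : C) : grad u z a -> grad u z b -> a = b.
Proof.
intros [H1 H2] [H3 H4].
assert (E1 := is_derive_unique _ _ _ H1); rewrite (is_derive_unique _ _ _ H3) in E1.
assert (E2 := is_derive_unique _ _ _ H2); rewrite (is_derive_unique _ _ _ H4) in E2.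
destruct a, b; unfold Re, Im in *; simpl in *; f_equal; lra.
Qed.

(** Sums of squares are differentiated instead of the square root in [Cmod]. *)
Lemma ln_Cmod (z : C) : z <> 0 -> ln (Cmod z) = / 2 * ln (Re z ^ 2 + Im z ^ 2).
Proof.
intros Hz; rewrite <- Cmod2_alt; apply Cmod_gt_0 in Hz.
rewrite ln_pow by auto; simpl; lra.
Qed.

Lemma sqr_sum_pos (z : C) : z <> 0 -> 0 < Re z ^ 2 + Im z ^ 2.
Proof.
intros Hz; apply Cmod_gt_0 in Hz; rewrite <- Cmod2_alt; apply pow_lt; auto.
Qed.

Lemma Re_Cdiv (a b : C) : b <> 0 ->
  Re (a / b) = (Re a * Re b + Im a * Im b) / (Re b ^ 2 + Im b ^ 2).
Proof.
intros Hb; assert (H := sqr_sum_pos b Hb); unfold Re, Im in *; simpl; simpl in H; field; lra.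
Qed.

Lemma Im_Cdiv (a b : C) : b <> 0 ->
  Im (a / b) = (Im a * Re b - Re a * Im b) / (Re b ^ 2 + Im b ^ 2).
Proof.
intros Hb; assert (H := sqr_sum_pos b Hb); unfold Re, Im in *; simpl; simpl in H; field; lra.
Qed.

Lemma is_derive_ln_sqr_sum (a b : R -> R) (t a' b' : R) : 0 < a t ^ 2 + b t ^ 2 ->
  is_derive a t a' -> is_derive b t b' ->
  is_derive (fun s => / 2 * ln (a s ^ 2 + b s ^ 2)) t
    ((a' * a t + b' * b t) / (a t ^ 2 + b t ^ 2)).
Proof.
intros H Ha Hb.
auto_derive.
- repeat split; auto; [exists a'|exists b']; auto.
- replace (Derive (fun s => a s) t) with a' by (symmetry; exact (is_derive_unique _ _ _ Ha)).
  replace (Derive (fun s => b s) t) with b' by (symmetry; exact (is_derive_unique _ _ _ Hb)).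
  simpl; simpl in H; field; lra.
Qed.

(** Locally ln |f| is the real part of a logarithm of [f], with derivative f' / f; working with the
    partial derivatives avoids choosing a branch. *)
Lemma grad_ln_Cmod (f : C -> C) (z l : C) :
  cderive f z l -> f z <> 0 -> grad (fun w => ln (Cmod (f w))) z (l / f z).
Proof.
intros H Hz.
destruct (ccont_neq_0 f z (cderive_cont _ _ _ H) Hz) as [d [Hd Hn]].
apply grad_ext_loc with (u := fun w => / 2 * ln (Re (f w) ^ 2 + Im (f w) ^ 2)) (d := d); auto.
{ intros w Hw; rewrite ln_Cmod; auto. }
destruct z as [x y]; apply cderive_partials in H; destruct H as (H1 & H2 & H3 & H4).
split; simpl fst; simpl snd.
- rewrite Re_Cdiv by auto.
  apply (is_derive_ln_sqr_sum (fun t => Re (f (t, y))) (fun t => Im (f (t, y)))); auto.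
  apply sqr_sum_pos; auto.
- rewrite Im_Cdiv by auto.
  replace (- ((Im l * Re (f (x, y)) - Re l * Im (f (x, y))) /
           (Re (f (x, y)) ^ 2 + Im (f (x, y)) ^ 2)))
    with ((- Im l * Re (f (x, y)) + Re l * Im (f (x, y))) /
           (Re (f (x, y)) ^ 2 + Im (f (x, y)) ^ 2)) by (unfold Rdiv; ring).
  apply (is_derive_ln_sqr_sum (fun t => Re (f (x, t))) (fun t => Im (f (x, t)))); auto.
  apply sqr_sum_pos; auto.
Qed.

Lemma cderive_eq (f : C -> C) (z l l' : C) : l = l' -> cderive f z l -> cderive f z l'.
Proof. intros ->; auto. Qed.

Lemma cderive_shift (p z : C) : cderive (fun w => w - p) z (RtoC 1).
Proof.
eapply cderive_eq; [|apply cderive_minus; [apply cderive_id|apply cderive_const]]; ring.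
Qed.

Lemma grad_ln_dist (p z : C) : z <> p -> grad (fun w => ln (Cmod (w - p))) z (/ (z - p)).
Proof.
intros Hz; assert (H : (z - p)%C <> 0) by (apply Cminus_eq_contra; auto).
eapply grad_eq; [|apply grad_ln_Cmod; [apply cderive_shift|exact H]].
cbv beta; field; exact H.
Qed.

Lemma cont_at_ln_Cmod (f : C -> C) (z : C) :
  ccont f z -> f z <> 0 -> cont_at (fun w => ln (Cmod (f w))) z.
Proof.
intros H Hz; apply (cont_at_comp_derive ln (fun w => Cmod (f w))); [apply cont_at_Cmod; auto|].
apply Cmod_gt_0 in Hz; exists (/ Cmod (f z)); apply is_derive_Reals, derivable_pt_lim_ln; auto.
Qed.

Lemma ccont_shift (p z : C) : ccont (fun w => w - p)%C z.
Proof. apply ccont_minus; [apply ccont_id|apply ccont_const]. Qed.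

Lemma cont_at_ln_dist (p z : C) : z <> p -> cont_at (fun w => ln (Cmod (w - p))) z.
Proof.
intros Hz; apply (cont_at_ln_Cmod (fun w => w - p)%C); [apply ccont_shift|].
apply Cminus_eq_contra; auto.
Qed.

(** Since [g] is holomorphic, the terms in [phi1 (u z)] cancel. *)
Lemma is_laplacian_comp (phi phi1 : R -> R) (u : C -> R) (g : C -> C) (z : C) (d phi2 : R) :
  0 < d -> (forall w, Cmod (w - z) < d -> grad u w (g w)) ->
  ex_derive (K := C_AbsRing) (V := C_NormedModule) g z ->
  (forall w, Cmod (w - z) < d -> is_derive phi (u w) (phi1 (u w))) ->
  is_derive phi1 (u z) phi2 ->
  is_laplacian (fun w => phi (u w)) z (phi2 * Cmod (g z) ^ 2).
Proof.
intros Hd Hg [l Hl] H1 H2; destruct z as [x y].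
assert (Hz := Hg (x, y)); rewrite Cmod_horizontal, Rminus_eq_0, Rabs_R0 in Hz.
specialize (Hz Hd); destruct Hz as [Hx Hy]; simpl fst in *; simpl snd in *.
apply cderive_partials in Hl; destruct Hl as (L1 & L2 & L3 & L4).
exists d; split; auto.
exists (fun w => phi1 (u w) * Re (g w)), (fun w => phi1 (u w) * - Im (g w)).
split.
- intros s t Hst.
  destruct (grad_comp phi u (s, t) (g (s, t)) _ (Hg _ Hst) (H1 _ Hst)) as [G1 G2].
  simpl fst in *; simpl snd in *; split.
  + replace (phi1 (u (s, t)) * Re (g (s, t))) with (Re (RtoC (phi1 (u (s, t))) * g (s, t)))
      by (unfold Re; simpl; ring); auto.
  + replace (phi1 (u (s, t)) * - Im (g (s, t))) with (- Im (RtoC (phi1 (u (s, t))) * g (s, t)))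
      by (unfold Im; simpl; ring); auto.
- exists (phi2 * Re (g (x, y)) ^ 2 + phi1 (u (x, y)) * Re l),
    (phi2 * Im (g (x, y)) ^ 2 - phi1 (u (x, y)) * Re l); split; [|split].
  + simpl fst; simpl snd.
    assert (D := is_derive_comp phi1 (fun t => u (t, y)) x _ _ H2 Hx).
    assert (E := is_derive_mult _ _ _ _ _ D L1 Rmult_comm).
    eapply R_derive_eq; [|exact E].
    unfold plus, mult, scal; simpl; unfold mult; simpl; unfold Re; simpl; ring.
  + simpl fst; simpl snd.
    assert (D := is_derive_comp phi1 (fun t => u (x, t)) y _ _ H2 Hy).
    assert (E := is_derive_mult _ _ _ _ _ D (is_derive_opp _ _ _ L4) Rmult_comm).
    eapply R_derive_eq; [|exact E].
    unfold plus, mult, scal, opp; simpl; unfold mult; simpl; unfold Re, Im; simpl; ring.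
  + rewrite Cmod2_alt; ring.
Qed.

Lemma is_laplacian_plus (u v : C -> R) (z : C) (a b : R) :
  is_laplacian u z a -> is_laplacian v z b -> is_laplacian (fun w => u w + v w) z (a + b).
Proof.
intros (d & Hd & gx & gy & H & gxx & gyy & H1 & H2 & H3)
  (d' & Hd' & gx' & gy' & H' & gxx' & gyy' & H1' & H2' & H3').
exists (Rmin d d'); split; [apply Rmin_glb_lt; auto|].
exists (fun w => gx w + gx' w), (fun w => gy w + gy' w); split.
- intros x y Hxy.
  destruct (H x y) as [G1 G2]; [eapply Rlt_le_trans; [exact Hxy|apply Rmin_l]|].
  destruct (H' x y) as [G3 G4]; [eapply Rlt_le_trans; [exact Hxy|apply Rmin_r]|].
  split.
  + exact (is_derive_plus (K := R_AbsRing) (V := R_NormedModule) _ _ _ _ _ G1 G3).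
  + exact (is_derive_plus (K := R_AbsRing) (V := R_NormedModule) _ _ _ _ _ G2 G4).
- exists (gxx + gxx'), (gyy + gyy'); split; [|split; [|lra]].
  + exact (is_derive_plus (K := R_AbsRing) (V := R_NormedModule) _ _ _ _ _ H1 H1').
  + exact (is_derive_plus (K := R_AbsRing) (V := R_NormedModule) _ _ _ _ _ H2 H2').
Qed.

Lemma is_laplacian_scal (k : R) (u : C -> R) (z : C) (a : R) :
  is_laplacian u z a -> is_laplacian (fun w => k * u w) z (k * a).
Proof.
intros (d & Hd & gx & gy & H & gxx & gyy & H1 & H2 & H3).
exists d; split; auto.
exists (fun w => k * gx w), (fun w => k * gy w); split.
- intros x y Hxy; destruct (H x y Hxy) as [G1 G2].
  split; apply is_derive_scal; auto.
- exists (k * gxx), (k * gyy); split; [|split; [|rewrite <- H3; ring]]; apply is_derive_scal; auto.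
Qed.

Lemma is_laplacian_ext_loc (u v : C -> R) (z : C) (a d : R) : 0 < d ->
  (forall w, Cmod (w - z) < d -> u w = v w) -> is_laplacian u z a -> is_laplacian v z a.
Proof.
intros Hd He (d' & Hd' & gx & gy & H & K).
exists (Rmin d d'); split; [apply Rmin_glb_lt; auto|].
exists gx, gy; split; auto.
intros x y Hxy.
assert (Hx1 : Cmod ((x, y) - z) < d) by (eapply Rlt_le_trans; [exact Hxy|apply Rmin_l]).
assert (Hx2 : Cmod ((x, y) - z) < d') by (eapply Rlt_le_trans; [exact Hxy|apply Rmin_r]).
(* The minus sign is the convention du = Re (w dz) of [grad]; the radius keeps the disc about (x, y)
   inside the disc about [z]. *)
assert (G : grad v (x, y) (gx (x, y), - gy (x, y))).
{ apply grad_ext_loc with (u := u) (d := d - Cmod ((x, y) - z)); [lra| |].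
  - intros w Hw; apply He; assert (T := Cmod_minus_le w (x, y) z); lra.
  - destruct (H x y Hx2) as [G1 G2]; split; unfold Re, Im; simpl; auto.
    rewrite Ropp_involutive; auto. }
destruct G as [G1 G2]; unfold Re, Im in *; simpl in *; rewrite Ropp_involutive in G2; auto.
Qed.

Lemma is_laplacian_eq (u : C -> R) (z : C) (a b : R) :
  a = b -> is_laplacian u z a -> is_laplacian u z b.
Proof. intros ->; auto. Qed.

Lemma is_laplacian_const (c : R) (z : C) : is_laplacian (fun _ => c) z 0.
Proof.
exists 1; split; [lra|]; exists (fun _ => 0), (fun _ => 0); split.
- intros; split; apply (is_derive_const (K := R_AbsRing) (V := R_NormedModule)).
- exists 0, 0; split; [|split; [|ring]];
    apply (is_derive_const (K := R_AbsRing) (V := R_NormedModule)).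
Qed.

(** By Cauchy-Riemann for [g] the two second derivatives cancel; this is the composition rule with
    the identity as outer function. *)
Lemma is_laplacian_grad (u : C -> R) (g : C -> C) (z : C) (d : R) : 0 < d ->
  (forall w, Cmod (w - z) < d -> grad u w (g w)) ->
  ex_derive (K := C_AbsRing) (V := C_NormedModule) g z -> is_laplacian u z 0.
Proof.
intros Hd H Hg.
eapply is_laplacian_eq; [|apply (is_laplacian_comp (fun x => x) (fun _ => 1) u g z d 0)]; auto.
- ring.
- intros; exact (is_derive_id (K := R_AbsRing) (u w)).
- exact (is_derive_const (K := R_AbsRing) (V := R_NormedModule) 1 (u z)).
Qed.

(** * Maxima: the second-order condition and existence on a square *)

(** If g2 > 0, the expansion of [g1] at [x] makes [g1] positive just right of [x] when g1 x >= 0,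
    and negative just left of [x] otherwise. In either case the mean value theorem produces a value
    above g x. *)
Lemma second_derivative_at_max (g g1 : R -> R) (x d g2 : R) : 0 < d ->
  (forall t, Rabs (t - x) < d -> is_derive g t (g1 t)) -> is_derive g1 x g2 ->
  (forall t, Rabs (t - x) < d -> g t <= g x) -> g2 <= 0.
Proof.
intros Hd H1 H2 Hm; apply Rnot_lt_le; intros Hg2.
destruct (proj1 (R_derive_eps _ _ _) H2 (g2 / 2) ltac:(lra)) as [e [He H3]].
set (t := Rmin d e / 2).
assert (Ht : 0 < Rmin d e) by (apply Rmin_glb_lt; auto).
assert (Td := Rmin_l d e); assert (Te := Rmin_r d e).
destruct (Rle_lt_dec 0 (g1 x)) as [Hx|Hx].
- destruct (MVT_cor2 g g1 x (x + t)) as [c [Hc1 Hc2]].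
  + unfold t; lra.
  + intros c Hc; apply is_derive_Reals, H1, Rabs_def1; unfold t in *; lra.
  + assert (Hc : Rabs (c - x) < e) by (apply Rabs_def1; unfold t in *; lra).
    specialize (H3 c Hc); apply Rabs_le_between in H3.
    rewrite (Rabs_pos_eq (c - x)) in H3 by lra.
    assert (0 < (c - x) * g2) by (apply Rmult_lt_0_compat; lra).
    assert (Hg : 0 < g1 c) by lra.
    assert (0 < g1 c * (x + t - x)) by (apply Rmult_lt_0_compat; unfold t; lra).
    assert (g (x + t) <= g x) by (apply Hm, Rabs_def1; unfold t; lra).
    lra.
- destruct (MVT_cor2 g g1 (x - t) x) as [c [Hc1 Hc2]].
  + unfold t; lra.
  + intros c Hc; apply is_derive_Reals, H1, Rabs_def1; unfold t in *; lra.
  + assert (Hc : Rabs (c - x) < e) by (apply Rabs_def1; unfold t in *; lra).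
    specialize (H3 c Hc); apply Rabs_le_between in H3.
    rewrite (Rabs_left (c - x)) in H3 by lra.
    assert (0 < (x - c) * g2) by (apply Rmult_lt_0_compat; lra).
    assert (Hg : g1 c < 0) by lra.
    assert (0 < - g1 c * (x - (x - t))) by (apply Rmult_lt_0_compat; unfold t; lra).
    assert (g (x - t) <= g x) by (apply Hm, Rabs_def1; unfold t; lra).
    lra.
Qed.

Lemma is_laplacian_at_max (u : C -> R) (z : C) (l d : R) : 0 < d ->
  is_laplacian u z l -> (forall w, Cmod (w - z) < d -> u w <= u z) -> l <= 0.
Proof.
destruct z as [x y]; intros Hd (d' & Hd' & gx & gy & H & gxx & gyy & H1 & H2 & H3) Hm.
simpl fst in *; simpl snd in *.
assert (Hmin : 0 < Rmin d d') by (apply Rmin_glb_lt; auto).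
assert (gxx <= 0).
{ apply (second_derivative_at_max (fun t => u (t, y)) (fun t => gx (t, y)) x (Rmin d d')); auto.
  - intros t Ht; apply H; rewrite Cmod_horizontal; eapply Rlt_le_trans; [exact Ht|apply Rmin_r].
  - intros t Ht; apply Hm; rewrite Cmod_horizontal; eapply Rlt_le_trans; [exact Ht|apply Rmin_l]. }
assert (gyy <= 0).
{ apply (second_derivative_at_max (fun t => u (x, t)) (fun t => gy (x, t)) y (Rmin d d')); auto.
  - intros t Ht; apply H; rewrite Cmod_vertical; eapply Rlt_le_trans; [exact Ht|apply Rmin_r].
  - intros t Ht; apply Hm; rewrite Cmod_vertical; eapply Rlt_le_trans; [exact Ht|apply Rmin_l]. }
lra.
Qed.

Lemma list_argmax (A : Type) (f : A -> R) (a : A) (l : list A) :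
  exists t, In t (a :: l) /\ forall s, In s (a :: l) -> f s <= f t.
Proof.
revert a; induction l as [|b l IH]; intros a.
- exists a; split; [left; auto|]; intros s [->|[]]; lra.
- destruct (IH b) as [t [Ht1 Ht2]].
  destruct (Rle_lt_dec (f a) (f t)) as [E|E].
  + exists t; split; [right; auto|]; intros s [->|Hs]; auto.
  + exists a; split; [left; auto|]; intros s [->|Hs]; [lra|].
    specialize (Ht2 s Hs); lra.
Qed.

Definition in_square (S : R) (z : C) : Prop := Rabs (fst z) <= S /\ Rabs (snd z) <= S.

Lemma Cmod_lt_2max (z : C) (d : R) : Rabs (fst z) < d -> Rabs (snd z) < d -> Cmod z < 2 * d.
Proof.
intros H1 H2; eapply Rle_lt_trans; [apply Cmod_2Rmax|].
assert (H3 : sqrt 2 < 2).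
{ rewrite <- (sqrt_Rsqr 2) at 2 by lra; apply sqrt_lt_1; unfold Rsqr; lra. }
assert (H4 := sqrt_pos 2).
assert (H5 : Rmax (Rabs (fst z)) (Rabs (snd z)) < d) by (apply Rmax_lub_lt; auto).
assert (H6 : 0 <= Rmax (Rabs (fst z)) (Rabs (snd z))).
{ eapply Rle_trans; [apply (Rabs_pos (fst z))|apply Rmax_l]. }
nra.
Qed.

(** If no maximum existed, each point z would have a neighbourhood on which U stays below its value
    at some point y of the square. Finitely many neighbourhoods cover the square, and the y with the
    largest value would lie in one of them. *)
Lemma usc_attains_max (U : C -> R) (S : R) : 0 <= S ->
  (forall z v, U z < v -> exists d, 0 < d /\ forall w, Cmod (w - z) < d -> U w < v) ->
  exists z, in_square S z /\ forall w, in_square S w -> U w <= U z.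
Proof.
intros HS Husc; apply NNPP; intros Hno.
assert (Hbetter : forall z, in_square S z -> exists w, in_square S w /\ U z < U w).
{ intros z Hz; apply NNPP; intros Hn; apply Hno; exists z; split; auto.
  intros w Hw; apply Rnot_lt_le; intros Hlt; apply Hn; exists w; auto. }
assert (H0 : in_square S 0) by (split; simpl; rewrite Rabs_R0; auto).
(* The factor 2 passes from the boxes of the compactness lemma, of half-side [snd yd], to discs of
   [Cmod]. *)
assert (Hch : forall z, exists yd : C * posreal, in_square S (fst yd) /\
   (in_square S z -> forall w, Cmod (w - z) < 2 * snd yd -> U w < U (fst yd))).
{ intros z; destruct (classic (in_square S z)) as [Hz|Hz].
  - destruct (Hbetter z Hz) as [y [Hy1 Hy2]].
    destruct (Husc z (U y) Hy2) as [d [Hd Hd2]].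
    assert (Hd' : 0 < d / 2) by lra.
    exists (y, mkposreal _ Hd'); simpl; split; auto; intros _ w Hw; apply Hd2; lra.
  - exists (RtoC 0, mkposreal 1 Rlt_0_1); simpl; split; auto; tauto. }
set (F := fun z => proj1_sig (constructive_indefinite_description _ (Hch z))).
assert (HF : forall z, in_square S (fst (F z)) /\
   (in_square S z -> forall w, Cmod (w - z) < 2 * snd (F z) -> U w < U (fst (F z)))).
{ intros z; unfold F; apply proj2_sig. }
clearbody F; clear Hch.
set (pt := fun t : Compactness.Tn 2 R => (fst t, fst (snd t)) : C).
(* The finite cover is given under a double negation, which is enough since the goal is [False]. *)
apply (compactness_list 2 (- S, (- S, tt)) (S, (S, tt)) (fun t => snd (F (pt t)))).
intros [l Hl].
assert (Hcover : forall z, in_square S z -> exists t, In t l /\ U z < U (fst (F (pt t)))).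
{ intros [x y] [Hx Hy]; simpl in Hx, Hy; apply Rabs_le_between in Hx, Hy.
  destruct (Hl (x, (y, tt))) as (t & Ht1 & Ht2 & Ht3); [simpl; tauto|].
  exists t; split; auto; destruct t as [a [b []]]; simpl in Ht2, Ht3.
  apply HF; unfold pt; simpl.
  - split; apply Rabs_le; simpl; tauto.
  - apply Cmod_lt_2max; simpl; tauto. }
destruct l as [|t0 l].
{ destruct (Hcover 0 H0) as [t [[] _]]. }
destruct (list_argmax _ (fun t => U (fst (F (pt t)))) t0 l) as [t [_ Ht]].
destruct (Hcover (fst (F (pt t))) (proj1 (HF _))) as [s [Hs1 Hs2]].
specialize (Ht s Hs1); simpl in Ht; lra.
Qed.

Lemma ln_le_sub1 (x : R) : 0 < x -> ln x <= x - 1.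
Proof. intros Hx; assert (H := exp_ineq1_le (ln x)); rewrite exp_ln in H; lra. Qed.

(** By ln x <= x - 1 and the triangle inequality the difference is at most |q - p| / |w - q|. *)
Lemma ln_dist_le (p q w : C) (d : R) : 0 < d -> d <= Cmod (w - q) -> w <> p ->
  ln (Cmod (w - p)) - ln (Cmod (w - q)) <= Cmod (q - p) / d.
Proof.
intros Hd Hq Hp; apply Cmod_minus_pos in Hp.
rewrite <- ln_div by lra.
eapply Rle_trans; [apply ln_le_sub1, Rdiv_lt_0_compat; lra|].
assert (T := Cmod_minus_le w q p).
assert (Q := Cmod_ge_0 (q - p)).
apply Rle_trans with (Cmod (q - p) / Cmod (w - q)).
- apply Rmult_le_reg_r with (Cmod (w - q)); [lra|].
  field_simplify; [lra|lra|lra].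
- apply Rmult_le_compat_l; auto; apply Rinv_le_contravar; lra.
Qed.

(** Strictly subharmonic off [q] and [P], and tending to minus infinity at the points
    of [P] and at infinity. *)
Fixpoint barrier (q : C) (P : list C) (w : C) : R :=
  match P with
  | nil => exp (-2 * ln (Cmod (w - q))) - ln (Cmod (w - q))
  | p :: P' => (ln (Cmod (w - p)) - ln (Cmod (w - q))) + barrier q P' w
  end.

(** * Harmonic functions and properties of the barrier *)

(** Continuity is demanded separately because existence of partial derivatives does not imply it. *)
Definition harmonic_at (u : C -> R) (z : C) : Prop := cont_at u z /\ is_laplacian u z 0.

Lemma cderive_inv_shift (p z : C) : z <> p ->
  ex_derive (K := C_AbsRing) (V := C_NormedModule) (fun w => / (w - p))%C z.
Proof.
intros H; eexists; apply (cderive_inv (fun w => w - p)%C);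
  [apply cderive_shift|apply Cminus_eq_contra; auto].
Qed.

Lemma neq_nearby (p z w : C) : Cmod (w - z) < Cmod (z - p) -> w <> p.
Proof. intros H ->; rewrite Cmod_minus_sym in H; lra. Qed.

Lemma harmonic_ln_dist (p z : C) : z <> p -> harmonic_at (fun w => ln (Cmod (w - p))) z.
Proof.
intros H; split; [apply cont_at_ln_dist; auto|].
apply is_laplacian_grad with (g := fun w => (/ (w - p))%C) (d := Cmod (z - p)).
- apply Cmod_minus_pos; auto.
- intros w Hw; apply grad_ln_dist; eapply neq_nearby; eauto.
- apply cderive_inv_shift; auto.
Qed.

Lemma harmonic_plus (u v : C -> R) (z : C) :
  harmonic_at u z -> harmonic_at v z -> harmonic_at (fun w => u w + v w) z.
Proof.
intros [H1 H2] [H3 H4]; split; [apply cont_at_plus; auto|].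
eapply is_laplacian_eq; [|apply is_laplacian_plus; eauto]; ring.
Qed.

Lemma harmonic_scal (k : R) (u : C -> R) (z : C) :
  harmonic_at u z -> harmonic_at (fun w => k * u w) z.
Proof.
intros [H1 H2]; split; [apply cont_at_mult; auto; apply cont_at_const|].
eapply is_laplacian_eq; [|apply is_laplacian_scal; eauto]; ring.
Qed.

Lemma harmonic_ext (u v : C -> R) (z : C) :
  (forall w, u w = v w) -> harmonic_at u z -> harmonic_at v z.
Proof.
intros E [H1 H2]; split; [apply cont_at_ext_loc with u 1|apply is_laplacian_ext_loc with u 1];
  auto; lra.
Qed.

Lemma harmonic_minus (u v : C -> R) (z : C) :
  harmonic_at u z -> harmonic_at v z -> harmonic_at (fun w => u w - v w) z.
Proof.
intros Hu Hv; apply harmonic_ext with (fun w => u w + (-1) * v w); [intros; ring|].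
apply harmonic_plus; auto; apply harmonic_scal; auto.
Qed.

(** All logarithms are harmonic here. With s = ln |w - q|, the remaining term exp (-2 s) has
    Laplacian 4 exp (-2 s) / |w - q|^2 > 0. *)
Lemma barrier_subharmonic (q : C) (P : list C) (w : C) : w <> q -> ~ In w P ->
  cont_at (barrier q P) w /\ exists l, 0 < l /\ is_laplacian (barrier q P) w l.
Proof.
intros Hq; induction P as [|p P IH]; intros HP.
- assert (Hln := harmonic_ln_dist q w Hq).
  split.
  + apply cont_at_minus; [|apply Hln].
    apply (cont_at_comp_derive (fun x => exp (-2 * x)) (fun w => ln (Cmod (w - q))));
      [apply Hln|]; auto_derive; auto.
  + exists (4 * exp (-2 * ln (Cmod (w - q))) * Cmod (/ (w - q)) ^ 2 + (-1) * 0); split.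
    * rewrite Rmult_0_r, Rplus_0_r; apply Rmult_lt_0_compat.
      -- assert (H := exp_pos (-2 * ln (Cmod (w - q)))); lra.
      -- apply pow_lt; rewrite Cmod_inv by (apply Cminus_eq_contra; auto).
         apply Rinv_0_lt_compat, Cmod_minus_pos; auto.
    * apply is_laplacian_ext_loc with
        (u := fun w => exp (-2 * ln (Cmod (w - q))) + (-1) * ln (Cmod (w - q))) (d := 1);
        [lra|intros; simpl; ring|].
      apply is_laplacian_plus; [|apply is_laplacian_scal, Hln].
      apply (is_laplacian_comp (fun x => exp (-2 * x)) (fun x => -2 * exp (-2 * x))
        (fun w => ln (Cmod (w - q))) (fun w => / (w - q))%C w (Cmod (w - q))).
      -- apply Cmod_minus_pos; auto.
      -- intros v Hv; apply grad_ln_dist; eapply neq_nearby; eauto.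
      -- apply cderive_inv_shift; auto.
      -- intros v Hv; auto_derive; auto; ring.
      -- auto_derive; auto; ring.
- destruct IH as [IH1 [l [Hl IH2]]]; [intros H; apply HP; right; auto|].
  assert (Hln := harmonic_minus _ _ _
    (harmonic_ln_dist p w (fun E => HP (or_introl (eq_sym E)))) (harmonic_ln_dist q w Hq)).
  split; [apply cont_at_plus; auto; apply Hln|].
  exists l; split; auto.
  apply is_laplacian_eq with (0 + l); [ring|].
  apply is_laplacian_plus; auto; apply Hln.
Qed.

(** Off the disc about [q] every difference of logarithms is bounded above, so the unpaired -ln |w -
    q| governs the growth: the barrier is bounded above there and tends to minus infinity at
    infinity. *)
Lemma barrier_upper (q : C) (P : list C) (d : R) : 0 < d ->
  exists K, forall w, d <= Cmod (w - q) -> ~ In w P -> barrier q P w <= K - ln (Cmod (w - q)).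
Proof.
intros Hd; induction P as [|p P [K IH]].
- exists (exp (-2 * ln d)); intros w Hw _; simpl.
  assert (ln d <= ln (Cmod (w - q))) by (apply ln_le; auto).
  assert (exp (-2 * ln (Cmod (w - q))) <= exp (-2 * ln d)).
  { destruct (Req_dec (ln d) (ln (Cmod (w - q)))) as [E|E]; [rewrite E; lra|].
    left; apply exp_increasing; lra. }
  lra.
- exists (Cmod (q - p) / d + K); intros w Hw HP; simpl.
  assert (IHw := IH w Hw (fun H => HP (or_intror H))).
  assert (L := ln_dist_le p q w d Hd Hw (fun E => HP (or_introl (eq_sym E)))).
  lra.
Qed.

(** The term ln |w - p| is kept and every other term is bounded above. If [p] recurs in the tail,
    the induction hypothesis already supplies it. *)
Lemma barrier_near_pole (q : C) (P : list C) (p : C) (d : R) : 0 < d -> In p P ->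
  exists K, forall w, d <= Cmod (w - q) -> ~ In w P -> barrier q P w <= K + ln (Cmod (w - p)).
Proof.
intros Hd; induction P as [|p' P IH]; intros HpP; [destruct HpP|].
destruct (classic (In p P)) as [Hp|Hp].
- destruct (IH Hp) as [K HK].
  exists (Cmod (q - p') / d + K); intros w Hw HP; simpl.
  assert (IHw := HK w Hw (fun H => HP (or_intror H))).
  assert (L := ln_dist_le p' q w d Hd Hw (fun E => HP (or_introl (eq_sym E)))).
  lra.
- destruct HpP as [->|HpP]; [|tauto].
  destruct (barrier_upper q P d Hd) as [K HK].
  (* One ln d bounds the -ln |w - q| paired with [p], the other the one left over in
     [barrier_upper]. *)
  exists (K - 2 * ln d); intros w Hw HP; simpl.
  assert (HKw := HK w Hw (fun H => HP (or_intror H))).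
  assert (ln d <= ln (Cmod (w - q))) by (apply ln_le; auto).
  lra.
Qed.

Lemma punctured_avoids (P : list C) (z : C) :
  exists d, 0 < d /\ forall w, 0 < Cmod (w - z) < d -> ~ In w P.
Proof.
induction P as [|p P [d [Hd IH]]]; [exists 1; split; [lra|simpl; tauto]|].
destruct (classic (p = z)) as [E|E].
- exists d; split; auto; intros w Hw [H|H]; [|apply (IH w); auto].
  subst w; rewrite E in Hw; replace (z - z)%C with (RtoC 0) in Hw by ring.
  rewrite Cmod_0 in Hw; lra.
- apply Cmod_minus_pos in E.
  exists (Rmin d (Cmod (p - z))); split; [apply Rmin_glb_lt; auto|].
  assert (H1 := Rmin_l d (Cmod (p - z))); assert (H2 := Rmin_r d (Cmod (p - z))).
  intros w Hw [H|H]; [subst w; lra|apply (IH w); auto; lra].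
Qed.

Lemma notin_nearby (P : list C) (z : C) : ~ In z P ->
  exists d, 0 < d /\ forall w, Cmod (w - z) < d -> ~ In w P.
Proof.
intros H; destruct (punctured_avoids P z) as [d [Hd K]]; exists d; split; auto.
intros w Hw; destruct (classic (w = z)) as [->|E]; auto.
apply K; split; auto; apply Cmod_minus_pos; auto.
Qed.

(** * Liouville's theorem and factorization of polynomials *)

Lemma ln_to_minf (K : R) (z : C) : exists d, 0 < d /\
  forall w, 0 < Cmod (w - z) < d -> ln (Cmod (w - z)) < K.
Proof.
exists (exp K); split; [apply exp_pos|]; intros w [H1 H2].
rewrite <- (ln_exp K); apply ln_increasing; auto.
Qed.

(** The positive part of V, extended by 0 over the poles and the disc about [q], is upper
    semicontinuous because V <= 0 near all of these, so it attains its maximum. A positive value of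
    V would put that maximum at an interior point of the domain, where the Laplacian of V is
    strictly positive, against the second-order condition. *)
Lemma subharmonic_at_pos_max (P : list C) (q : C) (V : C -> R) (d S : R) (z1 : C) : 0 < d ->
  (forall z, d <= Cmod (z - q) -> ~ In z P ->
     cont_at V z /\ exists l, 0 < l /\ is_laplacian V z l) ->
  (forall z, d <= Cmod (z - q) < 2 * d -> ~ In z P -> V z <= 0) ->
  (forall p, In p P -> exists e, 0 < e /\
     forall z, d <= Cmod (z - q) -> ~ In z P -> Cmod (z - p) < e -> V z <= 0) ->
  (forall z, d <= Cmod (z - q) -> ~ In z P -> S <= Cmod z -> V z <= 0) ->
  d <= Cmod (z1 - q) -> ~ In z1 P -> V z1 <= 0.
Proof.
intros Hd HV Hq HP HS Hz1 Hz1P; apply Rnot_lt_le; intros Hpos.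
set (good := fun z => d <= Cmod (z - q) /\ ~ In z P).
set (U := fun z => if excluded_middle_informative (good z) then Rmax (V z) 0 else 0).
assert (Ugood : forall z, good z -> U z = Rmax (V z) 0).
{ intros z Hz; unfold U; destruct excluded_middle_informative; tauto. }
assert (Ubad : forall z, ~ (good z /\ 0 < V z) -> U z = 0).
{ intros z Hz; unfold U; destruct excluded_middle_informative; auto.
  apply Rmax_right, Rnot_lt_le; tauto. }
assert (Upos : forall z, 0 <= U z).
{ intros z; unfold U; destruct excluded_middle_informative; [apply Rmax_r|lra]. }
(* No sign is known for [S]; the maximum with 0 makes the square nonempty. *)
assert (S0 : 0 <= Rmax S 0) by apply Rmax_r.
destruct (usc_attains_max U (Rmax S 0) S0) as [m [_ Hm]].
- intros z v Hv.
  (* Three cases: at a pole and within 2 d of [q] the function U vanishes nearby; elsewhere U is the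
     continuous positive part of V. *)
  destruct (classic (In z P)) as [HzP|HzP]; [|destruct (Rlt_le_dec (Cmod (z - q)) (2 * d)) as [Hzq|Hzq]].
  + destruct (HP z HzP) as [e [He HVe]]; exists e; split; auto.
    intros w Hw; rewrite Ubad; [specialize (Upos z); lra|].
    intros [[G1 G2] G3]; specialize (HVe w G1 G2 Hw); lra.
  + exists (2 * d - Cmod (z - q)); split; [lra|].
    intros w Hw; rewrite Ubad; [specialize (Upos z); lra|].
    intros [[G1 G2] G3]; assert (T := Cmod_minus_le w z q).
    assert (Hlt : Cmod (w - q) < 2 * d) by lra.
    specialize (Hq w (conj G1 Hlt) G2); lra.
  + assert (G : good z) by (split; auto; lra).
    rewrite (Ugood z G) in Hv.
    destruct (proj1 (HV z (proj1 G) HzP) (v - Rmax (V z) 0) ltac:(lra)) as [e [He Hce]].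
    destruct (notin_nearby P z HzP) as [e' [He' Hne]].
    exists (Rmin e (Rmin e' d)); split; [apply Rmin_glb_lt; [|apply Rmin_glb_lt]; auto|].
    intros w Hw.
    assert (E1 := Rmin_l e (Rmin e' d)); assert (E2 := Rmin_r e (Rmin e' d)).
    assert (E3 := Rmin_l e' d); assert (E4 := Rmin_r e' d).
    assert (T := Cmod_minus_le z w q); rewrite (Cmod_minus_sym z w) in T.
    rewrite Ugood by (split; [lra|apply Hne; lra]).
    specialize (Hce w ltac:(lra)); apply Rabs_lt_between in Hce.
    assert (M1 := Rmax_l (V z) 0); assert (M2 := Rmax_r (V z) 0).
    apply Rmax_lub_lt; lra.
- assert (G1 : good z1) by (split; auto).
  (* A point with V > 0 has modulus below [S], hence lies in the square, so the maximum over the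
     square dominates it. *)
  assert (Hall : forall w, good w -> 0 < V w -> U w <= U m).
  { intros w Hw HVw; apply Hm.
    assert (HwS : Cmod w < S).
    { apply Rnot_le_lt; intros HSw; specialize (HS w (proj1 Hw) (proj2 Hw) HSw); lra. }
    assert (M1 := Rmax_l S 0); assert (M2 := Rmax_Cmod w).
    split; (eapply Rle_trans; [|apply Rlt_le, (Rlt_le_trans _ _ _ HwS M1)]);
      (eapply Rle_trans; [|exact M2]); [apply Rmax_l|apply Rmax_r]. }
  assert (H1 := Hall z1 G1 Hpos); rewrite (Ugood z1 G1), Rmax_left in H1 by lra.
  assert (Gm : good m /\ 0 < V m).
  { apply NNPP; intros Hn; rewrite (Ubad m Hn) in H1; lra. }
  destruct Gm as [[Gm1 Gm2] Gm3].
  destruct (HV m Gm1 Gm2) as [_ [l [Hl1 Hl2]]].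
  assert (Hm2 : 2 * d <= Cmod (m - q)).
  { apply Rnot_lt_le; intros Hlt; specialize (Hq m (conj Gm1 Hlt) Gm2); lra. }
  destruct (notin_nearby P m Gm2) as [e [He Hne]].
  apply (Rlt_irrefl 0), (Rlt_le_trans _ l); auto.
  apply (is_laplacian_at_max V m l (Rmin e d)); auto; [apply Rmin_glb_lt; auto|].
  intros w Hw; apply Rnot_lt_le; intros Hlt.
  assert (E1 := Rmin_l e d); assert (E2 := Rmin_r e d).
  assert (T := Cmod_minus_le m w q); rewrite (Cmod_minus_sym m w) in T.
  assert (Gw : good w) by (split; [lra|apply Hne; lra]).
  assert (Hw2 := Hall w Gw ltac:(lra)).
  rewrite (Ugood w Gw), (Ugood m (conj Gm1 Gm2)), !Rmax_left in Hw2 by lra; lra.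
Qed.

Definition bounded_above_near (u : C -> R) (p : C) : Prop :=
  exists M d, 0 < d /\ forall z, 0 < Cmod (z - p) < d -> u z <= M.

Definition bounded_above_inf (u : C -> R) : Prop :=
  exists M S, forall z, S <= Cmod z -> u z <= M.

(** If H z exceeded H q by eta, the function V = H - (H q + 2 eta / 3) + eps B would be nonpositive
    near [q] by continuity, and near the poles and infinity because the barrier B outweighs the
    upper bounds of H. The maximum principle gives V z <= 0, whereas eps B z > - eta / 3 makes V z
    positive. *)
Lemma harmonic_bounded_above_le (P : list C) (H : C -> R) (z q : C) :
  (forall w, ~ In w P -> harmonic_at H w) ->
  (forall p, In p P -> bounded_above_near H p) -> bounded_above_inf H ->
  ~ In z P -> ~ In q P -> H z <= H q.
Proof.
intros HH HP [M [S HS]] Hz Hq; apply Rnot_lt_le; intros Hlt.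
set (eta := H z - H q); assert (Heta : 0 < eta) by (unfold eta; lra).
assert (Hzq : 0 < Cmod (z - q)) by (apply Cmod_minus_pos; intros E; subst z; lra).
destruct (proj1 (HH q Hq) (eta / 3) ltac:(lra)) as [d0 [Hd0 Hc]].
(* Halving keeps the annulus from d to 2 d inside the disc of continuity, and leaves [z] outside the
   excluded disc. *)
set (d := Rmin d0 (Cmod (z - q)) / 2).
assert (D0 : 0 < Rmin d0 (Cmod (z - q))) by (apply Rmin_glb_lt; auto).
assert (D1 := Rmin_l d0 (Cmod (z - q))); assert (D2 := Rmin_r d0 (Cmod (z - q))).
assert (Hd : 0 < d) by (unfold d; lra).
destruct (barrier_upper q P d Hd) as [K HK].
set (B := barrier q P).
(* X exceeds both |B z| and |K - ln d|, so with eps = eta / (3 X) both contributions of the barrier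
   stay below eta / 3. *)
set (X := Rabs (B z) + Rabs (K - ln d) + 1).
assert (HX : 0 < X).
{ assert (A1 := Rabs_pos (B z)); assert (A2 := Rabs_pos (K - ln d)); unfold X; lra. }
set (eps := eta / (3 * X)).
assert (Heps : 0 < eps) by (apply Rdiv_lt_0_compat; lra).
assert (HepsX : eps * X = eta / 3) by (unfold eps; field; lra).
assert (Ebound : forall x, Rabs x <= X - 1 -> - (eta / 3) < eps * x < eta / 3).
{ intros x Hx; rewrite <- HepsX; apply Rabs_le_between in Hx; nra. }
assert (BK : forall w, d <= Cmod (w - q) -> ~ In w P -> B w <= K - ln d).
{ intros w Hw HwP; specialize (HK w Hw HwP).
  assert (ln d <= ln (Cmod (w - q))) by (apply ln_le; auto); fold B in HK; lra. }
set (V := fun w => (H w + (- (H q + 2 * eta / 3))) + eps * B w).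
assert (Hneg : V z <= 0).
{ apply (subharmonic_at_pos_max P q V d
    (Rmax S (Cmod q + exp (K + (Rabs M + Rabs (H q) + eta) / eps))) z); auto.
  - intros w Hw HwP.
    assert (Hwq : w <> q) by (apply Cmod_minus_neq; lra).
    destruct (barrier_subharmonic q P w Hwq HwP) as [C1 [l [Hl1 Hl2]]].
    destruct (HH w HwP) as [C2 L2]; split.
    + apply cont_at_plus; [apply cont_at_plus; auto; apply cont_at_const|].
      apply cont_at_mult; auto; apply cont_at_const.
    + exists ((0 + 0) + eps * l); split; [rewrite !Rplus_0_l; apply Rmult_lt_0_compat; auto|].
      apply is_laplacian_plus; [apply is_laplacian_plus; auto; apply is_laplacian_const|].
      apply is_laplacian_scal; auto.
  - intros w [Hw1 Hw2] HwP.
    specialize (Hc w ltac:(unfold d in Hw2; lra)); apply Rabs_lt_between in Hc.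
    specialize (BK w Hw1 HwP).
    assert (E := Ebound (K - ln d) ltac:(assert (A1 := Rabs_pos (B z)); unfold X; lra)).
    assert (eps * B w <= eps * (K - ln d)) by (apply Rmult_le_compat_l; lra).
    unfold V; lra.
  - intros p Hp.
    destruct (barrier_near_pole q P p d Hd Hp) as [K' HK'].
    destruct (HP p Hp) as [M' [e [He HM']]].
    (* Below this threshold eps B is at most -(|M'| + |H q|), which cancels the bound M' on H and
       the term -H q. *)
    destruct (ln_to_minf (- K' - (Rabs M' + Rabs (H q)) / eps) p) as [e' [He' Hln]].
    exists (Rmin e e'); split; [apply Rmin_glb_lt; auto|].
    intros w Hw HwP Hwp.
    assert (E1 := Rmin_l e e'); assert (E2 := Rmin_r e e').
    assert (Hwp0 : 0 < Cmod (w - p)) by (apply Cmod_minus_pos; intros E; subst w; auto).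
    specialize (HM' w ltac:(lra)); specialize (Hln w ltac:(lra)).
    specialize (HK' w Hw HwP).
    assert (eps * B w <= eps * (- ((Rabs M' + Rabs (H q)) / eps))).
    { apply Rmult_le_compat_l; [lra|]; unfold B; lra. }
    replace (eps * (- ((Rabs M' + Rabs (H q)) / eps))) with (- (Rabs M' + Rabs (H q)))
      in * by (field; lra).
    assert (A1 := Rle_abs M'); assert (A2 := Rle_abs (- H q)); rewrite Rabs_Ropp in A2.
    unfold V; lra.
  - intros w Hw HwP HwS.
    assert (M1 := Rmax_l S (Cmod q + exp (K + (Rabs M + Rabs (H q) + eta) / eps))).
    assert (M2 := Rmax_r S (Cmod q + exp (K + (Rabs M + Rabs (H q) + eta) / eps))).
    specialize (HS w ltac:(lra)); specialize (HK w Hw HwP).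
    assert (T := Cmod_triangle_minus w q).
    assert (Hln : K + (Rabs M + Rabs (H q) + eta) / eps <= ln (Cmod (w - q))).
    { rewrite <- (ln_exp (K + _)); apply ln_le; [apply exp_pos|lra]. }
    assert (eps * B w <= eps * (- ((Rabs M + Rabs (H q) + eta) / eps))).
    { apply Rmult_le_compat_l; [lra|]; unfold B; lra. }
    replace (eps * (- ((Rabs M + Rabs (H q) + eta) / eps))) with (- (Rabs M + Rabs (H q) + eta))
      in * by (field; lra).
    assert (A1 := Rle_abs M); assert (A2 := Rle_abs (- H q)); rewrite Rabs_Ropp in A2.
    unfold V; lra.
  - unfold d; lra. }
assert (E := Ebound (B z) ltac:(assert (A1 := Rabs_pos (K - ln d)); unfold X; lra)).
unfold V, eta in *; lra.
Qed.

(** Liouville: a finite set is removable for bounded harmonic functions, and the plane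
    is parabolic. *)
Lemma harmonic_bounded_above_const (P : list C) (H : C -> R) (z q : C) :
  (forall w, ~ In w P -> harmonic_at H w) ->
  (forall p, In p P -> bounded_above_near H p) -> bounded_above_inf H ->
  ~ In z P -> ~ In q P -> H z = H q.
Proof. intros; apply Rle_antisym; eapply harmonic_bounded_above_le; eauto. Qed.

(** [poly n L N]: [N] is a polynomial function of degree at most [n] whose coefficient of
    degree [n] is [L], in Horner form. *)
Fixpoint poly (n : nat) (L : C) (N : C -> C) : Prop :=
  match n with
  | O => forall z, N z = L
  | S n => exists M c, poly n L M /\ forall z, N z = (z * M z + c)%C
  end.

Lemma poly_plus_const (n : nat) (L c : C) (N : C -> C) : (0 < n)%nat ->
  poly n L N -> poly n L (fun z => N z + c)%C.
Proof.
destruct n as [|n]; [lia|]; intros _ (M & c' & H1 & H2).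
exists M, (c' + c)%C; split; auto; intros z; rewrite H2; ring.
Qed.

Lemma poly_plus (n : nat) : forall (L L' : C) (N N' : C -> C),
  poly n L N -> poly n L' N' -> poly n (L + L') (fun z => N z + N' z)%C.
Proof.
induction n as [|n IH]; simpl; intros L L' N N'.
- intros H H' z; rewrite H, H'; auto.
- intros (M & c & H1 & H2) (M' & c' & H1' & H2').
  exists (fun z => M z + M' z)%C, (c + c')%C; split; auto.
  intros z; rewrite H2, H2'; ring.
Qed.

Lemma poly_scal (n : nat) : forall (L k : C) (N : C -> C),
  poly n L N -> poly n (k * L) (fun z => k * N z)%C.
Proof.
induction n as [|n IH]; simpl; intros L k N.
- intros H z; rewrite H; auto.
- intros (M & c & H1 & H2); exists (fun z => k * M z)%C, (k * c)%C; split; auto.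
  intros z; rewrite H2; ring.
Qed.

Lemma poly_mult_linear (n : nat) : forall (L p : C) (N : C -> C),
  poly n L N -> poly (S n) L (fun z => (z - p) * N z)%C.
Proof.
induction n as [|n IH]; intros L p N.
- intros H; exists N, (- (p * L))%C; split; auto; intros z; rewrite H; ring.
- intros (M & c & H1 & H2).
  exists (fun z => (z - p) * M z + c)%C, (- (p * c))%C; split.
  + apply poly_plus_const; [lia|]; apply IH; auto.
  + intros z; rewrite H2; ring.
Qed.

(** Synthetic division: if N = z M + c and M = (z - a) Q + M a, then N = (z - a) (z Q + M a) + N
    a. *)
Lemma poly_divide (n : nat) : forall (L a : C) (N : C -> C), poly (S n) L N ->
  exists M, poly n L M /\ forall z, N z = ((z - a) * M z + N a)%C.
Proof.
induction n as [|n IH]; intros L a N (M & c & H1 & H2).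
- exists M; split; auto; intros z; rewrite !H2; simpl in H1; rewrite !H1; ring.
- destruct (IH L a M H1) as [Q [HQ1 HQ2]].
  exists (fun z => z * Q z + M a)%C; split.
  + exists Q, (M a); auto.
  + intros z; rewrite !H2, (HQ2 z); ring.
Qed.

Lemma poly_derive (n : nat) : forall (L : C) (N : C -> C), poly n L N ->
  exists N' N'', forall z, cderive N z (N' z) /\ cderive N' z (N'' z).
Proof.
induction n as [|n IH]; intros L N.
- intros H; exists (fun _ => RtoC 0), (fun _ => RtoC 0); intros z; split; [|apply cderive_const].
  eapply is_derive_ext; [intros t; symmetry; apply H|apply cderive_const].
- intros (M & c & H1 & H2); destruct (IH L M H1) as (M' & M'' & HM).
  exists (fun z => 1 * M z + z * M' z + 0)%C,
    (fun z => (0 * M z + 1 * M' z) + (1 * M' z + z * M'' z) + 0)%C.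
  intros z; destruct (HM z) as [D1 D2]; split.
  + eapply is_derive_ext; [intros t; symmetry; apply H2|].
    apply cderive_plus; [|apply cderive_const].
    apply cderive_mult; auto; apply cderive_id.
  + apply cderive_plus; [|apply cderive_const].
    apply cderive_plus.
    * apply (cderive_mult (fun _ => RtoC 1)); auto; apply cderive_const.
    * apply cderive_mult; auto; apply cderive_id.
Qed.

(** From |M| >= m > 0 far out one gets |z M + c| >= m |z| - |c|. The constant m is |l| in degree one
    and 1, from the induction hypothesis, in higher degrees. *)
Lemma poly_to_inf (n : nat) : forall (K : R) (l : C) (N : C -> C),
  l <> 0 -> poly (S n) l N -> exists S, forall z, S <= Cmod z -> K <= Cmod (N z).
Proof.
assert (Step : forall (m K : R) (c : C) (M N : C -> C) (S0 : R), 0 < m ->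
  (forall z, S0 <= Cmod z -> m <= Cmod (M z)) -> (forall z, N z = (z * M z + c)%C) ->
  exists S, forall z, S <= Cmod z -> K <= Cmod (N z)).
{ intros m K c M N S0 Hm HM HN.
  exists (Rmax S0 ((Rabs K + Cmod c) / m)); intros z Hz.
  assert (M1 := Rmax_l S0 ((Rabs K + Cmod c) / m)).
  assert (M2 := Rmax_r S0 ((Rabs K + Cmod c) / m)).
  specialize (HM z ltac:(lra)); rewrite HN.
  assert (T := Cmod_triangle (z * M z + c) (- c)).
  replace (z * M z + c + - c)%C with (z * M z)%C in T by ring.
  rewrite Cmod_opp, Cmod_mult in T.
  assert (Q : (Rabs K + Cmod c) / m * m <= Cmod z * Cmod (M z)).
  { assert (Z := Cmod_ge_0 z); assert (A0 := Rabs_pos K); assert (C0 := Cmod_ge_0 c).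
    apply Rmult_le_compat; try lra; apply Rle_div_r; lra. }
  replace ((Rabs K + Cmod c) / m * m) with (Rabs K + Cmod c) in Q by (field; lra).
  assert (A0 := Rle_abs K); lra. }
induction n as [|n IH]; intros K l N Hl (M & c & H1 & H2).
- apply (Step (Cmod l) K c M N 0); auto; [apply Cmod_gt_0; auto|].
  intros z _; simpl in H1; rewrite H1; lra.
- destruct (IH 1 l M Hl H1) as [S0 HS0].
  apply (Step 1 K c M N S0); auto; lra.
Qed.

(** Without roots, -ln |N| is harmonic on the whole plane and at most 0 where |N| >= 1, hence
    constant by Liouville; but |N| tends to infinity. *)
Lemma poly_root (n : nat) (l : C) (N : C -> C) : l <> 0 -> poly (S n) l N -> exists a, N a = 0.
Proof.
intros Hl HN; apply NNPP; intros Hno.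
assert (Hnz : forall z, N z <> 0) by (intros z E; apply Hno; exists z; auto).
destruct (poly_derive _ _ _ HN) as (N' & N'' & HD).
set (u := fun z => -1 * ln (Cmod (N z))).
assert (Hu : forall z, harmonic_at u z).
{ intros z; destruct (HD z) as [D1 D2]; apply harmonic_scal; split.
  - apply cont_at_ln_Cmod; auto; eapply cderive_cont; eauto.
  - apply is_laplacian_grad with (g := fun w => (N' w / N w)%C) (d := 1); [lra| |].
    + intros w _; apply grad_ln_Cmod; auto; apply HD.
    + eexists; apply cderive_mult; [exact D2|]; apply cderive_inv; eauto. }
assert (Hconst : forall z, u z = u 0).
{ intros z; apply (harmonic_bounded_above_const nil); auto; try (intros ? []).
  destruct (poly_to_inf n 1 l N Hl HN) as [S HS].
  exists 0, S; intros w Hw; specialize (HS w Hw).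
  assert (ln 1 <= ln (Cmod (N w))) by (apply ln_le; lra).
  rewrite ln_1 in *; unfold u; lra. }
destruct (poly_to_inf n (Cmod (N 0) + 1) l N Hl HN) as [S HS].
assert (H1 : Cmod (RtoC (Rmax S 0)) = Rmax S 0).
{ rewrite Cmod_R; apply Rabs_pos_eq, Rmax_r. }
specialize (HS (RtoC (Rmax S 0)) ltac:(rewrite H1; apply Rmax_l)).
specialize (Hconst (RtoC (Rmax S 0))); unfold u in Hconst.
assert (H0 : 0 < Cmod (N 0)) by (apply Cmod_gt_0; auto).
assert (ln (Cmod (N 0)) < ln (Cmod (N (RtoC (Rmax S 0))))) by (apply ln_increasing; lra).
lra.
Qed.

Fixpoint roots_prod (s : list C) (z : C) : C :=
  match s with
  | nil => 1
  | a :: s => ((z - a) * roots_prod s z)%C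
  end.

Lemma poly_splits (n : nat) : forall N, poly n 1 N ->
  exists s, length s = n /\ forall z, N z = roots_prod s z.
Proof.
induction n as [|n IH]; intros N HN.
- exists nil; split; auto.
- destruct (poly_root n 1 N C1_nz HN) as [a Ha].
  destruct (poly_divide n 1 a N HN) as [M [HM1 HM2]].
  destruct (IH M HM1) as [s [Hs1 Hs2]].
  exists (a :: s); split; [simpl; auto|].
  intros z; simpl; rewrite HM2, Ha, Hs2; ring.
Qed.

Lemma poly_roots_prod (s : list C) : poly (length s) 1 (roots_prod s).
Proof.
induction s as [|a s IH]; simpl length; [intros z; reflexivity|].
exact (poly_mult_linear _ _ a _ IH).
Qed.

Lemma roots_prod_eq_0 (s : list C) (z : C) : roots_prod s z = 0 <-> In z s.
Proof.
induction s as [|a s IH]; simpl.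
- split; [intros H; apply C1_nz in H; auto|tauto].
- rewrite <- IH; split.
  + intros H; destruct (classic (z = a)) as [E|E]; [left; auto|right].
    apply NNPP; intros Hn; apply (Cmult_neq_0 (z - a)%C (roots_prod s z)); auto.
    apply Cminus_eq_contra; auto.
  + intros [->|H]; [ring|rewrite H; ring].
Qed.

(** * Bounds from the gradient *)

Lemma derive_bound_increment (f f1 : R -> R) (a b M : R) :
  (forall t, Rmin a b <= t <= Rmax a b -> is_derive f t (f1 t) /\ Rabs (f1 t) <= M) ->
  Rabs (f b - f a) <= M * Rabs (b - a).
Proof.
intros H.
destruct (MVT_gen f a b f1) as [c [Hc1 Hc2]].
- intros t Ht; apply H; lra.
- intros t Ht; apply continuity_pt_filterlim.
  apply (ex_derive_continuous (K := R_AbsRing) (V := R_NormedModule)).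
  exists (f1 t); apply H; auto.
- rewrite Hc2, Rabs_mult; apply Rmult_le_compat_r; [apply Rabs_pos|apply H; auto].
Qed.

Lemma Rabs_triangle_minus (a b : R) : Rabs a <= Rabs (a - b) + Rabs b.
Proof. replace a with ((a - b) + b) at 1 by ring; apply Rabs_triang. Qed.

Lemma Im_le_Cmod (c : C) : Rabs (Im c) <= Cmod c.
Proof. eapply Rle_trans; [apply Rmax_r|apply (Rmax_Cmod c)]. Qed.

(** The value at z is compared with that at the corner (a + e, b + e) along one horizontal and one
    vertical segment of length at most 2 e, which must avoid [p]. With e = d / 4 the square stays in
    the disc. *)
Lemma grad_bounded_punctured (u : C -> R) (g : C -> C) (p : C) (d M : R) : 0 < d ->
  (forall z, 0 < Cmod (z - p) < d -> grad u z (g z) /\ Cmod (g z) <= M) ->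
  exists B e, 0 < e /\ forall z, 0 < Cmod (z - p) < e -> Rabs (u z) <= B.
Proof.
destruct p as [a b]; intros Hd H.
set (e := d / 4).
assert (Hin : forall x y, Rabs (x - a) <= e -> Rabs (y - b) <= e -> (x <> a \/ y <> b) ->
  0 < Cmod ((x, y) - (a, b)) < d).
{ intros x y Hx Hy Hne; split.
  - apply Cmod_minus_pos; intros E; injection E; intros; destruct Hne; auto.
  - replace d with (2 * (d / 2)) by field; apply Cmod_lt_2max; simpl.
    + replace (x + - a) with (x - a) by ring; unfold e in *; lra.
    + replace (y + - b) with (y - b) by ring; unfold e in *; lra. }
assert (Hhor : forall x1 x2 y, Rabs (x1 - a) <= e -> Rabs (x2 - a) <= e -> Rabs (y - b) <= e ->
  y <> b -> Rabs (u (x2, y) - u (x1, y)) <= M * (2 * e)).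
{ intros x1 x2 y H1 H2 Hy Hne; apply Rabs_le_between in H1; apply Rabs_le_between in H2.
  assert (Hx12 : Rabs (x2 - x1) <= 2 * e) by (apply Rabs_le; lra).
  assert (HM : 0 <= M).
  { destruct (H (x1, y)) as [_ G]; [apply Hin; auto; apply Rabs_le; lra|].
    eapply Rle_trans; [apply Cmod_ge_0|exact G]. }
  eapply Rle_trans;
    [apply (derive_bound_increment (fun t => u (t, y)) (fun t => Re (g (t, y))) x1 x2 M)|].
  - intros t Ht.
    assert (Ht' : Rabs (t - a) <= e).
    { unfold Rmin, Rmax in Ht; apply Rabs_le; destruct (Rle_dec x1 x2); lra. }
    destruct (H (t, y)) as [[G _] G2]; [apply Hin; auto|].
    split; [exact G|eapply Rle_trans; [apply re_le_Cmod|exact G2]].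
  - apply Rmult_le_compat_l; auto. }
assert (Hver : forall x y1 y2, Rabs (y1 - b) <= e -> Rabs (y2 - b) <= e -> Rabs (x - a) <= e ->
  x <> a -> Rabs (u (x, y2) - u (x, y1)) <= M * (2 * e)).
{ intros x y1 y2 H1 H2 Hx Hne; apply Rabs_le_between in H1; apply Rabs_le_between in H2.
  assert (Hy12 : Rabs (y2 - y1) <= 2 * e) by (apply Rabs_le; lra).
  assert (HM : 0 <= M).
  { destruct (H (x, y1)) as [_ G]; [apply Hin; auto; apply Rabs_le; lra|].
    eapply Rle_trans; [apply Cmod_ge_0|exact G]. }
  eapply Rle_trans;
    [apply (derive_bound_increment (fun t => u (x, t)) (fun t => - Im (g (x, t))) y1 y2 M)|].
  - intros t Ht.
    assert (Ht' : Rabs (t - b) <= e).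
    { unfold Rmin, Rmax in Ht; apply Rabs_le; destruct (Rle_dec y1 y2); lra. }
    destruct (H (x, t)) as [[_ G] G2]; [apply Hin; auto|].
    split; [exact G|rewrite Rabs_Ropp; eapply Rle_trans; [apply Im_le_Cmod|exact G2]].
  - apply Rmult_le_compat_l; auto. }
assert (Ha : Rabs (a + e - a) <= e) by (apply Rabs_le; unfold e; lra).
assert (Hb : Rabs (b + e - b) <= e) by (apply Rabs_le; unfold e; lra).
exists (Rabs (u (a + e, b + e)) + 2 * (M * (2 * e))), e; split; [unfold e; lra|].
intros [x y] [Hz1 Hz2].
assert (R1 : Rabs (x - a) <= e).
{ apply Rlt_le; eapply Rle_lt_trans; [|exact Hz2].
  eapply Rle_trans; [|apply Rmax_Cmod]; apply Rmax_l. }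
assert (R2 : Rabs (y - b) <= e).
{ apply Rlt_le; eapply Rle_lt_trans; [|exact Hz2].
  eapply Rle_trans; [|apply Rmax_Cmod]; apply Rmax_r. }
(* On the line y = b the horizontal move takes place at height b + e; otherwise at height y, which
   misses [p]. *)
destruct (Req_dec y b) as [E|E].
- assert (Hx : x <> a).
  { intros E2; subst; replace ((a, b) - (a, b))%C with (RtoC 0) in Hz1 by ring.
    rewrite Cmod_0 in Hz1; lra. }
  assert (V1 := Hver x (b + e) y Hb R2 R1 Hx).
  assert (V2 := Hhor (a + e) x (b + e) Ha R1 Hb ltac:(unfold e; lra)).
  assert (T1 := Rabs_triangle_minus (u (x, y)) (u (x, b + e))).
  assert (T2 := Rabs_triangle_minus (u (x, b + e)) (u (a + e, b + e))).
  lra.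
- assert (V1 := Hhor (a + e) x y Ha R1 R2 E).
  assert (V2 := Hver (a + e) (b + e) y Hb R2 Ha ltac:(unfold e; lra)).
  assert (T1 := Rabs_triangle_minus (u (x, y)) (u (a + e, y))).
  assert (T2 := Rabs_triangle_minus (u (a + e, y)) (u (a + e, b + e))).
  lra.
Qed.

(** The functions s f + K / t with s = 1 and s = -1 are nonincreasing, which replaces integrating K
    / t^2 from S to T. *)
Lemma derive_inverse_square_bound (f f1 : R -> R) (S T K : R) : 0 < S -> S <= T -> 0 <= K ->
  (forall t, S <= t <= T -> is_derive f t (f1 t) /\ Rabs (f1 t) <= K / t ^ 2) ->
  Rabs (f T - f S) <= K / S.
Proof.
intros HS HT HK H; destruct (Req_dec S T) as [<-|Hne].
{ rewrite Rminus_eq_0, Rabs_R0; apply Rdiv_le_0_compat; lra. }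
assert (Hdiv : forall t, 0 < t -> is_derive (fun t => K / t) t (- (K / t ^ 2))).
{ intros t Ht; auto_derive; [lra|field; lra]. }
assert (G : forall s, s = 1 \/ s = -1 -> s * (f T - f S) <= K / S).
{ intros s Hs.
  destruct (MVT_cor2 (fun t => s * f t + K / t) (fun t => s * f1 t + - (K / t ^ 2)) S T)
    as [c [Hc1 Hc2]]; [lra| |].
  - intros c Hc; apply is_derive_Reals.
    apply (is_derive_plus (K := R_AbsRing) (V := R_NormedModule) (fun t => s * f t)).
    + apply is_derive_scal, H; auto.
    + apply Hdiv; lra.
  - destruct (H c ltac:(lra)) as [_ G]; apply Rabs_le_between in G.
    assert (G2 : s * f1 c + - (K / c ^ 2) <= 0) by (destruct Hs; subst s; lra).
    assert (0 <= K / T) by (apply Rdiv_le_0_compat; lra).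
    assert ((s * f1 c + - (K / c ^ 2)) * (T - S) <= 0) by nra.
    lra. }
apply Rabs_le; assert (G1 := G 1 (or_introl eq_refl)); assert (G2 := G (-1) (or_intror eq_refl)).
lra.
Qed.

(** The path to (x, y) runs up or down the line of abscissa S from (S, S) or (S, -S), costing K / S,
    then horizontally at height y. The second piece has length at most 2 |y| and derivative at most
    K / y^2, costing 2 K / S. The other half |y| <= |x| follows by exchanging the coordinates. *)
Lemma partials_bounded_inf_half (v vx vy : R -> R -> R) (S K : R) : 0 < S -> 0 <= K ->
  (forall x y, S <= Rmax (Rabs x) (Rabs y) ->
     is_derive (fun t => v t y) x (vx x y) /\ is_derive (fun t => v x t) y (vy x y) /\
     Rabs (vx x y) <= K / Rmax (Rabs x) (Rabs y) ^ 2 /\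
     Rabs (vy x y) <= K / Rmax (Rabs x) (Rabs y) ^ 2) ->
  forall x y, S <= Rabs y -> Rabs x <= Rabs y ->
    Rabs (v x y) <= Rabs (v S S) + Rabs (v S (- S)) + 3 * (K / S).
Proof.
intros HS HK H x y Hy Hxy.
assert (Dec : forall s t, 0 < s -> s <= t -> K / t ^ 2 <= K / s ^ 2).
{ intros s t Hs Hst; apply Rmult_le_compat_l; auto.
  apply Rinv_le_contravar; [apply pow_lt; auto|apply pow_incr; lra]. }
assert (H1 : Rabs (v x y - v S y) <= 2 * (K / S)).
{ apply Rle_trans with (K / Rabs y ^ 2 * Rabs (x - S)).
  - apply (derive_bound_increment (fun t => v t y) (fun t => vx t y) S x).
    intros t _; assert (M2 := Rmax_r (Rabs t) (Rabs y)).
    destruct (H t y ltac:(lra)) as (D & _ & B & _); split; auto.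
    eapply Rle_trans; [exact B|apply Dec; lra].
  - assert (B1 : Rabs (x - S) <= 2 * Rabs y).
    { assert (T := Rabs_triang x (- S)); rewrite Rabs_Ropp, (Rabs_pos_eq S) in T by lra.
      unfold Rminus; lra. }
    apply Rle_trans with (K / Rabs y ^ 2 * (2 * Rabs y)).
    + apply Rmult_le_compat_l; auto; apply Rdiv_le_0_compat; auto; apply pow_lt; lra.
    + replace (K / Rabs y ^ 2 * (2 * Rabs y)) with (2 * (K / Rabs y)) by (field; lra).
      apply Rmult_le_compat_l; [lra|]; apply Rmult_le_compat_l; auto.
      apply Rinv_le_contravar; auto. }
assert (H2 : Rabs (v S y) <= Rabs (v S S) + Rabs (v S (- S)) + K / S).
{ assert (P1 := Rabs_pos (v S S)); assert (P2 := Rabs_pos (v S (- S))).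
  destruct (Rle_lt_dec 0 y) as [Hy0|Hy0].
  - rewrite Rabs_pos_eq in Hy by auto.
    assert (D := derive_inverse_square_bound (fun t => v S t) (fun t => vy S t) S y K HS Hy HK).
    cbv beta in D; assert (T := Rabs_triangle_minus (v S y) (v S S)).
    enough (Rabs (v S y - v S S) <= K / S) by lra.
    apply D; intros t Ht; assert (M2 := Rmax_r (Rabs S) (Rabs t)).
    rewrite (Rabs_pos_eq t) in M2 by lra.
    destruct (H S t) as (_ & D2 & _ & B); [rewrite (Rabs_pos_eq t) by lra; lra|].
    split; auto; eapply Rle_trans; [exact B|].
    rewrite (Rabs_pos_eq t) by lra; apply Dec; lra.
  - rewrite Rabs_left in Hy by auto.
    assert (D := derive_inverse_square_bound (fun t => v S (- t)) (fun t => - vy S (- t))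
      S (- y) K HS Hy HK).
    cbv beta in D; rewrite Ropp_involutive in D.
    assert (T := Rabs_triangle_minus (v S y) (v S (- S))).
    enough (Rabs (v S y - v S (- S)) <= K / S) by lra.
    apply D; intros t Ht; assert (M2 := Rmax_r (Rabs S) (Rabs (- t))).
    rewrite Rabs_Ropp, (Rabs_pos_eq t) in M2 by lra.
    destruct (H S (- t)) as (_ & D2 & _ & B); [rewrite Rabs_Ropp, (Rabs_pos_eq t) by lra; lra|].
    split.
    + eapply R_derive_eq; [|apply (is_derive_comp (fun s => v S s) Ropp t _ (-1) D2)].
      * unfold scal; simpl; unfold mult; simpl; ring.
      * auto_derive; auto; ring.
    + rewrite Rabs_Ropp; eapply Rle_trans; [exact B|].
      rewrite Rabs_Ropp, (Rabs_pos_eq t) by lra; apply Dec; lra. }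
assert (T := Rabs_triangle_minus (v x y) (v S y)).
lra.
Qed.

Lemma grad_bounded_inf (u : C -> R) (g : C -> C) (S K : R) : 0 < S -> 0 <= K ->
  (forall z, S <= Cmod z -> grad u z (g z) /\ Cmod (g z) <= K / Cmod z ^ 2) ->
  exists B, forall z, 2 * S <= Cmod z -> Rabs (u z) <= B.
Proof.
intros HS HK H.
assert (Hpart : forall x y, S <= Rmax (Rabs x) (Rabs y) ->
     is_derive (fun t => u (t, y)) x (Re (g (x, y))) /\
     is_derive (fun t => u (x, t)) y (- Im (g (x, y))) /\
     Rabs (Re (g (x, y))) <= K / Rmax (Rabs x) (Rabs y) ^ 2 /\
     Rabs (- Im (g (x, y))) <= K / Rmax (Rabs x) (Rabs y) ^ 2).
{ intros x y Hxy; assert (M := Rmax_Cmod (x, y)); simpl in M.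
  destruct (H (x, y) ltac:(lra)) as [[G1 G2] G3].
  assert (Hle : Cmod (g (x, y)) <= K / Rmax (Rabs x) (Rabs y) ^ 2).
  { eapply Rle_trans; [exact G3|]; apply Rmult_le_compat_l; auto.
    apply Rinv_le_contravar; [apply pow_lt; lra|apply pow_incr; lra]. }
  split; [exact G1|split; [exact G2|split]].
  - eapply Rle_trans; [apply re_le_Cmod|exact Hle].
  - rewrite Rabs_Ropp; eapply Rle_trans; [apply Im_le_Cmod|exact Hle]. }
assert (B1 := partials_bounded_inf_half (fun x y => u (x, y)) (fun x y => Re (g (x, y)))
  (fun x y => - Im (g (x, y))) S K HS HK Hpart).
assert (B2 := partials_bounded_inf_half (fun x y => u (y, x)) (fun x y => - Im (g (y, x)))
  (fun x y => Re (g (y, x))) S K HS HK).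
cbv beta in B2.
assert (Hsw : forall x y : R, Rabs y <= Rabs x -> S <= Rabs x ->
  Rabs (u (x, y)) <= Rabs (u (S, S)) + Rabs (u (- S, S)) + 3 * (K / S)).
{ intros x y H1 H2; apply B2; auto.
  intros s t Hst; rewrite Rmax_comm in Hst |- *.
  destruct (Hpart t s Hst) as (G1 & G2 & G3 & G4); auto. }
exists (Rabs (u (S, S)) + Rabs (u (S, - S)) + Rabs (u (- S, S)) + 3 * (K / S)).
intros [x y] Hz.
assert (P1 := Rabs_pos (u (S, - S))); assert (P2 := Rabs_pos (u (- S, S))).
destruct (Rle_lt_dec (Rabs x) (Rabs y)) as [Hxy|Hxy].
- assert (S <= Rabs y).
  { apply Rnot_lt_le; intros Hlt; assert (C := Cmod_lt_2max (x, y) S); simpl in C.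
    specialize (C ltac:(lra) Hlt); lra. }
  specialize (B1 x y ltac:(auto) Hxy); lra.
- assert (S <= Rabs x).
  { apply Rnot_lt_le; intros Hlt; assert (C := Cmod_lt_2max (x, y) S); simpl in C.
    specialize (C Hlt ltac:(lra)); lra. }
  specialize (Hsw x y ltac:(lra) ltac:(auto)); lra.
Qed.

(** * Partial fractions of the character form *)

Fixpoint log_sum (r : C -> R) (P : list C) (z : C) : R :=
  match P with
  | nil => 0
  | p :: P => r p * ln (Cmod (z - p)) + log_sum r P z
  end.

Fixpoint pole_sum (r : C -> R) (P : list C) (z : C) : C :=
  match P with
  | nil => RtoC 0
  | p :: P => (RtoC (r p) * / (z - p) + pole_sum r P z)%C
  end.

Fixpoint res_sum (r : C -> R) (P : list C) : R :=
  match P with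
  | nil => 0
  | p :: P => r p + res_sum r P
  end.

Lemma grad_log_sum (r : C -> R) (P : list C) (z : C) :
  ~ In z P -> grad (log_sum r P) z (pole_sum r P z).
Proof.
induction P as [|p P IH]; simpl; intros H; [apply grad_const|].
apply grad_plus; [|tauto].
apply grad_scal, grad_ln_dist; intros E; apply H; auto.
Qed.

Lemma harmonic_log_sum (r : C -> R) (P : list C) (z : C) :
  ~ In z P -> harmonic_at (log_sum r P) z.
Proof.
induction P as [|p P IH]; simpl; intros H.
- split; [apply cont_at_const|apply is_laplacian_const].
- apply harmonic_plus; [|tauto].
  apply harmonic_scal, harmonic_ln_dist; intros E; apply H; auto.
Qed.

Lemma ccont_inv_shift (p z : C) : z <> p -> ccont (fun w => / (w - p))%C z.
Proof.
intros H; apply (ccont_inv (fun w => w - p)%C); [apply ccont_shift|apply Cminus_eq_contra; auto].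
Qed.

Lemma ccont_pole_sum (r : C -> R) (P : list C) (z : C) : ~ In z P -> ccont (pole_sum r P) z.
Proof.
induction P as [|p P IH]; simpl; intros H; [apply ccont_const|].
apply ccont_plus; [|apply IH; tauto].
apply ccont_mult; [apply ccont_const|apply ccont_inv_shift]; intros E; apply H; auto.
Qed.

Lemma ccont_bounded (f : C -> C) (z : C) : ccont f z ->
  exists K d, 0 < d /\ forall w, Cmod (w - z) < d -> Cmod (f w) <= K.
Proof.
intros H; destruct (proj1 (ccont_eps f z) H 1 Rlt_0_1) as [d [Hd Hd2]].
exists (Cmod (f z) + 1), d; split; auto; intros w Hw.
assert (T := Cmod_triangle_minus (f w) (f z)); specialize (Hd2 w Hw); lra.
Qed.

Lemma cont_at_bounded (u : C -> R) (z : C) : cont_at u z ->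
  exists K d, 0 < d /\ forall w, Cmod (w - z) < d -> Rabs (u w) <= K.
Proof.
intros H; destruct (H 1 Rlt_0_1) as [d [Hd Hd2]].
exists (Rabs (u z) + 1), d; split; auto; intros w Hw.
assert (T := Rabs_triangle_minus (u w) (u z)); specialize (Hd2 w Hw); lra.
Qed.

Lemma pole_sum_near_pole (r : C -> R) (P : list C) (p : C) : NoDup P -> In p P ->
  exists K d, 0 < d /\ forall z, 0 < Cmod (z - p) < d ->
    Cmod (pole_sum r P z - RtoC (r p) * / (z - p)) <= K.
Proof.
induction P as [|q P IH]; intros HP Hp; [destruct Hp|].
inversion HP as [|? ? Hq HP']; subst; simpl.
destruct (classic (q = p)) as [E|E].
- subst q; destruct (ccont_bounded _ _ (ccont_pole_sum r P p Hq)) as (K & d & Hd & H).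
  exists K, d; split; auto; intros z Hz.
  replace (RtoC (r p) * / (z - p) + pole_sum r P z - RtoC (r p) * / (z - p))%C
    with (pole_sum r P z) by ring.
  apply H; lra.
- destruct Hp as [Hp|Hp]; [tauto|].
  destruct (IH HP' Hp) as (K & d & Hd & H).
  destruct (ccont_bounded _ _ (ccont_mult _ _ p (ccont_const (RtoC (r q)) p)
    (ccont_inv_shift q p (fun e => E (eq_sym e))))) as (K' & d' & Hd' & H').
  exists (K' + K), (Rmin d d'); split; [apply Rmin_glb_lt; auto|]; intros z Hz.
  assert (E1 := Rmin_l d d'); assert (E2 := Rmin_r d d').
  replace (RtoC (r q) * / (z - q) + pole_sum r P z - RtoC (r p) * / (z - p))%C
    with (RtoC (r q) * / (z - q) + (pole_sum r P z - RtoC (r p) * / (z - p)))%C by ring.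
  eapply Rle_trans; [apply Cmod_triangle|].
  apply Rplus_le_compat; [apply H'|apply H]; lra.
Qed.

(** Writing g z = r + (z - p) phi z with [phi] continuous at [p], the difference f z - r / (z - p)
    is phi z. *)
Lemma simple_pole_principal_part (f : C -> C) (p r : C) : simple_pole f p r ->
  exists K d, 0 < d /\ forall z, 0 < Cmod (z - p) < d -> Cmod (f z - r * / (z - p)) <= K.
Proof.
intros (d & Hd & g & Hg & Hgp & Hfg).
destruct (Hg p) as [l Hl].
{ replace (p - p)%C with (RtoC 0) by ring; rewrite Cmod_0; auto. }
apply C_derive_slope in Hl; destruct Hl as (e & phi & He & H1 & _ & H3).
destruct (ccont_bounded _ _ H3) as (K & e' & He' & HK).
exists K, (Rmin d (Rmin e e')); split; [apply Rmin_glb_lt; [|apply Rmin_glb_lt]; auto|].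
intros z Hz.
assert (E1 := Rmin_l d (Rmin e e')); assert (E2 := Rmin_r d (Rmin e e')).
assert (E3 := Rmin_l e e'); assert (E4 := Rmin_r e e').
assert (Hzp : (z - p)%C <> 0) by (apply Cmod_gt_0; lra).
replace (f z - r * / (z - p))%C with (phi z); [apply HK; lra|].
specialize (Hfg z ltac:(lra)); rewrite H1, Hgp in Hfg by lra.
assert (E : (f z = ((z - p) * f z) / (z - p))%C) by (field; auto).
rewrite E, Hfg; field; auto.
Qed.

Lemma inv_shift_expansion (p : C) : exists S K, 0 < S /\ 0 <= K /\ forall z, S <= Cmod z ->
  Cmod (/ (z - p) - / z) <= K / Cmod z ^ 2.
Proof.
assert (Hp := Cmod_ge_0 p).
(* The difference is p / ((z - p) z), and this radius ensures |z - p| >= |z| / 2. *)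
exists (2 * Cmod p + 1), (2 * Cmod p); split; [lra|split; [lra|]]; intros z Hz.
assert (T := Cmod_triangle_minus z p).
assert (Hz0 : z <> 0) by (apply Cmod_gt_0; lra).
assert (Hzp : (z - p)%C <> 0) by (apply Cmod_gt_0; lra).
replace (/ (z - p) - / z)%C with (p / ((z - p) * z))%C by (field; auto).
rewrite Cmod_div, Cmod_mult by (apply Cmult_neq_0; auto).
apply Rle_div_l; [apply Rmult_lt_0_compat; apply Cmod_gt_0; auto|].
replace (2 * Cmod p / Cmod z ^ 2 * (Cmod (z - p) * Cmod z))
  with (Cmod p * ((2 * Cmod (z - p)) / Cmod z)) by (field; lra).
rewrite <- (Rmult_1_r (Cmod p)) at 1; apply Rmult_le_compat_l; auto.
apply Rle_div_r; lra.
Qed.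

Lemma pole_sum_expansion (r : C -> R) (P : list C) : exists S K, 0 < S /\ 0 <= K /\
  forall z, S <= Cmod z ->
    ~ In z P /\ Cmod (pole_sum r P z - RtoC (res_sum r P) * / z) <= K / Cmod z ^ 2.
Proof.
induction P as [|p P (S & K & HS & HK & H)]; cbn [pole_sum res_sum In].
- exists 1, 0; split; [lra|split; [lra|]]; intros z Hz; split; auto.
  replace (0 - 0 * / z)%C with (RtoC 0) by ring; rewrite Cmod_0; unfold Rdiv; lra.
- destruct (inv_shift_expansion p) as (S' & K' & HS' & HK' & H').
  assert (M1 := Rmax_l S S'); assert (M2 := Rmax_r S S'); assert (Hp := Cmod_ge_0 p).
  assert (Hr := Rabs_pos (r p)).
  exists (Rmax S S' + Cmod p + 1), (Rabs (r p) * K' + K); split; [lra|split].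
  { assert (0 <= Rabs (r p) * K') by (apply Rmult_le_pos; auto); lra. }
  intros z Hz; destruct (H z ltac:(lra)) as [Hin Hb]; split.
  { intros [->|Hi]; [lra|auto]. }
  rewrite RtoC_plus.
  replace (RtoC (r p) * / (z - p) + pole_sum r P z -
      (RtoC (r p) + RtoC (res_sum r P)) * / z)%C
    with (RtoC (r p) * (/ (z - p) - / z) + (pole_sum r P z - RtoC (res_sum r P) * / z))%C by ring.
  eapply Rle_trans; [apply Cmod_triangle|].
  rewrite Cmod_mult, Cmod_R.
  replace ((Rabs (r p) * K' + K) / Cmod z ^ 2)
    with (Rabs (r p) * (K' / Cmod z ^ 2) + K / Cmod z ^ 2) by (unfold Rdiv; ring).
  apply Rplus_le_compat; auto; apply Rmult_le_compat_l; auto; apply H'; lra.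
Qed.

(** In the chart w = 1 / z the coefficient minus its principal part is -z^2 (f z - 1 / z), and it is
    bounded: residue -1 at infinity means leading term +1 / z. *)
Lemma residue_inf_expansion (f : C -> C) : simple_pole (coeff_inf f) 0 (RtoC (-1)) ->
  exists S K, 0 < S /\ 0 <= K /\ forall z, S <= Cmod z -> Cmod (f z - / z) <= K / Cmod z ^ 2.
Proof.
intros H; destruct (simple_pole_principal_part _ _ _ H) as (K & d & Hd & HK).
exists (1 + / d), (Rabs K); split; [|split; [apply Rabs_pos|]].
{ assert (0 < / d) by (apply Rinv_0_lt_compat; auto); lra. }
intros z Hz.
assert (Hd' : 0 < / d) by (apply Rinv_0_lt_compat; auto).
assert (Hz0 : z <> 0) by (apply Cmod_gt_0; lra).
assert (Hzi : Cmod (/ z - 0) = / Cmod z).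
{ replace (/ z - 0)%C with (/ z)%C by ring; apply Cmod_inv; auto. }
specialize (HK (/ z)%C); rewrite Hzi in HK.
assert (Hlt : / Cmod z < d).
{ rewrite <- (Rinv_inv d); apply Rinv_lt_contravar; [apply Rmult_lt_0_compat|]; lra. }
specialize (HK (conj (Rinv_0_lt_compat (Cmod z) ltac:(lra)) Hlt)).
unfold coeff_inf in HK.
replace (- (f (/ / z) / (/ z * / z)) - RtoC (-1) * / (/ z - 0))%C
  with (- ((f z - / z) * (z * z)))%C in HK.
- rewrite Cmod_opp, !Cmod_mult in HK.
  apply Rle_div_r; [apply pow_lt; lra|].
  simpl; rewrite Rmult_1_r; assert (A := Rle_abs K); lra.
- replace (/ / z)%C with z by (field; auto).
  replace (/ z - 0)%C with (/ z)%C by ring.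
  replace (RtoC (-1)) with (- RtoC 1)%C by (rewrite <- RtoC_opp; reflexivity).
  field; auto.
Qed.

Lemma third_kind_partial_fractions (f : C -> C) (h : C -> R) (P : list C) (r : C -> R) :
  NoDup P -> (forall z, ~ In z P -> ex_derive (K := C_AbsRing) (V := C_NormedModule) f z) ->
  (forall p, In p P -> simple_pole f p (RtoC (r p))) ->
  simple_pole (coeff_inf f) 0 (RtoC (-1)) ->
  (forall z, ~ In z P -> cont_at h z /\ grad h z (f z)) ->
  (exists c, forall z, ~ In z P -> h z = c + log_sum r P z) /\
  (forall z, ~ In z P -> f z = pole_sum r P z) /\
  res_sum r P = 1.
Proof.
intros HP Hf Hpole Hinf Hh.
set (H := fun z => h z - log_sum r P z).
set (F := fun z => (f z - pole_sum r P z)%C).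
assert (HF : forall z, ~ In z P -> grad H z (F z)).
{ intros z Hz; apply grad_minus; [apply Hh; auto|apply grad_log_sum; auto]. }
assert (Hharm : forall z, ~ In z P -> harmonic_at H z).
{ intros z Hz; apply harmonic_minus; [|apply harmonic_log_sum; auto].
  split; [apply Hh; auto|].
  destruct (notin_nearby P z Hz) as [d [Hd Hn]].
  apply is_laplacian_grad with (g := f) (d := d); auto.
  intros w Hw; apply Hh; auto. }
assert (Hnear : forall p, In p P ->
  exists B e, 0 < e /\ forall z, 0 < Cmod (z - p) < e -> Rabs (H z) <= B).
{ intros p Hp.
  destruct (pole_sum_near_pole r P p HP Hp) as (K1 & d1 & Hd1 & H1).
  destruct (simple_pole_principal_part f p _ (Hpole p Hp)) as (K2 & d2 & Hd2 & H2).
  destruct (punctured_avoids P p) as (d3 & Hd3 & H3).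
  apply (grad_bounded_punctured H F p (Rmin d1 (Rmin d2 d3)) (K2 + K1)).
  { apply Rmin_glb_lt; [|apply Rmin_glb_lt]; auto. }
  intros z Hz.
  assert (E1 := Rmin_l d1 (Rmin d2 d3)); assert (E2 := Rmin_r d1 (Rmin d2 d3)).
  assert (E3 := Rmin_l d2 d3); assert (E4 := Rmin_r d2 d3).
  split; [apply HF, H3; lra|].
  unfold F; replace (f z - pole_sum r P z)%C with
    ((f z - RtoC (r p) * / (z - p)) + - (pole_sum r P z - RtoC (r p) * / (z - p)))%C by ring.
  eapply Rle_trans; [apply Cmod_triangle|]; rewrite Cmod_opp.
  apply Rplus_le_compat; [apply H2|apply H1]; lra. }
(* The residue theorem predicts k = 0; until that is proved, H may grow like k ln |z|. *)
set (k := 1 - res_sum r P).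
assert (HFinf : exists S K, 0 < S /\ 0 <= K /\ forall z, S <= Cmod z ->
   ~ In z P /\ Cmod (F z - RtoC k * / z) <= K / Cmod z ^ 2).
{ destruct (pole_sum_expansion r P) as (S1 & K1 & HS1 & HK1 & H1).
  destruct (residue_inf_expansion f Hinf) as (S2 & K2 & HS2 & HK2 & H2).
  assert (M1 := Rmax_l S1 S2); assert (M2 := Rmax_r S1 S2).
  exists (Rmax S1 S2), (K2 + K1); split; [lra|split; [lra|]]; intros z Hz.
  destruct (H1 z ltac:(lra)) as [Hi Hb]; split; auto.
  unfold F, k; rewrite RtoC_minus.
  replace (f z - pole_sum r P z - (RtoC 1 - RtoC (res_sum r P)) * / z)%C
    with ((f z - / z) + - (pole_sum r P z - RtoC (res_sum r P) * / z))%C by ring.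
  eapply Rle_trans; [apply Cmod_triangle|]; rewrite Cmod_opp.
  unfold Rdiv; rewrite Rmult_plus_distr_r.
  apply Rplus_le_compat; auto; apply H2; lra. }
destruct HFinf as (S & K & HS & HK & HSF).
assert (Hbinf : exists B, forall z, 2 * S <= Cmod z -> Rabs (H z - k * ln (Cmod z)) <= B).
{ apply grad_bounded_inf with (g := fun z => (F z - RtoC k * / z)%C) (K := K); auto.
  intros z Hz; destruct (HSF z Hz) as [Hi Hb]; split; auto.
  apply grad_minus; [apply HF; auto|apply grad_scal].
  assert (Hz0 : z <> 0) by (apply Cmod_gt_0; lra).
  eapply grad_eq; [|apply (grad_ln_Cmod (fun w => w) z (RtoC 1)); auto; apply cderive_id].
  field; auto. }
destruct Hbinf as [B HB].
assert (M1 := Rmax_l (2 * S) 1); assert (M2 := Rmax_r (2 * S) 1).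
(* According to the sign of k, either H or -H is bounded above at infinity. The radius is at least 1
   so that ln |v| >= 0 there. *)
assert (Hconst : forall z w, ~ In z P -> ~ In w P -> H z = H w).
{ intros z w Hz Hw; destruct (Rle_lt_dec k 0) as [Hk|Hk].
  - apply (harmonic_bounded_above_const P); auto.
    + intros p Hp; destruct (Hnear p Hp) as (B' & e & He & HB').
      exists B', e; split; auto; intros v Hv; eapply Rle_trans; [apply Rle_abs|auto].
    + exists B, (Rmax (2 * S) 1); intros v Hv.
      specialize (HB v ltac:(lra)); apply Rabs_le_between in HB.
      assert (ln 1 <= ln (Cmod v)) by (apply ln_le; lra); rewrite ln_1 in *; nra.
  - assert (E : -1 * H z = -1 * H w); [|lra].
    apply (harmonic_bounded_above_const P (fun v => -1 * H v)); auto.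
    + intros v Hv; apply harmonic_scal; auto.
    + intros p Hp; destruct (Hnear p Hp) as (B' & e & He & HB').
      exists B', e; split; auto; intros v Hv; specialize (HB' v Hv).
      apply Rabs_le_between in HB'; lra.
    + exists B, (Rmax (2 * S) 1); intros v Hv.
      specialize (HB v ltac:(lra)); apply Rabs_le_between in HB.
      assert (ln 1 <= ln (Cmod v)) by (apply ln_le; lra); rewrite ln_1 in *; nra. }
assert (HF0 : forall z, ~ In z P -> F z = 0).
{ intros z Hz; destruct (notin_nearby P z Hz) as [d [Hd Hn]].
  apply (grad_unique H z); [auto|].
  apply grad_ext_loc with (u := fun _ => H z) (d := d); [auto| |apply grad_const].
  intros w Hw; apply Hconst; auto. }
assert (HS0 : Cmod (RtoC S) = S) by (rewrite Cmod_R, Rabs_pos_eq; lra).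
split; [|split].
- exists (H (RtoC S)); intros z Hz; rewrite <- (Hconst z (RtoC S) Hz); [unfold H; ring|].
  apply HSF; lra.
- intros z Hz; specialize (HF0 z Hz); unfold F in HF0; apply Ceq_minus; auto.
- enough (k = 0) by (unfold k in *; lra).
  apply NNPP; intros Hk; apply Rabs_pos_lt in Hk.
  (* At the real point T > K / |k| beyond S, the estimate |k| / T <= K / T^2 fails. *)
  set (T := S + K / Rabs k + 1).
  assert (HT : 0 <= K / Rabs k) by (apply Rdiv_le_0_compat; auto).
  assert (HTm : Cmod (RtoC T) = T) by (rewrite Cmod_R, Rabs_pos_eq; unfold T; lra).
  destruct (HSF (RtoC T)) as [Hi Hb]; [unfold T in *; lra|].
  rewrite (HF0 _ Hi), HTm in Hb.
  replace (0 - RtoC k * / RtoC T)%C with (- (RtoC k * / RtoC T))%C in Hb by ring.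
  assert (HT0 : RtoC T <> 0) by (apply Cmod_gt_0; rewrite HTm; unfold T; lra).
  rewrite Cmod_opp, Cmod_mult, Cmod_inv, HTm, Cmod_R in Hb by auto.
  assert (HTpos : 0 < T) by (unfold T; lra).
  apply (Rmult_le_compat_r (T ^ 2)) in Hb; [|apply pow_le; lra].
  replace (Rabs k * / T * T ^ 2) with (Rabs k * T) in Hb by (field; lra).
  replace (K / T ^ 2 * T ^ 2) with K in Hb by (field; lra).
  assert (E : Rabs k * T = Rabs k * S + K + Rabs k) by (unfold T; field; lra).
  assert (0 < Rabs k * S) by (apply Rmult_lt_0_compat; auto); lra.
Qed.

(** * The sum of simple fractions over a common denominator *)

Fixpoint pole_num (r : C -> R) (P : list C) (z : C) : C :=
  match P with
  | nil => RtoC 0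
  | p :: P => (RtoC (r p) * roots_prod P z + (z - p) * pole_num r P z)%C
  end.

(** Each fraction contributes its residue times a monic product over the other poles; once the
    residues sum to 1, the numerator is monic with degree one less than the number of poles. *)
Lemma poly_pole_num (r : C -> R) (P : list C) : forall p,
  poly (length P) (RtoC (res_sum r (p :: P))) (pole_num r (p :: P)).
Proof.
induction P as [|q P IH]; intros p.
- intros z; simpl; rewrite Rplus_0_r; ring.
- change (res_sum r (p :: q :: P)) with (r p + res_sum r (q :: P)).
  rewrite RtoC_plus.
  apply poly_plus with (N := fun z => (RtoC (r p) * roots_prod (q :: P) z)%C)
    (N' := fun z => ((z - p) * pole_num r (q :: P) z)%C).
  + replace (RtoC (r p)) with (RtoC (r p) * 1)%C at 1 by ring.
    apply poly_scal, poly_roots_prod.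
  + exact (poly_mult_linear _ _ p _ (IH q)).
Qed.

Lemma pole_sum_num (r : C -> R) (P : list C) (z : C) : ~ In z P ->
  (pole_sum r P z = pole_num r P z / roots_prod P z)%C.
Proof.
induction P as [|p P IH]; simpl; intros H; [field; apply C1_nz|].
assert (Hz : (z - p)%C <> 0) by (apply Cminus_eq_contra; intros E; apply H; auto).
assert (HP : roots_prod P z <> 0) by (intros E; apply H; right; apply roots_prod_eq_0; auto).
rewrite IH by tauto; field; auto.
Qed.

(** At [p] only the summand of [p] survives: its residue times the product of p - q over the other,
    distinct poles. So numerator and denominator have no common root. *)
Lemma pole_num_pole (r : C -> R) (P : list C) (p : C) : NoDup P ->
  (forall q, In q P -> r q <> 0) -> In p P -> pole_num r P p <> 0.
Proof.
induction P as [|q P IH]; intros HP Hr Hp; [destruct Hp|].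
inversion HP as [|? ? Hq HP']; subst; simpl.
destruct (classic (q = p)) as [E|E].
- subst q; replace (p - p)%C with (RtoC 0) by ring; rewrite Cmult_0_l, Cplus_0_r.
  apply Cmult_neq_0.
  + intros E; apply RtoC_inj in E; revert E; apply Hr; left; auto.
  + intros E; apply Hq, roots_prod_eq_0; auto.
- destruct Hp as [Hp|Hp]; [tauto|].
  rewrite (proj2 (roots_prod_eq_0 P p) Hp), Cmult_0_r, Cplus_0_l.
  apply Cmult_neq_0; [apply Cminus_eq_contra; auto|].
  apply IH; auto; intros s Hs; apply Hr; right; auto.
Qed.

Lemma ccont_roots_prod (s : list C) (z : C) : ccont (roots_prod s) z.
Proof.
induction s as [|a s IH]; [apply ccont_const|].
apply ccont_mult; auto; apply ccont_shift.
Qed.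

(** * Uniqueness *)

Lemma Cmod_self (z : C) : Cmod (z - z) = 0.
Proof. replace (z - z)%C with (RtoC 0) by ring; apply Cmod_0. Qed.

Lemma Cmod_shift_real (a : C) (t : R) : 0 < t -> Cmod (a + RtoC t - a) = t.
Proof.
intros Ht; replace (a + RtoC t - a)%C with (RtoC t) by ring; rewrite Cmod_R, Rabs_pos_eq; lra.
Qed.

(** This compares exponents: if ln rho has two expressions near [a] up to bounded terms, their
    coefficients of ln |z - a| agree. *)
Lemma ln_dist_bounded_eq_0 (k : R) (a : C) :
  (exists M d, 0 < d /\ forall z, 0 < Cmod (z - a) < d -> Rabs (k * ln (Cmod (z - a))) <= M) ->
  k = 0.
Proof.
intros (M & d & Hd & H); apply NNPP; intros Hk; apply Rabs_pos_lt in Hk.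
destruct (ln_to_minf (- ((Rabs M + 1) / Rabs k)) a) as (d' & Hd' & H').
set (t := Rmin d d' / 2).
assert (Ht : 0 < Rmin d d') by (apply Rmin_glb_lt; auto).
assert (E1 := Rmin_l d d'); assert (E2 := Rmin_r d d').
assert (Hz : Cmod (a + RtoC t - a) = t) by (apply Cmod_shift_real; unfold t; lra).
specialize (H (a + RtoC t)%C); specialize (H' (a + RtoC t)%C); rewrite Hz in H, H'.
specialize (H ltac:(unfold t; lra)); specialize (H' ltac:(unfold t; lra)).
assert (A := Rabs_pos M).
assert (B : 0 < (Rabs M + 1) / Rabs k) by (apply Rdiv_lt_0_compat; lra).
rewrite Rabs_mult, (Rabs_left (ln t)) in H by lra.
assert (C : Rabs k * ((Rabs M + 1) / Rabs k) < Rabs k * - ln t) by (apply Rmult_lt_compat_l; lra).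
replace (Rabs k * ((Rabs M + 1) / Rabs k)) with (Rabs M + 1) in C by (field; lra).
assert (D := Rle_abs M); lra.
Qed.

(** With [Phi = 4 e^t / (1 + e^t)], this is [Phi (4 - Phi) / 4]. *)
Definition sph_factor (t : R) : R := 4 * exp t / (1 + exp t) ^ 2.

Lemma sph_factor_pos (t : R) : 0 < sph_factor t.
Proof.
assert (H := exp_pos t); unfold sph_factor; apply Rdiv_lt_0_compat; [lra|apply pow_lt; lra].
Qed.

Lemma sph_factor_opp (t : R) : sph_factor (- t) = sph_factor t.
Proof.
unfold sph_factor; rewrite exp_Ropp; assert (H := exp_pos t); field; lra.
Qed.

(** For s >= 0 the factor lies between exp (-s) and 4 exp (-s), and it is even. The evenness is the
    source of the absolute value of the residue. *)
Lemma ln_sph_factor (t : R) : - Rabs t <= ln (sph_factor t) <= ln 4 - Rabs t.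
Proof.
assert (G : forall s, 0 <= s -> - s <= ln (sph_factor s) <= ln 4 - s).
{ intros s Hs; assert (H1 := exp_ineq1_le s); set (E := exp s) in *.
  assert (HE : 0 < E) by apply exp_pos.
  assert (H2 : 0 < (1 + E) ^ 2) by (apply pow_lt; lra).
  assert (Hln : ln E = s) by apply ln_exp.
  rewrite <- Hln, <- ln_Rinv by auto; split.
  - apply ln_le; [apply Rinv_0_lt_compat; auto|].
    unfold sph_factor; rewrite exp_ln by auto; apply Rle_div_r; auto.
    apply Rmult_le_reg_l with E; auto; rewrite <- Rmult_assoc, Rinv_r by lra; nra.
  - rewrite <- ln_div by lra; apply ln_le; [apply sph_factor_pos|].
    unfold sph_factor; rewrite exp_ln by auto; apply Rle_div_l; auto.
    replace (4 / E * (1 + E) ^ 2) with (4 * E + (8 + 4 / E)) by (field; lra).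
    assert (0 < 4 / E) by (apply Rdiv_lt_0_compat; lra); lra. }
destruct (Rle_lt_dec 0 t) as [Ht|Ht].
- rewrite Rabs_pos_eq by auto; apply G; auto.
- rewrite Rabs_left, <- (sph_factor_opp t) by auto; apply G; lra.
Qed.

(** Put x = ln |z - a| < 0. Up to bounded terms [sph_factor] contributes -|2 ra x| = 2 |ra| x to ln
    rho and the squared form -2 x; the cone gives 2 (alpha - 1) x. *)
Lemma residue_at_cone (rho : C -> R) (a b : C) (c ra rb alpha : R) : a <> 0 -> a <> b ->
  cone_at rho a alpha ->
  (forall z : C, z <> 0 -> z <> a -> z <> b -> rho z =
     sph_factor (2 * (c + (ra * ln (Cmod (z - a)) + rb * ln (Cmod (z - b))))) *
     Cmod (z / ((z - a) * (z - b))) ^ 2) ->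
  alpha = Rabs ra.
Proof.
intros Ha Hab (d0 & Hd0 & u & Hu & Hrho) Hform.
destruct (cont_at_bounded u a) as (Ku & d1 & Hd1 & HKu).
{ apply Hu; rewrite Cmod_self; auto. }
destruct (cont_at_bounded (fun w => 2 * (c + rb * ln (Cmod (w - b)))) a) as (K1 & d2 & Hd2 & HK1).
{ apply cont_at_mult; [apply cont_at_const|]; apply cont_at_plus; [apply cont_at_const|].
  apply cont_at_mult; [apply cont_at_const|]; apply cont_at_ln_dist; auto. }
destruct (cont_at_bounded (fun w => ln (Cmod w) - ln (Cmod (w - b))) a) as (K2 & d3 & Hd3 & HK2).
{ apply cont_at_minus; [|apply cont_at_ln_dist; auto].
  apply (cont_at_ln_Cmod (fun w => w)); [apply ccont_id|auto]. }
destruct (punctured_avoids [RtoC 0; b] a) as (d4 & Hd4 & HP).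
enough (alpha - Rabs ra = 0) by lra.
apply (ln_dist_bounded_eq_0 _ a).
set (d := Rmin 1 (Rmin d0 (Rmin d1 (Rmin d2 (Rmin d3 d4))))).
assert (L1 : d <= 1) by apply Rmin_l.
assert (L2 : d <= Rmin d0 (Rmin d1 (Rmin d2 (Rmin d3 d4)))) by apply Rmin_r.
assert (L3 := Rmin_l d0 (Rmin d1 (Rmin d2 (Rmin d3 d4)))).
assert (L4 := Rmin_r d0 (Rmin d1 (Rmin d2 (Rmin d3 d4)))).
assert (L5 := Rmin_l d1 (Rmin d2 (Rmin d3 d4))).
assert (L6 := Rmin_r d1 (Rmin d2 (Rmin d3 d4))).
assert (L7 := Rmin_l d2 (Rmin d3 d4)); assert (L8 := Rmin_r d2 (Rmin d3 d4)).
assert (L9 := Rmin_l d3 d4); assert (L10 := Rmin_r d3 d4).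
exists (K1 + ln 4 + 2 * K2 + Ku), d; split.
{ unfold d; repeat (apply Rmin_glb_lt; auto); lra. }
intros z Hz.
assert (Hin := HP z ltac:(lra)); simpl in Hin.
assert (Hz0 : z <> 0) by (intros E; apply Hin; auto).
assert (Hzb : z <> b) by (intros E; apply Hin; auto).
assert (Hza : z <> a) by (apply Cmod_minus_neq; lra).
specialize (Hrho z ltac:(lra)); specialize (Hform z Hz0 Hza Hzb).
specialize (HKu z ltac:(lra)); specialize (HK1 z ltac:(lra)); specialize (HK2 z ltac:(lra)).
set (x := ln (Cmod (z - a))) in *.
set (v1 := 2 * (c + rb * ln (Cmod (z - b)))) in *.
set (v2 := ln (Cmod z) - ln (Cmod (z - b))) in *.
assert (Hx : x < 0) by (unfold x; rewrite <- ln_1; apply ln_increasing; lra).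
assert (P1 : 0 < Cmod z) by (apply Cmod_gt_0; auto).
assert (P2 : 0 < Cmod (z - b)) by (apply Cmod_minus_pos; auto).
assert (E1 : ln (rho z) = 2 * (alpha - 1) * x + u z).
{ rewrite Hrho, ln_mult, ln_exp by apply exp_pos; f_equal; unfold Rpower; rewrite ln_exp; auto. }
assert (E2 : ln (rho z) = ln (sph_factor (v1 + 2 * ra * x)) + 2 * (v2 - x)).
{ rewrite Hform; rewrite ln_mult.
  - f_equal; [f_equal; f_equal; unfold v1; ring|].
    rewrite Cmod_div, Cmod_mult by (apply Cmult_neq_0; apply Cminus_eq_contra; auto).
    rewrite ln_pow.
    + rewrite ln_div, ln_mult by (try apply Rmult_lt_0_compat; lra).
      simpl; unfold v2, x; ring.
    + apply Rdiv_lt_0_compat; [lra|apply Rmult_lt_0_compat; lra].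
  - apply sph_factor_pos.
  - apply pow_lt, Cmod_gt_0; intros E; apply Hz0.
    replace z with (z / ((z - a) * (z - b)) * ((z - a) * (z - b)))%C.
    + rewrite E; ring.
    + field; split; apply Cminus_eq_contra; auto. }
assert (S := ln_sph_factor (v1 + 2 * ra * x)).
assert (T1 := Rabs_triang v1 (2 * ra * x)).
assert (T2 := Rabs_triang (v1 + 2 * ra * x) (- v1)).
replace (v1 + 2 * ra * x + - v1) with (2 * ra * x) in T2 by ring.
rewrite Rabs_Ropp in T2.
assert (E3 : Rabs (2 * ra * x) = - (2 * Rabs ra * x)).
{ rewrite !Rabs_mult, (Rabs_pos_eq 2), (Rabs_left x) by lra; ring. }
assert (L4' : 0 <= ln 4) by (rewrite <- ln_1; apply ln_le; lra).
apply Rabs_le_between in HKu; apply Rabs_le_between in HK2.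
apply Rabs_le; lra.
Qed.

(** For alpha < 1 the density rho is unbounded at [a], while |f|^2 is bounded near a point that is
    not a pole. The list [zs] stands for the zeros of f, where the metric identity says nothing. *)
Lemma cone_is_pole (rho : C -> R) (f : C -> C) (P zs : list C) (a : C) (alpha : R) :
  alpha < 1 -> cone_at rho a alpha ->
  (forall z, ~ In z P -> ccont f z) ->
  (forall z, ~ In z P -> ~ In z zs -> rho z <= Cmod (f z) ^ 2) -> In a P.
Proof.
intros Halpha (d0 & Hd0 & u & Hu & Hrho) Hf Hle; apply NNPP; intros Ha.
destruct (ccont_bounded f a (Hf a Ha)) as (K & d1 & Hd1 & HK).
destruct (cont_at_bounded u a) as (Ku & d2 & Hd2 & HKu).
{ apply Hu; rewrite Cmod_self; auto. }
destruct (punctured_avoids (P ++ zs) a) as (d3 & Hd3 & HP).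
enough (alpha - 1 = 0) by lra.
apply (ln_dist_bounded_eq_0 _ a).
set (d := Rmin 1 (Rmin d0 (Rmin d1 (Rmin d2 d3)))).
assert (L1 : d <= 1) by apply Rmin_l.
assert (L2 : d <= Rmin d0 (Rmin d1 (Rmin d2 d3))) by apply Rmin_r.
assert (L3 := Rmin_l d0 (Rmin d1 (Rmin d2 d3))); assert (L4 := Rmin_r d0 (Rmin d1 (Rmin d2 d3))).
assert (L5 := Rmin_l d1 (Rmin d2 d3)); assert (L6 := Rmin_r d1 (Rmin d2 d3)).
assert (L7 := Rmin_l d2 d3); assert (L8 := Rmin_r d2 d3).
exists (Rabs (ln (K ^ 2)) + Rabs Ku), d; split.
{ unfold d; repeat (apply Rmin_glb_lt; auto); lra. }
intros z Hz.
assert (Hin := HP z ltac:(lra)); rewrite in_app_iff in Hin.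
specialize (Hrho z ltac:(lra)); specialize (HK z ltac:(lra)); specialize (HKu z ltac:(lra)).
specialize (Hle z ltac:(tauto) ltac:(tauto)).
assert (Hpos : 0 < rho z) by (rewrite Hrho; apply Rmult_lt_0_compat; apply exp_pos).
assert (E1 : ln (rho z) = 2 * (alpha - 1) * ln (Cmod (z - a)) + u z).
{ rewrite Hrho, ln_mult, ln_exp by apply exp_pos; f_equal; unfold Rpower; rewrite ln_exp; auto. }
assert (E2 : ln (rho z) <= ln (K ^ 2)).
{ apply ln_le; auto; eapply Rle_trans; [exact Hle|].
  apply pow_incr; split; auto; apply Cmod_ge_0. }
assert (Hx : ln (Cmod (z - a)) < 0) by (rewrite <- ln_1; apply ln_increasing; lra).
assert (0 < (alpha - 1) * ln (Cmod (z - a))) by nra.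
apply Rabs_le_between in HKu.
assert (A1 := Rle_abs (ln (K ^ 2))); assert (A2 := Rle_abs Ku).
assert (A3 := Rabs_pos (ln (K ^ 2))); rewrite Rabs_pos_eq by lra; lra.
Qed.

(** At a zero of f the bound |f|^2 tends to 0, whereas rho is continuous and positive at a smooth
    point. *)
Lemma smooth_point_not_zero (rho : C -> R) (f : C -> C) (P zs : list C) (z0 : C) :
  curv1_at rho z0 -> ~ In z0 P -> ccont f z0 ->
  (forall z, ~ In z P -> ~ In z zs -> rho z <= Cmod (f z) ^ 2) -> f z0 <> 0.
Proof.
intros (Hpos & Hcont & _) HP Hf Hle E.
destruct (Hcont (rho z0 / 2) ltac:(lra)) as (d1 & Hd1 & H1).
(* With |f| <= 1 one has |f|^2 <= |f| < rho z0 / 2. *)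
assert (Hm : 0 < Rmin 1 (rho z0 / 2)) by (apply Rmin_glb_lt; lra).
destruct (proj1 (ccont_eps f z0) Hf _ Hm) as (d2 & Hd2 & H2).
destruct (punctured_avoids (P ++ zs) z0) as (d3 & Hd3 & H3).
set (t := Rmin d1 (Rmin d2 d3) / 2).
assert (Ht : 0 < Rmin d1 (Rmin d2 d3)) by (repeat (apply Rmin_glb_lt; auto)).
assert (L1 := Rmin_l d1 (Rmin d2 d3)); assert (L2 := Rmin_r d1 (Rmin d2 d3)).
assert (L3 := Rmin_l d2 d3); assert (L4 := Rmin_r d2 d3).
assert (Hz : Cmod (z0 + RtoC t - z0) = t) by (apply Cmod_shift_real; unfold t; lra).
set (z := (z0 + RtoC t)%C) in *.
specialize (H1 z ltac:(unfold t in *; lra)); specialize (H2 z ltac:(unfold t in *; lra)).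
specialize (H3 z ltac:(unfold t in *; lra)); rewrite in_app_iff in H3.
specialize (Hle z ltac:(tauto) ltac:(tauto)).
apply Rabs_lt_between in H1; rewrite E in H2.
replace (f z - 0)%C with (f z) in H2 by ring.
assert (M1 := Rmin_l 1 (rho z0 / 2)); assert (M2 := Rmin_r 1 (rho z0 / 2)).
assert (C0 := Cmod_ge_0 (f z)).
assert (Cmod (f z) ^ 2 <= Cmod (f z)) by (simpl; nra).
lra.
Qed.

(** Angle 4 pi means that rho is |z|^2 times a factor bounded below by exp (- Ku), whereas the
    hypothesis bounds rho by a constant times |z|^(2 n). *)
Lemma cone_zero_order (rho : C -> R) (f : C -> C) (P : list C) (n : nat) :
  cone_at rho 0 2 -> ~ In (RtoC 0) P ->
  (forall z : C, z <> 0 -> ~ In z P -> rho z <= Cmod (z ^ n / roots_prod P z) ^ 2) -> (n <= 1)%nat.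
Proof.
intros (d0 & Hd0 & u & Hu & Hrho) HP Hle.
destruct (Nat.le_gt_cases n 1) as [Hn|Hn]; auto; exfalso.
destruct (cont_at_bounded u 0) as (Ku & d1 & Hd1 & HKu).
{ apply Hu; rewrite Cmod_self; auto. }
assert (HP0 : roots_prod P 0 <> 0) by (intros E; apply HP, roots_prod_eq_0; auto).
destruct (ccont_bounded _ _ (ccont_inv _ 0 (ccont_roots_prod P 0) HP0)) as (K & d2 & Hd2 & HK).
destruct (notin_nearby P 0 HP) as (d3 & Hd3 & H3).
(* For n >= 2 and a real point t < 1 the two bounds force exp (- Ku) <= t^2 K^2, which fails for t
   below this quotient. *)
assert (Q : 0 < exp (- Ku) / (K ^ 2 + 1)).
{ apply Rdiv_lt_0_compat; [apply exp_pos|assert (G := pow2_ge_0 K); lra]. }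
set (m := Rmin 1 (Rmin (exp (- Ku) / (K ^ 2 + 1)) (Rmin d0 (Rmin d1 (Rmin d2 d3))))).
assert (Hm : 0 < m) by (unfold m; repeat (apply Rmin_glb_lt; auto); lra).
set (t := m / 2).
assert (L0 : m <= 1) by apply Rmin_l.
assert (L1 : m <= Rmin (exp (- Ku) / (K ^ 2 + 1)) (Rmin d0 (Rmin d1 (Rmin d2 d3)))) by apply Rmin_r.
assert (L2 := Rmin_l (exp (- Ku) / (K ^ 2 + 1)) (Rmin d0 (Rmin d1 (Rmin d2 d3)))).
assert (L3 := Rmin_r (exp (- Ku) / (K ^ 2 + 1)) (Rmin d0 (Rmin d1 (Rmin d2 d3)))).
assert (L4 := Rmin_l d0 (Rmin d1 (Rmin d2 d3))); assert (L5 := Rmin_r d0 (Rmin d1 (Rmin d2 d3))).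
assert (L6 := Rmin_l d1 (Rmin d2 d3)); assert (L7 := Rmin_r d1 (Rmin d2 d3)).
assert (L8 := Rmin_l d2 d3); assert (L9 := Rmin_r d2 d3).
assert (Hz : Cmod (RtoC t) = t) by (rewrite Cmod_R, Rabs_pos_eq; unfold t; lra).
assert (Hz' : Cmod (RtoC t - 0) = t) by (replace (RtoC t - 0)%C with (RtoC t) by ring; auto).
assert (Ht : 0 < t < m) by (unfold t; lra).
assert (Hz0 : RtoC t <> 0) by (apply Cmod_gt_0; lra).
specialize (Hrho (RtoC t)); specialize (HKu (RtoC t)); specialize (HK (RtoC t)).
specialize (H3 (RtoC t)); rewrite Hz' in *.
specialize (Hrho ltac:(lra)); specialize (HKu ltac:(lra)); specialize (HK ltac:(lra)).
specialize (H3 ltac:(lra)); specialize (Hle (RtoC t) Hz0 H3).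
unfold Cdiv in Hle; rewrite Cmod_mult, Cmod_pow, Hz in Hle.
assert (E1 : rho (RtoC t) = t ^ 2 * exp (u (RtoC t))).
{ rewrite Hrho; f_equal; replace (2 * (2 - 1)) with (INR 2) by (simpl; ring).
  apply Rpower_pow; lra. }
apply Rabs_le_between in HKu.
assert (E2 : exp (- Ku) <= exp (u (RtoC t))).
{ destruct (Req_dec (- Ku) (u (RtoC t))) as [E|E]; [rewrite E; lra|].
  left; apply exp_increasing; lra. }
assert (E3 : t ^ n <= t ^ 2).
{ replace n with (2 + (n - 2))%nat by lia; rewrite pow_add.
  rewrite <- (Rmult_1_r (t ^ 2)) at 2; apply Rmult_le_compat_l; [apply pow_le; lra|].
  rewrite <- (pow1 (n - 2)); apply pow_incr; lra. }
assert (E4 : (t ^ n * Cmod (/ roots_prod P (RtoC t))) ^ 2 <= (t ^ 2 * K) ^ 2).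
{ apply pow_incr; split; [apply Rmult_le_pos; [apply pow_le; lra|apply Cmod_ge_0]|].
  apply Rmult_le_compat; auto; [apply pow_le; lra|apply Cmod_ge_0]. }
assert (T2 : 0 < t ^ 2) by (apply pow_lt; lra).
assert (E5 : t ^ 2 * exp (- Ku) <= t ^ 2 * (t ^ 2 * K ^ 2)).
{ apply Rle_trans with (rho (RtoC t)).
  - rewrite E1; apply Rmult_le_compat_l; lra.
  - eapply Rle_trans; [exact Hle|]; eapply Rle_trans; [exact E4|right; ring]. }
apply Rmult_le_reg_l in E5; auto.
assert (E6 : t * (K ^ 2 + 1) < exp (- Ku)).
{ apply Rlt_div_r; [assert (G := pow2_ge_0 K); lra|lra]. }
assert (G := pow2_ge_0 K).
assert (t ^ 2 * K ^ 2 <= t * K ^ 2) by (simpl; nra).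
lra.
Qed.

(** The exponents 2 (beta - 1) and 2 (gamma - 1) split off the inverse squares that belong to
    |omega0|^2; what remains is the exponential of the argument of [sph_factor]. *)
Lemma rho_c_sph_factor (beta gamma c : R) (z : C) :
  z <> RtoC 1 -> z <> RtoC (- (gamma / beta)) ->
  rho_c beta gamma c z =
    sph_factor (c + 2 * beta * ln (Cmod (z - 1)) + 2 * gamma * ln (Cmod (z - RtoC (- (gamma / beta))))) *
    Cmod (omega0 beta gamma z) ^ 2.
Proof.
intros H1 H2; apply Cmod_minus_pos in H1; apply Cmod_minus_pos in H2.
assert (N1 : (z - 1)%C <> 0) by (apply Cmod_gt_0; auto).
assert (N2 : (z - RtoC (- (gamma / beta)))%C <> 0) by (apply Cmod_gt_0; auto).
unfold rho_c, omega0.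
replace (z + RtoC (gamma / beta))%C with (z - RtoC (- (gamma / beta)))%C
  by (rewrite RtoC_opp; ring).
rewrite Cmod_div, Cmod_mult by (apply Cmult_neq_0; auto).
set (X := Cmod (z - 1)) in *; set (Y := Cmod (z - RtoC (- (gamma / beta)))) in *.
unfold sph_factor.
replace (2 * (beta - 1)) with (2 * beta + - INR 2) by (simpl; ring).
replace (2 * (gamma - 1)) with (2 * gamma + - INR 2) by (simpl; ring).
rewrite !Rpower_plus, !Rpower_Ropp, !Rpower_pow by auto.
rewrite !exp_plus; fold (Rpower X (2 * beta)); fold (Rpower Y (2 * gamma)).
assert (E1 := exp_pos c); assert (E2 : 0 < Rpower X (2 * beta)) by apply exp_pos.
assert (E3 : 0 < Rpower Y (2 * gamma)) by apply exp_pos.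
assert (0 < exp c * Rpower X (2 * beta) * Rpower Y (2 * gamma))
  by (repeat apply Rmult_lt_0_compat; auto).
field; repeat split; lra.
Qed.

(** This solves the equation 4 dPhi / (Phi (4 - Phi)) = 2 Re (w dz): the derivative of half the
    logit is 2 / (Phi (4 - Phi)). *)
Lemma grad_half_logit (Phi : C -> R) (z w : C) : 0 < Phi z < 4 ->
  grad Phi z (RtoC (Phi z * (4 - Phi z) / 2) * w) ->
  grad (fun v => / 2 * ln (Phi v / (4 - Phi v))) z w.
Proof.
intros H HG.
apply grad_eq with (RtoC (2 / (Phi z * (4 - Phi z))) * (RtoC (Phi z * (4 - Phi z) / 2) * w))%C.
{ rewrite Cmult_assoc, <- RtoC_mult.
  replace (2 / (Phi z * (4 - Phi z)) * (Phi z * (4 - Phi z) / 2)) with 1 by (field; lra).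
  ring. }
apply (grad_comp (fun s => / 2 * ln (s / (4 - s)))); auto.
auto_derive.
- repeat split; try lra; apply Rdiv_lt_0_compat; lra.
- field; lra.
Qed.

Lemma sph_factor_logit (x : R) : 0 < x < 4 ->
  sph_factor (2 * (/ 2 * ln (x / (4 - x)))) = x * (4 - x) / 4.
Proof.
intros H; unfold sph_factor; rewrite <- Rmult_assoc, Rinv_r, Rmult_1_l by lra.
rewrite exp_ln by (apply Rdiv_lt_0_compat; lra); field; lra.
Qed.

Lemma roots_prod_zeros (s : list C) (z : C) : (forall a, In a s -> a = 0) ->
  roots_prod s z = (z ^ length s)%C.
Proof.
induction s as [|a s IH]; simpl; intros H; [reflexivity|].
rewrite IH by auto; rewrite (H a) by auto; ring.
Qed.

Lemma length_2_In (P : list C) (a b : C) : length P = 2%nat -> In a P -> In b P -> a <> b ->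
  P = [a; b] \/ P = [b; a].
Proof.
destruct P as [|p [|q [|? ?]]]; simpl; try discriminate; intros _ Ha Hb Hab.
destruct Ha as [->|[->|[]]], Hb as [->|[->|[]]]; tauto.
Qed.

Lemma character_form_heart (beta gamma : R) (rho : C -> R) (f : C -> C) (a b : C) :
  0 < beta < 1 -> 0 < gamma < 1 -> beta + gamma = 1 ->
  sph_conical_metric rho [(RtoC 0, 2); (a, beta); (b, gamma)] ->
  character_form rho f ->
  simple_pole (coeff_inf f) (RtoC 0) (RtoC (-1)) ->
  a <> 0 /\ b = (- RtoC (gamma / beta) * a)%C /\
  (forall z, z <> a -> z <> b -> f z = (z / ((z - a) * (z - b)))%C) /\
  exists c, forall z : C, z <> 0 -> z <> a -> z <> b -> rho z =
     sph_factor (2 * (c + (beta * ln (Cmod (z - a)) + gamma * ln (Cmod (z - b))))) *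
     Cmod (z / ((z - a) * (z - b))) ^ 2.
Proof.
intros Hbeta Hgamma Hbg (Hnd & Hcone & Hsmooth & _) (P & infp & Htk & _ & Phi & HPhi & Hrho & _) Hinf.
destruct Htk as (HP & Hf & Hpoles & _).
simpl in Hnd; inversion Hnd as [|? ? N0 N1]; subst; inversion N1 as [|? ? N2 _]; subst.
assert (Ha0 : a <> 0) by (intros E; apply N0; left; auto).
assert (Hb0 : b <> 0) by (intros E; apply N0; right; left; auto).
assert (Hab : a <> b) by (intros E; apply N2; left; auto).
destruct (Hcone (RtoC 0, 2)) as [_ C0]; [left; auto|].
destruct (Hcone (a, beta)) as [_ Ca]; [right; left; auto|].
destruct (Hcone (b, gamma)) as [_ Cb]; [right; right; left; auto|].
simpl in C0, Ca, Cb.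
(* Choice needs a residue at every point; off P the value 0 is a dummy. *)
assert (Hch : forall p, exists r : R, In p P -> r <> 0 /\ simple_pole f p (RtoC r)).
{ intros p; destruct (classic (In p P)) as [Hp|Hp]; [|exists 0; tauto].
  destruct (Hpoles p Hp) as [r Hr]; exists r; auto. }
set (r := fun p => proj1_sig (constructive_indefinite_description _ (Hch p))).
assert (Hr : forall p, In p P -> r p <> 0 /\ simple_pole f p (RtoC (r p))).
{ intros p; unfold r; apply proj2_sig. }
clearbody r; clear Hch Hpoles.
set (h := fun z => / 2 * ln (Phi z / (4 - Phi z))).
assert (Hh : forall z, ~ In z P -> cont_at h z /\ grad h z (f z)).
{ intros [x y] Hz; destruct (HPhi x y Hz) as (B & Hc & Dx & Dy); split.
  - apply (cont_at_comp_derive (fun s => / 2 * ln (s / (4 - s)))); auto.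
    auto_derive; repeat split; try lra; apply Rdiv_lt_0_compat; lra.
  - apply grad_half_logit; auto; split; simpl fst; simpl snd.
    + eapply R_derive_eq; [|exact Dx]; unfold Re; simpl; ring.
    + eapply R_derive_eq; [|exact Dy]; unfold Im; simpl; ring. }
destruct (third_kind_partial_fractions f h P r HP Hf (fun p Hp => proj2 (Hr p Hp)) Hinf Hh)
  as ([c Hc] & Hfsum & Hres).
assert (Hfc : forall z, ~ In z P -> ccont f z).
{ intros z Hz; destruct (Hf z Hz) as [l Hl]; eapply cderive_cont; eauto. }
assert (Hrho' : forall z, ~ In z P -> f z <> 0 ->
  rho z = sph_factor (2 * (c + log_sum r P z)) * Cmod (f z) ^ 2).
{ intros z Hz Hfz; rewrite Hrho by auto; f_equal.
  rewrite <- Hc by auto; unfold h; rewrite sph_factor_logit; auto.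
  destruct z as [x y]; apply (HPhi x y Hz). }
assert (HPcons : exists p P', P = p :: P').
{ destruct P as [|p P']; [simpl in Hres; lra|eauto]. }
assert (Hzs : exists zs, S (length zs) = length P /\
  (forall z, pole_num r P z = roots_prod zs z)).
{ destruct HPcons as (p & P' & ->).
  assert (Hpoly := poly_pole_num r P' p); rewrite Hres in Hpoly.
  destruct (poly_splits _ _ Hpoly) as (zs & Hl & Hz); exists zs; simpl; auto. }
destruct Hzs as (zs & Hlen & Hnum).
assert (HzsP : forall z, In z zs -> ~ In z P).
{ intros z Hz HzP; apply (pole_num_pole r P z HP (fun q Hq => proj1 (Hr q Hq)) HzP).
  rewrite Hnum; apply roots_prod_eq_0; auto. }
assert (Hfq : forall z, ~ In z P -> f z = (roots_prod zs z / roots_prod P z)%C).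
{ intros z Hz; rewrite Hfsum, pole_sum_num, Hnum; auto. }
(* This is 4 exp t <= (1 + exp t)^2, the bound of Phi (4 - Phi) / 4 by 1. *)
assert (Hle : forall z, ~ In z P -> ~ In z zs -> rho z <= Cmod (f z) ^ 2).
{ intros z Hz Hzz.
  assert (Hfz : f z <> 0).
  { rewrite Hfq by auto; apply Cmult_neq_0.
    - rewrite roots_prod_eq_0; auto.
    - apply Cmod_gt_0; rewrite Cmod_inv by (rewrite roots_prod_eq_0; auto).
      apply Rinv_0_lt_compat, Cmod_gt_0; rewrite roots_prod_eq_0; auto. }
  rewrite Hrho' by auto; rewrite <- (Rmult_1_l (Cmod (f z) ^ 2)) at 2.
  apply Rmult_le_compat_r; [apply pow_le, Cmod_ge_0|].
  set (t := 2 * (c + log_sum r P z)); unfold sph_factor; assert (E := exp_pos t).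
  apply Rle_div_l; [apply pow_lt; lra|].
  assert (Q := pow2_ge_0 (1 - exp t)); lra. }
assert (HaP : In a P) by (apply (cone_is_pole rho f P zs a beta); auto; lra).
assert (HbP : In b P) by (apply (cone_is_pole rho f P zs b gamma); auto; lra).
assert (Hzs0 : forall z, In z zs -> z = 0).
{ intros z Hz; apply NNPP; intros Hz0.
  apply (smooth_point_not_zero rho f P zs z); auto.
  - apply Hsmooth; simpl; intros [E|[E|[E|[]]]]; subst; eauto.
    + apply (HzsP _ Hz HaP).
    + apply (HzsP _ Hz HbP).
  - rewrite Hfq by auto; rewrite (proj2 (roots_prod_eq_0 zs z) Hz); unfold Cdiv; ring. }
assert (HlenP : (2 <= length P)%nat).
{ apply (NoDup_incl_length (l := [a; b]) (l' := P)).
  - constructor; [simpl; intros [E|[]]; auto|constructor; [simpl; tauto|constructor]].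
  - intros z [<-|[<-|[]]]; auto. }
(* With two poles there is at least one zero; it sits at 0, and zeros are not poles. *)
assert (H0P : ~ In (RtoC 0) P).
{ destruct zs as [|z zs]; [simpl in Hlen; lia|].
  rewrite <- (Hzs0 z) by (left; auto); apply HzsP; left; auto. }
assert (Hzn : (length zs <= 1)%nat).
{ apply (cone_zero_order rho f P (length zs)); auto.
  intros z Hz0 HzP; rewrite <- roots_prod_zeros, <- Hfq by auto.
  apply Hle; auto. }
assert (Hzs1 : length zs = 1%nat) by lia.
(* The list P may hold the two poles in either order; the rest treats both cases together. *)
destruct (length_2_In P a b) as [EP|EP]; auto; [lia| |];
  (assert (Hin : forall z, ~ In z P <-> z <> a /\ z <> b)
    by (intros z; rewrite EP; simpl; split; [intros Hn; split; intros E; subst; tauto|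
        intros [E1 E2] [E|[E|[]]]; auto])).
all: assert (Hf2 : forall z, z <> a -> z <> b -> f z = (z / ((z - a) * (z - b)))%C)
  by (intros z Hza Hzb; rewrite Hfq by (apply Hin; auto);
      rewrite roots_prod_zeros, Hzs1, EP by auto; simpl; rewrite !Cmult_1_r;
      try rewrite (Cmult_comm (z - b)); reflexivity).
all: assert (Hsum : r a + r b = 1) by (rewrite EP in Hres; simpl in Hres; lra).
all: assert (Hlog : forall z, log_sum r P z = r a * ln (Cmod (z - a)) + r b * ln (Cmod (z - b)))
  by (intros z; rewrite EP; simpl; ring).
all: assert (Hrho2 : forall z : C, z <> 0 -> z <> a -> z <> b -> rho z =
     sph_factor (2 * (c + (r a * ln (Cmod (z - a)) + r b * ln (Cmod (z - b))))) *
     Cmod (z / ((z - a) * (z - b))) ^ 2)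
  by (intros z Hz0 Hza Hzb; rewrite <- Hlog, <- Hf2 by auto; apply Hrho'; [apply Hin; auto|];
      rewrite Hf2 by auto; apply Cmult_neq_0; auto;
      apply Cmod_gt_0; rewrite Cmod_inv by (apply Cmult_neq_0; apply Cminus_eq_contra; auto);
      apply Rinv_0_lt_compat, Cmod_gt_0, Cmult_neq_0; apply Cminus_eq_contra; auto).
all: assert (Ra : beta = Rabs (r a)) by (apply (residue_at_cone rho a b c (r a) (r b)); auto).
all: assert (Rb : gamma = Rabs (r b)) by
  (apply (residue_at_cone rho b a c (r b) (r a)); auto; intros z Hz0 Hzb Hza;
   rewrite Hrho2 by auto; rewrite (Rplus_comm (r b * _)), (Cmult_comm (z - b)); auto).
(* Both signs negative would give the sum -1, and opposite signs a sum below 1 in absolute value. *)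
all: assert (Ea : r a = beta) by (revert Ra Rb; unfold Rabs; do 2 destruct Rcase_abs; lra).
all: assert (Eb : r b = gamma) by lra.
all: rewrite Ea, Eb in Hrho2.
all: split; [auto|split; [|split; [auto|exists c; auto]]].
(* Since f 0 = 0, the partial fractions at 0 give beta / (0 - a) + gamma / (0 - b) = 0, that is beta
   b + gamma a = 0. *)
all: assert (F0 := Hfsum 0 (proj2 (Hin 0) (conj (not_eq_sym Ha0) (not_eq_sym Hb0)))).
all: rewrite Hf2, EP in F0 by auto; simpl in F0; rewrite Ea, Eb in F0.
all: assert (Hbeta0 : RtoC beta <> 0) by (intros E; apply RtoC_inj in E; lra).
all: rewrite RtoC_div by lra.
all: assert (K : (RtoC beta * b + RtoC gamma * a = 0)%C).
1,3: assert (A1 : (0 - a)%C <> 0) by (apply Cminus_eq_contra; auto);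
     assert (A2 : (0 - b)%C <> 0) by (apply Cminus_eq_contra; auto).
1,2: transitivity ((- (RtoC beta * / (0 - a) + RtoC gamma * / (0 - b))) * ((0 - a) * (0 - b)))%C;
     [field; auto|].
1: replace (RtoC beta * / (0 - a) + RtoC gamma * / (0 - b))%C
     with (RtoC beta * / (0 - a) + (RtoC gamma * / (0 - b) + 0))%C by ring.
2: replace (RtoC beta * / (0 - a) + RtoC gamma * / (0 - b))%C
     with (RtoC gamma * / (0 - b) + (RtoC beta * / (0 - a) + 0))%C by ring.
1,2: rewrite <- F0; unfold Cdiv; ring.
all: transitivity ((RtoC beta * b + RtoC gamma * a - RtoC gamma * a) / RtoC beta)%C;
     [field; auto|rewrite K; field; auto].
Qed.

Lemma heart_unique (beta gamma : R) (rho : C -> R) (f : C -> C) (a b : C) :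
  0 < beta < 1 -> 0 < gamma < 1 -> beta + gamma = 1 ->
  sph_conical_metric rho [(RtoC 0, 2); (a, beta); (b, gamma)] ->
  character_form rho f ->
  simple_pole (coeff_inf f) (RtoC 0) (RtoC (-1)) ->
  exists p : C, p <> RtoC 0 /\
    (forall z : C, z <> RtoC 1 -> z <> RtoC (- (gamma / beta)) ->
       Cmult p (f (Cmult p z)) = omega0 beta gamma z) /\
    exists c : R, forall z : C,
      z <> RtoC 0 -> z <> RtoC 1 -> z <> RtoC (- (gamma / beta)) ->
      (Cmod p) ^ 2 * rho (Cmult p z) = rho_c beta gamma c z.
Proof.
intros Hbeta Hgamma Hbg Hmet Hchar Hinf.
destruct (character_form_heart beta gamma rho f a b Hbeta Hgamma Hbg Hmet Hchar Hinf)
  as (Ha0 & Hb & Hf & c & Hrho).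
assert (Hma : 0 < Cmod a) by (apply Cmod_gt_0; auto).
assert (Hne : forall z w : C, z <> w -> (a * z)%C <> (a * w)%C).
{ intros z w Hzw E; apply (Cmult_neq_0 a (z - w)%C); auto; [apply Cminus_eq_contra; auto|].
  replace (a * (z - w))%C with (a * z - a * w)%C by ring; rewrite E; ring. }
assert (Hb' : b = (a * RtoC (- (gamma / beta)))%C) by (rewrite Hb, RtoC_opp; ring).
assert (Hza : forall z : C, z <> 1 -> (a * z)%C <> a).
{ intros z Hz; specialize (Hne z 1 Hz); rewrite Cmult_1_r in Hne; auto. }
assert (Hzb : forall z : C, z <> RtoC (- (gamma / beta)) -> (a * z)%C <> b).
{ intros z Hz; rewrite Hb'; auto. }
assert (Hom : forall z : C, z <> 1 -> z <> RtoC (- (gamma / beta)) ->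
  (a * (a * z / ((a * z - a) * (a * z - b))) = omega0 beta gamma z)%C).
{ intros z H1 H2; unfold omega0.
  assert (N1 : (z - 1)%C <> 0) by (apply Cminus_eq_contra; auto).
  assert (N2 : (z + RtoC (gamma / beta))%C <> 0).
  { replace (z + RtoC (gamma / beta))%C with (z - RtoC (- (gamma / beta)))%C
      by (rewrite RtoC_opp; ring).
    apply Cminus_eq_contra; auto. }
  replace (a * z - a)%C with (a * (z - 1))%C by ring.
  replace (a * z - b)%C with (a * (z + RtoC (gamma / beta)))%C by (rewrite Hb; ring).
  field; auto. }
exists a; split; [auto|split].
- intros z H1 H2; rewrite Hf by auto; auto.
(* Substituting a z pulls |a|^(2 beta + 2 gamma) = |a|^2 out of the exponential, which shifts the
   constant by 2 ln |a|. *)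
- exists (2 * c + 2 * ln (Cmod a)); intros z H0 H1 H2.
  assert (Haz : (a * z)%C <> 0) by (apply Cmult_neq_0; auto).
  rewrite rho_c_sph_factor, Hrho by auto.
  rewrite <- Hom by auto; rewrite (Cmod_mult a).
  replace (2 * (c + (beta * ln (Cmod (a * z - a)) + gamma * ln (Cmod (a * z - b)))))
    with (c + c + 2 * ln (Cmod a) + 2 * beta * ln (Cmod (z - 1)) +
          2 * gamma * ln (Cmod (z - RtoC (- (gamma / beta))))).
  + replace (2 * c) with (c + c) by ring; ring.
  + replace (a * z - a)%C with (a * (z - 1))%C by ring.
    replace (a * z - b)%C with (a * (z - RtoC (- (gamma / beta))))%C by (rewrite Hb'; ring).
    rewrite !Cmod_mult, !ln_mult by (auto; apply Cmod_minus_pos; auto).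
    replace gamma with (1 - beta) by lra; ring.
Qed.

(** * Existence *)

Lemma cont_at_Rpower_pos (u : C -> R) (s : R) (z : C) :
  cont_at u z -> 0 < u z -> cont_at (fun w => Rpower (u w) s) z.
Proof.
intros Hu Hz; apply (cont_at_comp_derive (fun x => Rpower x s)); auto.
unfold Rpower; auto_derive; auto.
Qed.

(** [Rpower] with the value [0] at [0] (where Rocq's [Rpower 0 s] is [1]). *)
Definition Rpower0 (x s : R) : R := if Req_dec_T x 0 then 0 else Rpower x s.

Lemma cont_at_Rpower0 (p z : C) (s : R) : 0 < s ->
  cont_at (fun w => Rpower0 (Cmod (w - p)) s) z.
Proof.
intros Hs; destruct (classic (z = p)) as [->|Hz].
- intros eps Heps; exists (Rpower eps (/ s)); split; [apply exp_pos|].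
  intros w Hw; unfold Rpower0; rewrite Cmod_self.
  destruct (Req_dec_T 0 0); [|lra].
  destruct Req_dec_T as [E|E]; [rewrite Rminus_0_r, Rabs_R0; auto|].
  assert (H0 := Cmod_ge_0 (w - p)).
  rewrite Rminus_0_r, Rabs_pos_eq by apply Rlt_le, exp_pos.
  rewrite <- (Rpower_1 eps) by auto; rewrite <- (Rinv_l s) by lra.
  rewrite <- Rpower_mult; apply Rlt_Rpower_l; auto; lra.
- apply Cmod_minus_pos in Hz.
  apply cont_at_ext_loc with (fun w => Rpower (Cmod (w - p)) s) (Cmod (z - p)); auto.
  + intros w Hw; apply neq_nearby, Cmod_minus_pos in Hw.
    unfold Rpower0; destruct Req_dec_T; auto; lra.
  + apply cont_at_Rpower_pos; auto; apply cont_at_Cmod, ccont_shift.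
Qed.

Lemma cont_at_ln (u : C -> R) (z : C) : cont_at u z -> 0 < u z -> cont_at (fun w => ln (u w)) z.
Proof. intros Hu Hz; apply cont_at_comp_derive; auto; auto_derive; auto. Qed.

(** The exponent u collects ln A and the denominator. It must be continuous at [p] too, where the
    power |z - p|^(2 s) should be 0; hence [Rpower0] there. *)
Lemma cone_at_intro (rho A B : C -> R) (p : C) (s d : R) : 0 < s -> 0 < d ->
  (forall z, Cmod (z - p) < d -> (cont_at A z /\ 0 < A z) /\ (cont_at B z /\ 0 < B z)) ->
  (forall z, 0 < Cmod (z - p) < d -> rho z =
     Rpower (Cmod (z - p)) (2 * (s - 1)) * A z / (1 + Rpower (Cmod (z - p)) (2 * s) * B z) ^ 2) ->
  cone_at rho p s.
Proof.
intros Hs Hd HAB Hrho; exists d; split; auto.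
assert (Hpos : forall z, Cmod (z - p) < d -> 0 < 1 + Rpower0 (Cmod (z - p)) (2 * s) * B z).
{ intros z Hz; destruct (HAB z Hz) as [_ [_ HB]].
  assert (0 <= Rpower0 (Cmod (z - p)) (2 * s)).
  { unfold Rpower0; destruct Req_dec_T; [lra|apply Rlt_le, exp_pos]. }
  assert (0 <= Rpower0 (Cmod (z - p)) (2 * s) * B z) by (apply Rmult_le_pos; lra); lra. }
exists (fun z => ln (A z) - 2 * ln (1 + Rpower0 (Cmod (z - p)) (2 * s) * B z)); split.
- intros z Hz; destruct (HAB z Hz) as [[HA1 HA2] [HB1 HB2]].
  apply cont_at_minus; [apply cont_at_ln; auto|].
  apply cont_at_mult; [apply cont_at_const|apply cont_at_ln; auto].
  apply cont_at_plus; [apply cont_at_const|].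
  apply cont_at_mult; auto; apply cont_at_Rpower0; lra.
- intros z Hz; rewrite Hrho by auto.
  destruct (HAB z (proj2 Hz)) as [[HA1 HA2] [HB1 HB2]].
  assert (HP := Hpos z (proj2 Hz)).
  replace (Rpower0 (Cmod (z - p)) (2 * s)) with (Rpower (Cmod (z - p)) (2 * s)) in *
    by (unfold Rpower0; destruct Req_dec_T; auto; lra).
  set (D := 1 + Rpower (Cmod (z - p)) (2 * s) * B z) in *.
  replace (ln (A z) - 2 * ln D) with (ln (A z) + - ln (D ^ 2)) by (rewrite ln_pow by auto; simpl; ring).
  rewrite exp_plus, exp_Ropp, !exp_ln by (auto; apply pow_lt; auto).
  unfold Rdiv; ring.
Qed.

Lemma is_derive_ln_sqr_exp (V : R -> R) (x s l : R) : 0 <= s -> is_derive V x l ->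
  is_derive (fun t => ln (t ^ 2 + s + exp (V t))) x
    ((2 * x + exp (V x) * l) / (x ^ 2 + s + exp (V x))).
Proof.
intros Hs HV; assert (E := exp_pos (V x)); assert (S := pow2_ge_0 x); simpl in S; auto_derive.
- repeat split; try lra; eexists; exact HV.
- replace (Derive (fun t => V t) x) with l by (symmetry; exact (is_derive_unique _ _ _ HV)).
  simpl; field; lra.
Qed.

Lemma is_derive_log_metric_inf (V G : R -> R) (l : R) :
  is_derive V 0 (G 0) -> is_derive G 0 l ->
  is_derive (fun t => (2 * t + exp (V t) * G t) / (t ^ 2 + exp (V t))) 0 (2 * exp (- V 0) + l).
Proof.
intros HV HG; assert (E := exp_pos (V 0)); auto_derive.
- repeat split; try (eexists; eassumption); lra.
- replace (Derive (fun t => V t) 0) with (G 0) by (symmetry; exact (is_derive_unique _ _ _ HV)).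
  replace (Derive (fun t => G t) 0) with l by (symmetry; exact (is_derive_unique _ _ _ HG)).
  rewrite exp_Ropp; field; lra.
Qed.

(** At infinity [u] diverges and the composition rule does not apply, so its singular part is
    cleared into |w|^2. At 0 each second derivative has the term 2 exp (- v 0); the terms Re l and
    -Re l cancel by Cauchy-Riemann. *)
Lemma is_laplacian_log_metric_inf (v : C -> R) (g : C -> C) (d : R) : 0 < d ->
  (forall w, Cmod (w - 0) < d -> grad v w (g w)) ->
  ex_derive (K := C_AbsRing) (V := C_NormedModule) g (RtoC 0) ->
  is_laplacian (fun w => ln (Cmod w ^ 2 + exp (v w))) 0 (4 * exp (- v (RtoC 0))).
Proof.
intros Hd Hv [l Hl].
assert (Hv0 : grad v (RtoC 0) (g (RtoC 0))) by (apply Hv; rewrite Cmod_self; auto).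
destruct Hv0 as [V1 V2]; apply cderive_partials in Hl; destruct Hl as (L1 & _ & _ & L4).
simpl in V1, V2.
exists d; split; auto.
exists (fun w => (2 * Re w + exp (v w) * Re (g w)) / (Cmod w ^ 2 + exp (v w))),
  (fun w => (2 * Im w + exp (v w) * - Im (g w)) / (Cmod w ^ 2 + exp (v w))).
assert (Hsq : forall x y : R, Cmod (x, y) ^ 2 = x ^ 2 + y ^ 2).
{ intros x y; rewrite Cmod2_alt; reflexivity. }
split.
- intros x y Hxy; destruct (Hv _ Hxy) as [D1 D2]; simpl in D1, D2.
  assert (E := exp_pos (v (x, y))); assert (S1 := pow2_ge_0 x); assert (S2 := pow2_ge_0 y).
  rewrite Hsq; split.
  + apply is_derive_ext with (fun t => ln (t ^ 2 + y ^ 2 + exp (v (t, y)))).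
    { intros t; rewrite <- Hsq; reflexivity. }
    apply (is_derive_ln_sqr_exp (fun t => v (t, y))); auto.
  + apply is_derive_ext with (fun t => ln (t ^ 2 + x ^ 2 + exp (v (x, t)))).
    { intros t; rewrite (Rplus_comm (t ^ 2)), <- Hsq; reflexivity. }
    rewrite (Rplus_comm (x ^ 2)); apply (is_derive_ln_sqr_exp (fun t => v (x, t))); auto.
- exists (2 * exp (- v (RtoC 0)) + Re l), (2 * exp (- v (RtoC 0)) + - Re l).
  simpl fst; simpl snd; split; [|split; [|lra]].
  + apply is_derive_ext with
      (fun t => (2 * t + exp (v (t, 0)) * Re (g (t, 0))) / (t ^ 2 + exp (v (t, 0)))).
    { intros t; rewrite Hsq; unfold Re; simpl; f_equal; ring. }
    apply (is_derive_log_metric_inf (fun t => v (t, 0)) (fun t => Re (g (t, 0)))); auto.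
  + apply is_derive_ext with
      (fun t => (2 * t + exp (v (0, t)) * - Im (g (0, t))) / (t ^ 2 + exp (v (0, t)))).
    { intros t; rewrite Hsq; unfold Im; simpl; f_equal; ring. }
    apply (is_derive_log_metric_inf (fun t => v (0, t)) (fun t => - Im (g (0, t)))); auto.
    exact (is_derive_opp _ _ _ L4).
Qed.

(** * The metric at finite points *)

Section Existence.

Variables (beta gamma c : R).
Hypotheses (Hbeta : 0 < beta < 1) (Hgamma : 0 < gamma < 1) (Hbg : beta + gamma = 1).

Let m : C := RtoC (- (gamma / beta)).

(** This is ln |F|^2 for the developing map F = exp (c / 2) (z - 1)^beta (z - m)^gamma, whose
    logarithmic derivative is [omega0]. *)
Let u (w : C) : R := c + 2 * beta * ln (Cmod (w - 1)) + 2 * gamma * ln (Cmod (w - m)).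

Lemma heart_ratio_pos : 0 < gamma / beta.
Proof. apply Rdiv_lt_0_compat; lra. Qed.

Lemma heart_poles_neq : RtoC 1 <> m /\ RtoC 0 <> m.
Proof.
assert (H := heart_ratio_pos); split; intros E; apply RtoC_inj in E; lra.
Qed.

Lemma shift_m (z : C) : (z + RtoC (gamma / beta))%C = (z - m)%C.
Proof. unfold m; rewrite RtoC_opp; ring. Qed.

Lemma omega0_m (z : C) : omega0 beta gamma z = (z / ((z - 1) * (z - m)))%C.
Proof. unfold omega0; rewrite shift_m; reflexivity. Qed.

Lemma rho_c_u (z : C) : z <> 1 -> z <> m ->
  rho_c beta gamma c z = sph_factor (u z) * Cmod (omega0 beta gamma z) ^ 2.
Proof. intros H1 H2; rewrite rho_c_sph_factor; auto. Qed.

(** The sum beta / (z - 1) + gamma / (z - m) has numerator z - (beta m + gamma), and beta m = -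
    gamma. *)
Lemma grad_u (z : C) : z <> 1 -> z <> m -> grad u z (2 * omega0 beta gamma z).
Proof.
intros H1 H2; rewrite omega0_m.
assert (N1 : (z - 1)%C <> 0) by (apply Cminus_eq_contra; auto).
assert (N2 : (z - m)%C <> 0) by (apply Cminus_eq_contra; auto).
eapply grad_eq; [|apply grad_plus; [apply grad_plus; [apply grad_const|]|];
  apply grad_scal, grad_ln_dist; auto].
assert (Hb : RtoC beta <> 0) by (intros E; apply RtoC_inj in E; lra).
assert (E : RtoC gamma = (1 - RtoC beta)%C) by (rewrite <- RtoC_minus; f_equal; lra).
rewrite !RtoC_mult.
assert (Em : m = (- (1 - RtoC beta) / RtoC beta)%C).
{ unfold m; rewrite RtoC_opp, RtoC_div by lra; rewrite E; field; auto. }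
(* This is beta (z - m) after eliminating gamma, the form of the denominator that [field] meets. *)
assert (N3 : (RtoC beta * z + 1 - RtoC beta)%C <> 0).
{ intros E0; apply N2; rewrite Em.
  transitivity ((RtoC beta * z + 1 - RtoC beta) / RtoC beta)%C; [field; auto|].
  rewrite E0; field; auto. }
rewrite E, Em; rewrite Em in N2; field; repeat split; auto.
intros E0; apply N3; rewrite <- E0; ring.
Qed.

Lemma cderive_omega0 (z : C) : z <> 1 -> z <> m ->
  ex_derive (K := C_AbsRing) (V := C_NormedModule) (omega0 beta gamma) z.
Proof.
intros H1 H2; eexists.
eapply is_derive_ext; [intros t; symmetry; apply omega0_m|].
apply (cderive_mult (fun w => w) (fun w => / ((w - 1) * (w - m)))%C); [apply cderive_id|].
apply cderive_inv; [apply cderive_mult; apply cderive_shift|].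
apply Cmult_neq_0; apply Cminus_eq_contra; auto.
Qed.

Lemma neq_poles_nearby (z : C) : z <> 1 -> z <> m ->
  exists d, 0 < d /\ forall w, Cmod (w - z) < d -> w <> 1 /\ w <> m.
Proof.
intros H1 H2; destruct (notin_nearby [RtoC 1; m] z) as (d & Hd & H).
- simpl; intros [E|[E|[]]]; auto.
- exists d; split; auto; intros w Hw; specialize (H w Hw); simpl in H.
  split; intros E; apply H; auto.
Qed.

Lemma cont_at_u (z : C) : z <> 1 -> z <> m -> cont_at u z.
Proof.
intros H1 H2; apply cont_at_plus; [apply cont_at_plus; [apply cont_at_const|]|];
  (apply cont_at_mult; [apply cont_at_const|apply cont_at_ln_dist; auto]).
Qed.

Lemma is_derive_sph_factor_ln (t : R) :
  is_derive (fun s => ln (sph_factor s)) t (1 - 2 * exp t / (1 + exp t)).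
Proof.
assert (E := exp_pos t); unfold sph_factor; auto_derive.
- repeat split; auto; try lra.
  + apply Rgt_not_eq; apply Rmult_lt_0_compat; lra.
  + apply Rdiv_lt_0_compat; [lra|repeat apply Rmult_lt_0_compat; lra].
- field; lra.
Qed.

(** The second derivative of ln sph_factor is - sph_factor / 2 and the gradient of [u] has length 2
    |omega0|, so this part has Laplacian -2 rho; the remaining ln |omega0|^2 is harmonic off zeros
    and poles. *)
Lemma curv1_at_heart (z : C) : z <> 0 -> z <> 1 -> z <> m -> curv1_at (rho_c beta gamma c) z.
Proof.
intros H0 H1 H2.
destruct (neq_poles_nearby z H1 H2) as (d1 & Hd1 & Hn).
assert (P0 : 0 < Cmod z) by (apply Cmod_gt_0; auto).
assert (Homega : forall w : C, w <> 0 -> w <> 1 -> w <> m -> 0 < Cmod (omega0 beta gamma w)).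
{ intros w W0 W1 W2; rewrite omega0_m, Cmod_div, Cmod_mult
    by (apply Cmult_neq_0; apply Cminus_eq_contra; auto).
  apply Rdiv_lt_0_compat; [apply Cmod_gt_0; auto|].
  apply Rmult_lt_0_compat; apply Cmod_minus_pos; auto. }
assert (Hc : ccont (omega0 beta gamma) z).
{ destruct (cderive_omega0 z H1 H2) as [l Hl]; eapply cderive_cont; eauto. }
split; [|split].
- rewrite rho_c_u by auto; apply Rmult_lt_0_compat; [apply sph_factor_pos|apply pow_lt; auto].
- apply cont_at_ext_loc with (fun w => sph_factor (u w) * Cmod (omega0 beta gamma w) ^ 2) d1; auto.
  { intros w Hw; symmetry; apply rho_c_u; apply Hn; auto. }
  apply cont_at_mult.
  + apply (cont_at_comp_derive sph_factor); [apply cont_at_u; auto|].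
    unfold sph_factor; assert (E := exp_pos (u z)); auto_derive.
    repeat split; auto; apply Rgt_not_eq; try apply Rmult_lt_0_compat; lra.
  + apply (cont_at_comp_derive (fun x => x ^ 2)); [apply cont_at_Cmod; auto|auto_derive; auto].
- set (d := Rmin d1 (Cmod z)).
  assert (Hd : 0 < d) by (apply Rmin_glb_lt; auto).
  assert (L1 : d <= d1) by apply Rmin_l; assert (L2 : d <= Cmod z) by apply Rmin_r.
  apply is_laplacian_ext_loc with (d := d) (u := fun w =>
    ln (sph_factor (u w)) + 2 * (ln (Cmod (w - 0)) - ln (Cmod (w - 1)) - ln (Cmod (w - m)))); auto.
  { intros w Hw; destruct (Hn w ltac:(lra)) as [W1 W2].
    assert (W0 : w <> 0).
    { apply neq_nearby with z; replace (z - 0)%C with z by ring; lra. }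
    assert (Q := Homega w W0 W1 W2).
    rewrite rho_c_u, ln_mult, ln_pow by (auto; try apply sph_factor_pos; apply pow_lt; auto).
    rewrite omega0_m, Cmod_div, Cmod_mult by (apply Cmult_neq_0; apply Cminus_eq_contra; auto).
    assert (Q1 := Cmod_minus_pos w 1 W1); assert (Q2 := Cmod_minus_pos w m W2).
    rewrite ln_div, ln_mult by (auto; try apply Rmult_lt_0_compat; auto; apply Cmod_gt_0; auto).
    replace (w - 0)%C with w by ring; simpl; ring. }
  apply is_laplacian_eq with
    ((- 2 * exp (u z) / (1 + exp (u z)) ^ 2) * Cmod (2 * omega0 beta gamma z) ^ 2 + 2 * 0).
  { rewrite rho_c_u by auto; unfold sph_factor.
    rewrite Cmod_mult, Cmod_R, Rabs_pos_eq by lra; assert (E := exp_pos (u z)); field; lra. }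
  apply is_laplacian_plus.
  + apply (is_laplacian_comp (fun t => ln (sph_factor t)) (fun t => 1 - 2 * exp t / (1 + exp t)) u
      (fun w => 2 * omega0 beta gamma w)%C z d1); auto.
    * intros w Hw; apply grad_u; apply Hn; auto.
    * destruct (cderive_omega0 z H1 H2) as [l Hl]; eexists.
      apply (cderive_mult (fun _ => RtoC 2)); [apply cderive_const|exact Hl].
    * intros; apply is_derive_sph_factor_ln.
    * assert (E := exp_pos (u z)); auto_derive; [lra|field; lra].
  + apply is_laplacian_scal.
    apply (harmonic_minus (fun w => ln (Cmod (w - 0)) - ln (Cmod (w - 1))));
      [apply harmonic_minus|]; apply harmonic_ln_dist; auto.
Qed.

Lemma cone_at_heart_0 : cone_at (rho_c beta gamma c) 0 2.
Proof.
destruct heart_poles_neq as [_ Hm].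
destruct (neq_poles_nearby 0) as (d & Hd & Hn); auto.
{ intros E; apply C1_nz; auto. }
exists d; split; auto.
exists (fun w => ln (sph_factor (u w)) - 2 * (ln (Cmod (w - 1)) + ln (Cmod (w - m)))); split.
- intros z Hz; destruct (Hn z Hz) as [H1 H2].
  apply cont_at_minus.
  + apply (cont_at_comp_derive (fun t => ln (sph_factor t))); [apply cont_at_u; auto|].
    eexists; apply is_derive_sph_factor_ln.
  + apply cont_at_mult; [apply cont_at_const|apply cont_at_plus; apply cont_at_ln_dist; auto].
- intros z Hz; destruct (Hn z (proj2 Hz)) as [H1 H2].
  rewrite rho_c_u by auto; rewrite omega0_m.
  apply Cmod_minus_pos in H1 as Q1; apply Cmod_minus_pos in H2 as Q2.
  rewrite Cmod_div, Cmod_mult by (apply Cmult_neq_0; apply Cminus_eq_contra; auto).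
  replace (2 * (2 - 1)) with (INR 2) by (simpl; ring); rewrite Rpower_pow by lra.
  replace (z - 0)%C with z by ring.
  replace (ln (sph_factor (u z)) - 2 * (ln (Cmod (z - 1)) + ln (Cmod (z - m))))
    with (ln (sph_factor (u z)) + - (ln (Cmod (z - 1) ^ 2) + ln (Cmod (z - m) ^ 2)))
    by (rewrite !ln_pow by auto; simpl; ring).
  rewrite exp_plus, exp_Ropp, exp_plus, !exp_ln
    by (try apply sph_factor_pos; apply pow_lt; auto).
  field; lra.
Qed.

Lemma cont_at_pos_factor (q : C) (s : R) (z : C) : z <> q ->
  cont_at (fun w => Rpower (Cmod (w - q)) s) z /\ 0 < Rpower (Cmod (z - q)) s.
Proof.
intros H; split; [|apply exp_pos].
apply cont_at_Rpower_pos; [apply cont_at_Cmod, ccont_shift|apply Cmod_minus_pos; auto].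
Qed.

Lemma cone_at_heart_1 : cone_at (rho_c beta gamma c) 1 beta.
Proof.
destruct heart_poles_neq as [Hm _].
destruct (notin_nearby [RtoC 0; m] 1) as (d & Hd & Hn).
{ simpl; intros [E|[E|[]]]; auto; apply C1_nz; auto. }
apply cone_at_intro with (d := d)
  (A := fun z => 4 * exp c * Rpower (Cmod (z - m)) (2 * (gamma - 1)) * Cmod (z - 0) ^ 2)
  (B := fun z => exp c * Rpower (Cmod (z - m)) (2 * gamma)); try lra.
- intros z Hz; specialize (Hn z Hz); simpl in Hn.
  assert (H0 : z <> 0) by (intros E; apply Hn; auto).
  assert (H2 : z <> m) by (intros E; apply Hn; auto).
  assert (E := exp_pos c).
  destruct (cont_at_pos_factor m (2 * (gamma - 1)) z H2) as [C1 P1].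
  destruct (cont_at_pos_factor m (2 * gamma) z H2) as [C2 P2].
  split; split.
  + apply cont_at_mult; [apply cont_at_mult; auto; apply cont_at_const|].
    apply (cont_at_comp_derive (fun x => x ^ 2)); [apply cont_at_Cmod, ccont_shift|auto_derive; auto].
  + apply Rmult_lt_0_compat; [apply Rmult_lt_0_compat; [lra|auto]|].
    apply pow_lt, Cmod_minus_pos; auto.
  + apply cont_at_mult; auto; apply cont_at_const.
  + apply Rmult_lt_0_compat; auto.
- intros z Hz; unfold rho_c; rewrite shift_m; replace (z - 0)%C with z by ring.
  unfold Rdiv; f_equal; [ring|do 3 f_equal; ring].
Qed.

Lemma cone_at_heart_m : cone_at (rho_c beta gamma c) m gamma.
Proof.
destruct heart_poles_neq as [Hm H0m].
destruct (notin_nearby [RtoC 0; RtoC 1] m) as (d & Hd & Hn).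
{ simpl; intros [E|[E|[]]]; auto. }
apply cone_at_intro with (d := d)
  (A := fun z => 4 * exp c * Rpower (Cmod (z - 1)) (2 * (beta - 1)) * Cmod (z - 0) ^ 2)
  (B := fun z => exp c * Rpower (Cmod (z - 1)) (2 * beta)); try lra.
- intros z Hz; specialize (Hn z Hz); simpl in Hn.
  assert (H0 : z <> 0) by (intros E; apply Hn; auto).
  assert (H1 : z <> 1) by (intros E; apply Hn; auto).
  assert (E := exp_pos c).
  destruct (cont_at_pos_factor 1 (2 * (beta - 1)) z H1) as [C1 P1].
  destruct (cont_at_pos_factor 1 (2 * beta) z H1) as [C2 P2].
  split; split.
  + apply cont_at_mult; [apply cont_at_mult; auto; apply cont_at_const|].
    apply (cont_at_comp_derive (fun x => x ^ 2)); [apply cont_at_Cmod, ccont_shift|auto_derive; auto].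
  + apply Rmult_lt_0_compat; [apply Rmult_lt_0_compat; [lra|auto]|].
    apply pow_lt, Cmod_minus_pos; auto.
  + apply cont_at_mult; auto; apply cont_at_const.
  + apply Rmult_lt_0_compat; auto.
- intros z Hz; unfold rho_c; rewrite shift_m; replace (z - 0)%C with z by ring.
  unfold Rdiv; f_equal; [ring|do 3 f_equal; ring].
Qed.

(** * The metric at infinity, and its character form *)

Let k : R := gamma / beta.

(** This is 1 / m, the pole [m] seen in the chart w = 1 / z. *)
Let n : C := RtoC (- / k).

(** Chosen so that u (1 / w) = v w - 2 ln |w|; unlike u (1 / w), it is harmonic at w = 0. *)
Let v (w : C) : R :=
  c + 2 * gamma * ln k + (2 * beta * ln (Cmod (w - 1)) + 2 * gamma * ln (Cmod (w - n))).

(** The density in the chart w = 1 / z with all negative powers of |w| cleared, which gives it its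
    proper value at w = 0. *)
Let rho_inf (w : C) : R :=
  4 * exp (v w) / (Cmod (w - 1) ^ 2 * (k * Cmod (w - n)) ^ 2) / (Cmod w ^ 2 + exp (v w)) ^ 2.

Lemma heart_inf_disc : exists d, 0 < d /\ forall w, Cmod (w - 0) < d -> w <> 1 /\ w <> n.
Proof.
assert (Hk : 0 < k) by apply heart_ratio_pos; assert (Hik := Rinv_0_lt_compat k Hk).
destruct (notin_nearby [RtoC 1; n] 0) as (d & Hd & Hn).
{ simpl; intros [E|[E|[]]]; [apply C1_nz; auto|apply RtoC_inj in E; lra]. }
exists d; split; auto; intros w Hw; specialize (Hn w Hw); simpl in Hn.
split; intros E; apply Hn; auto.
Qed.

Lemma Cinv_minus_m (w : C) : w <> 0 -> (/ w - m)%C = (RtoC k * (w - n) / w)%C.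
Proof.
intros H; assert (Hk : 0 < k) by apply heart_ratio_pos.
assert (Hk0 : RtoC k <> 0) by (intros E; apply RtoC_inj in E; lra).
unfold n, m; fold k; rewrite !RtoC_opp, RtoC_inv by lra; field; auto.
Qed.

Lemma rho_inf_eq (w : C) : w <> 0 -> w <> 1 -> w <> n ->
  rho_inf w = rho_c beta gamma c (/ w) / Cmod w ^ 4.
Proof.
intros H0 H1 Hn; assert (Hk : 0 < k) by apply heart_ratio_pos.
assert (Q0 : 0 < Cmod w) by (apply Cmod_gt_0; auto).
assert (Q1 := Cmod_minus_pos w 1 H1); assert (Q2 := Cmod_minus_pos w n Hn).
assert (M1 : Cmod (/ w - 1) = Cmod (w - 1) / Cmod w).
{ rewrite Cmod_minus_sym; rewrite <- Cmod_div by auto; f_equal; field; auto. }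
assert (M2 : Cmod (/ w - m) = k * Cmod (w - n) / Cmod w).
{ rewrite Cinv_minus_m, Cmod_div, Cmod_mult, Cmod_R, Rabs_pos_eq by (auto; lra); auto. }
assert (Hkn : 0 < k * Cmod (w - n)) by (apply Rmult_lt_0_compat; auto).
assert (P1 : 0 < Cmod (w - 1) / Cmod w) by (apply Rdiv_lt_0_compat; auto).
assert (P2 : 0 < k * Cmod (w - n) / Cmod w) by (apply Rdiv_lt_0_compat; auto).
assert (N1 : (/ w)%C <> 1) by (apply Cmod_minus_neq; rewrite M1; auto).
assert (N2 : (/ w)%C <> m) by (apply Cmod_minus_neq; rewrite M2; auto).
rewrite rho_c_u, omega0_m by auto.
rewrite Cmod_div, Cmod_mult, M1, M2, Cmod_inv
  by (auto; apply Cmult_neq_0; apply Cminus_eq_contra; auto).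
assert (Hu : exp (u (/ w)%C) = exp (v w) / Cmod w ^ 2).
{ rewrite <- (exp_ln (Cmod w ^ 2)) by (apply pow_lt; auto).
  unfold Rdiv; rewrite <- exp_Ropp, <- exp_plus; f_equal.
  unfold u, v; rewrite M1, M2, !ln_div, ln_mult, ln_pow by auto.
  replace gamma with (1 - beta) by lra; simpl; ring. }
unfold sph_factor; rewrite Hu; unfold rho_inf.
assert (E := exp_pos (v w)).
assert (0 < Cmod w ^ 2) by (apply pow_lt; auto).
field; repeat split; lra.
Qed.

(** Apart from -2 ln (|w|^2 + exp (v w)) all terms of ln rho_inf are harmonic near 0. The Laplacian
    is thus -8 exp (- v 0), and rho_inf 0 = 4 exp (- v 0) because k |0 - n| = 1. *)
Lemma curv1_at_heart_inf : curv1_at rho_inf 0.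
Proof.
destruct heart_inf_disc as (d & Hd & Hn).
assert (Hk : 0 < k) by apply heart_ratio_pos.
assert (Hgv : forall w : C, w <> 1 -> w <> n -> grad v w
  (0 + (RtoC (2 * beta) * / (w - 1) + RtoC (2 * gamma) * / (w - n)))).
{ intros w W1 Wn; apply grad_plus; [apply grad_const|].
  apply grad_plus; apply grad_scal, grad_ln_dist; auto. }
assert (Hpos : forall w : C, w <> 1 -> w <> n ->
  0 < Cmod (w - 1) ^ 2 * (k * Cmod (w - n)) ^ 2 /\ 0 < Cmod w ^ 2 + exp (v w)).
{ intros w W1 Wn; apply Cmod_minus_pos in W1; apply Cmod_minus_pos in Wn; split.
  - apply Rmult_lt_0_compat; apply pow_lt; auto; apply Rmult_lt_0_compat; auto.
  - assert (E := exp_pos (v w)); assert (S := pow2_ge_0 (Cmod w)); lra. }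
destruct (Hn 0) as [H01 H0n]; [rewrite Cmod_self; auto|].
destruct (Hpos 0 H01 H0n) as [Q1 Q2].
assert (Hharm : forall w : C, w <> 1 -> w <> n -> harmonic_at v w).
{ intros w W1 Wn; apply (harmonic_plus (fun _ => c + 2 * gamma * ln k)).
  - split; [apply cont_at_const|apply is_laplacian_const].
  - apply harmonic_plus; apply harmonic_scal, harmonic_ln_dist; auto. }
assert (Hln : forall w : C, w <> 1 -> w <> n -> ln (rho_inf w) =
  ln 4 - 2 * ln k + v w - 2 * ln (Cmod (w - 1)) - 2 * ln (Cmod (w - n)) +
    (-2) * ln (Cmod w ^ 2 + exp (v w))).
{ intros w W1 Wn; destruct (Hpos w W1 Wn) as [R1 R2].
  apply Cmod_minus_pos in W1; apply Cmod_minus_pos in Wn.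
  assert (E := exp_pos (v w)).
  assert (Hkn : 0 < k * Cmod (w - n)) by (apply Rmult_lt_0_compat; auto).
  unfold rho_inf.
  rewrite !ln_div, !ln_mult, !ln_pow, ln_mult, ln_exp
    by (try apply pow_lt; try apply Rdiv_lt_0_compat; auto; lra).
  simpl; ring. }
assert (Hlap : is_laplacian (fun w => ln 4 - 2 * ln k + v w - 2 * ln (Cmod (w - 1)) -
  2 * ln (Cmod (w - n)) + (-2) * ln (Cmod w ^ 2 + exp (v w))) 0 (0 + (-2) * (4 * exp (- v 0)))).
{ apply is_laplacian_plus.
  - apply (harmonic_minus (fun w => ln 4 - 2 * ln k + v w - 2 * ln (Cmod (w - 1)))).
    + apply (harmonic_minus (fun w => ln 4 - 2 * ln k + v w)).
      * apply (harmonic_plus (fun _ => ln 4 - 2 * ln k)); auto.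
        split; [apply cont_at_const|apply is_laplacian_const].
      * apply harmonic_scal, harmonic_ln_dist; auto.
    + apply harmonic_scal, harmonic_ln_dist; auto.
  - apply is_laplacian_scal.
    apply is_laplacian_log_metric_inf with (d := d) (g := fun w =>
      (0 + (RtoC (2 * beta) * / (w - 1) + RtoC (2 * gamma) * / (w - n)))%C); auto.
    + intros w Hw; apply Hgv; apply Hn; auto.
    + destruct (cderive_inv_shift 1 0 H01) as [l1 D1].
      destruct (cderive_inv_shift n 0 H0n) as [l2 D2].
      eexists; apply cderive_plus; [apply cderive_const|].
      apply cderive_plus; (apply (cderive_mult (fun _ => RtoC _)); [apply cderive_const|eauto]). }
assert (Hrho0 : rho_inf 0 = 4 * exp (- v 0)).
{ unfold rho_inf; rewrite Cmod_0, exp_Ropp.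
  assert (A1 : Cmod (0 - 1) = 1).
  { rewrite Cmod_minus_sym; replace (1 - 0)%C with (RtoC 1) by ring; apply Cmod_1. }
  assert (A2 : Cmod (0 - n) = / k).
  { rewrite Cmod_minus_sym; replace (n - 0)%C with n by ring.
    unfold n; rewrite Cmod_R, Rabs_Ropp, Rabs_pos_eq; auto.
    apply Rlt_le, Rinv_0_lt_compat; auto. }
  assert (E := exp_pos (v 0)); rewrite A1, A2; field; lra. }
split; [|split].
- rewrite Hrho0; assert (E := exp_pos (- v 0)); lra.
- assert (Hcv : cont_at (fun w => exp (v w)) 0).
  { apply (cont_at_comp_derive exp); [apply Hharm; auto|auto_derive; auto]. }
  assert (Hsq : forall (w : C -> C) (z : C), ccont w z -> cont_at (fun x => Cmod (w x) ^ 2) z).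
  { intros w z Hw; apply (cont_at_comp_derive (fun x => x ^ 2));
      [apply cont_at_Cmod; auto|auto_derive; auto]. }
  unfold rho_inf, Rdiv; apply cont_at_mult; [apply cont_at_mult|].
  + apply cont_at_mult; [apply cont_at_const|auto].
  + apply (cont_at_comp_derive (fun x => / x)); [|auto_derive; lra].
    apply cont_at_mult; [apply Hsq, ccont_shift|].
    apply (cont_at_comp_derive (fun x => x ^ 2)); [|auto_derive; auto].
    apply cont_at_mult; [apply cont_at_const|apply cont_at_Cmod, ccont_shift].
  + apply (cont_at_comp_derive (fun x => / x ^ 2));
      [|auto_derive; apply Rgt_not_eq; repeat apply Rmult_lt_0_compat; lra].
    apply cont_at_plus; auto; apply (Hsq (fun w => w)), ccont_id.
- eapply is_laplacian_ext_loc with (d := d); [auto| |].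
  + intros w Hw; symmetry; apply Hln; apply Hn; auto.
  + rewrite Hrho0; eapply is_laplacian_eq; [|exact Hlap]; ring.
Qed.

Lemma heart_metric : sph_conical_metric (rho_c beta gamma c)
  [(RtoC 0, 2); (RtoC 1, beta); (m, gamma)].
Proof.
destruct heart_poles_neq as [H1m H0m].
split; [|split; [|split]].
- simpl; repeat constructor; simpl; try tauto.
  + intros [E|[E|[]]]; auto; apply C1_nz; auto.
  + intros [E|[]]; auto.
- intros pa [<-|[<-|[<-|[]]]]; simpl; split; try lra.
  + apply cone_at_heart_0.
  + apply cone_at_heart_1.
  + apply cone_at_heart_m.
- intros z Hz; simpl in Hz; apply curv1_at_heart; intros E; apply Hz; auto.
- destruct heart_inf_disc as (d & Hd & Hn).
  exists rho_inf, d; split; [auto|split; [|apply curv1_at_heart_inf]].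
  intros w Hw; assert (Hw' : Cmod (w - 0) < d).
  { replace (w - 0)%C with w by ring; lra. }
  apply rho_inf_eq; try apply Hn; auto; apply Cmod_gt_0; lra.
Qed.

Lemma heart_residue_inf : simple_pole (coeff_inf (omega0 beta gamma)) (RtoC 0) (RtoC (-1)).
Proof.
destruct heart_inf_disc as (d & Hd & Hn).
assert (Hk : 0 < k) by apply heart_ratio_pos.
assert (Hk0 : RtoC k <> 0) by (intros E; apply RtoC_inj in E; lra).
exists d; split; auto.
(* This is w times the coefficient at infinity; its value at 0 is 1 / (k n) = -1. *)
exists (fun w => / (RtoC k * ((w - 1) * (w - n))))%C; split; [|split].
- intros w Hw; destruct (Hn w Hw) as [W1 Wn]; eexists; apply cderive_inv.
  + apply (cderive_mult (fun _ => RtoC k)); [apply cderive_const|].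
    apply cderive_mult; apply cderive_shift.
  + repeat apply Cmult_neq_0; auto; apply Cminus_eq_contra; auto.
- unfold n; rewrite RtoC_opp, RtoC_inv by lra.
  replace (RtoC (-1)) with (- RtoC 1)%C by (rewrite <- RtoC_opp; reflexivity).
  assert (RtoC 1 <> 0) by apply C1_nz; field; auto.
- intros w [Hw0 Hw]; destruct (Hn w Hw) as [W1 Wn].
  assert (W0 : w <> 0) by (apply Cmod_minus_neq; auto).
  assert (N1 : (w - 1)%C <> 0) by (apply Cminus_eq_contra; auto).
  assert (N2 : (w - n)%C <> 0) by (apply Cminus_eq_contra; auto).
  assert (N1' : (1 - w)%C <> 0) by (apply Cminus_eq_contra; auto).
  unfold coeff_inf; rewrite omega0_m, Cinv_minus_m by auto.
  replace (/ w - 1)%C with (- (w - 1) / w)%C by (field; auto).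
  replace (w - 0)%C with w by ring; field; auto.
Qed.

Lemma simple_pole_heart (p q : C) (r : R) : p <> q ->
  (forall z, omega0 beta gamma z = (z / ((z - p) * (z - q)))%C) ->
  (p / (p - q) = RtoC r)%C -> simple_pole (omega0 beta gamma) p (RtoC r).
Proof.
intros Hpq Hom Hr; exists (Cmod (p - q)); split; [apply Cmod_minus_pos; auto|].
exists (fun z => z / (z - q))%C; split; [|split; [auto|]].
- intros z Hz; apply neq_nearby in Hz; destruct (cderive_inv_shift q z Hz) as [l Hl].
  eexists; apply (cderive_mult (fun w => w)); [apply cderive_id|exact Hl].
- intros z [Hz1 Hz2]; apply neq_nearby in Hz2.
  assert (N1 : (z - p)%C <> 0) by (apply Cmod_gt_0; auto).
  assert (N2 : (z - q)%C <> 0) by (apply Cminus_eq_contra; auto).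
  rewrite Hom; field; auto.
Qed.

Lemma heart_character_form : character_form (rho_c beta gamma c) (omega0 beta gamma).
Proof.
destruct heart_poles_neq as [H1m H0m].
assert (Hb : RtoC beta <> 0) by (intros E; apply RtoC_inj in E; lra).
assert (Em : m = (- RtoC gamma / RtoC beta)%C).
{ unfold m; rewrite RtoC_opp, RtoC_div by lra; field; auto. }
assert (Ebg : (RtoC beta + RtoC gamma = 1)%C) by (rewrite <- RtoC_plus, Hbg; reflexivity).
assert (Hin : forall z, ~ In z [RtoC 1; m] -> z <> 1 /\ z <> m).
{ intros z Hz; simpl in Hz; split; intros E; apply Hz; auto. }
exists [RtoC 1; m], true; split; [|split].
- split; [|split; [|split]].
  + constructor; [simpl; intros [E|[]]; auto|constructor; [simpl; tauto|constructor]].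
  + intros z Hz; apply Hin in Hz; apply cderive_omega0; tauto.
  (* The residues are 1 / (1 - m) and m / (m - 1); since 1 - m = 1 / beta they are beta and
     gamma. *)
  + assert (E1 : (1 - m = / RtoC beta)%C).
    { rewrite Em; transitivity ((RtoC beta + RtoC gamma) / RtoC beta)%C; [field; auto|].
      rewrite Ebg; field; auto. }
    intros p [<-|[<-|[]]]; [exists beta|exists gamma]; (split; [lra|]).
    * apply (simple_pole_heart _ m); auto; [apply omega0_m|].
      rewrite E1; field; auto.
    * apply (simple_pole_heart _ 1); auto; [intros z; rewrite omega0_m, (Cmult_comm (z - m)); auto|].
      replace (m - 1)%C with (- (1 - m))%C by ring; rewrite E1, Em; field; auto.
  + exists (-1); split; [lra|exact heart_residue_inf].
- exists (fun z => / 2 * u z); intros x y Hxy; apply Hin in Hxy; destruct Hxy as [H1 H2].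
  assert (G := grad_scal (/ 2) _ _ _ (grad_u (x, y) H1 H2)).
  replace (RtoC (/ 2) * (2 * omega0 beta gamma (x, y)))%C with (omega0 beta gamma (x, y)) in G.
  + exact G.
  + rewrite Cmult_assoc, <- RtoC_mult, Rinv_l by lra; ring.
(* Solving u = ln (Phi / (4 - Phi)) for Phi; both its derivative in [u] and Phi (4 - Phi) / 4 equal
   sph_factor u. *)
- exists (fun z => 4 * exp (u z) / (1 + exp (u z))); split; [|split; [|exact I]].
  + intros x y Hxy; apply Hin in Hxy; destruct Hxy as [H1 H2].
    assert (E := exp_pos (u (x, y))).
    assert (D : is_derive (fun t => 4 * exp t / (1 + exp t)) (u (x, y)) (sph_factor (u (x, y)))).
    { unfold sph_factor; auto_derive; [lra|field; lra]. }
    split; [split|split].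
    * apply Rdiv_lt_0_compat; lra.
    * apply Rlt_div_l; lra.
    * apply (cont_at_comp_derive (fun t => 4 * exp t / (1 + exp t)));
        [apply cont_at_u; auto|eexists; exact D].
    * assert (G := grad_comp _ _ _ _ _ (grad_u (x, y) H1 H2) D).
      destruct G as [G1 G2]; split.
      -- eapply R_derive_eq; [|exact G1].
         generalize (omega0 beta gamma (x, y)); intros o.
         unfold sph_factor, Re; simpl; field; lra.
      -- eapply R_derive_eq; [|exact G2].
         generalize (omega0 beta gamma (x, y)); intros o.
         unfold sph_factor, Im; simpl; field; lra.
  + intros z Hz _; apply Hin in Hz; destruct Hz as [H1 H2].
    rewrite rho_c_u by auto; unfold sph_factor; assert (E := exp_pos (u z)); field; lra.
Qed.

End Existence.

Theorem theorem1p2 (beta gamma : R) :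
  0 < beta < 1 -> 0 < gamma < 1 -> beta + gamma = 1 ->
  (* any heart-shaped reducible metric, normalized as in the statement,
     is, after z |-> p z, given by omega0 and rho_c for some real c *)
  (forall (rho : C -> R) (f : C -> C) (a b : C),
     sph_conical_metric rho [(RtoC 0, 2); (a, beta); (b, gamma)] ->
     character_form rho f ->
     simple_pole (coeff_inf f) (RtoC 0) (RtoC (-1)) ->
     exists p : C, p <> RtoC 0 /\
       (forall z : C, z <> RtoC 1 -> z <> RtoC (- (gamma / beta)) ->
          Cmult p (f (Cmult p z)) = omega0 beta gamma z) /\
       exists c : R, forall z : C,
         z <> RtoC 0 -> z <> RtoC 1 -> z <> RtoC (- (gamma / beta)) ->
         (Cmod p) ^ 2 * rho (Cmult p z) = rho_c beta gamma c z) /\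
  (* conversely every c gives such a metric, with character 1-form omega0 *)
  (forall c : R,
     sph_conical_metric (rho_c beta gamma c)
       [(RtoC 0, 2); (RtoC 1, beta); (RtoC (- (gamma / beta)), gamma)] /\
     character_form (rho_c beta gamma c) (omega0 beta gamma) /\
     simple_pole (coeff_inf (omega0 beta gamma)) (RtoC 0) (RtoC (-1))).
Proof.
intros Hbeta Hgamma Hbg; split.
- intros rho f a b; apply heart_unique; auto.
- intros c; split; [|split].
  + apply heart_metric; auto.
  + apply heart_character_form; auto.
  + apply heart_residue_inf; auto.
Qed.
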